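(* Let $P_0=\begin{pmatrix} Q & S\\ S^T & R\end{pmatrix}\in\mathbb{S}^{2\nu}$ with $R\preceq0$ (blocks of size $\nu\times\nu$) and let $$\mathbf{V}=\left\{vI_k \;\middle|\; v\in\mathbb{C},\ \begin{pmatrix}I_\nu\\ vI_\nu\end{pmatrix}^{*}P_0\begin{pmatrix}I_\nu\\ vI_\nu\end{pmatrix}\succeq 0\right\}.$$ Let $\begin{pmatrix}A_\psi&B_\psi\\ C_\psi&D_\psi\end{pmatrix}\in\mathbb{R}^{(n_\psi+m_\psi)\times(n_\psi+k)}$ with $A_\psi\in\mathbb{R}^{n_\psi\times n_\psi}$ stable (Hurwitz) be given and abbreviate $J_\Psi:=\mathrm{diag}(J_\psi,J_\psi)$ for $J\in\{A,B,C,D\}$. Then the uncertain interconnection $$\begin{pmatrix}\dot x(t)\\ z(t)\end{pmatrix}=\begin{pmatrix}A&B\\ C&D\end{pmatrix}\begin{pmatrix}x(t)\\ w(t)\end{pmatrix},\quad w(t)=\Delta(z)(t),\quad t\ge0,\quad \Delta\in\mathbf{\Delta}(\mathbf{V}),$$ is robustly stable if there exist $X\in\mathbb{S}^{2n_\psi+n}$, $Y\in\mathbb{S}^{\nu n_\psi}$ and $M\in\mathbb{S}^{\nu m_\psi}$ satisfying $$\begin{pmatrix} I_\nu\otimes I_{n_\psi}&0\\ I_\nu\otimes A_\psi&I_\nu\otimes B_\psi\\ I_\nu\otimes C_\psi&I_\nu\otimes D_\psi\end{pmatrix}^T\begin{pmatrix}0&Y&0\\ Y&0&0\\ 0&0&M\end{pmatrix}\begin{pmatrix}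 I_\nu\otimes I_{n_\psi}&0\\ I_\nu\otimes A_\psi&I_\nu\otimes B_\psi\\ I_\nu\otimes C_\psi&I_\nu\otimes D_\psi\end{pmatrix}\succ0,$$ $$H^T\begin{pmatrix}0&X&0\\ X&0&0\\ 0&0&P(P_0,M)\end{pmatrix}H\prec0\quad\text{with}\quad H=\begin{pmatrix}I&0&0\\ 0&I&0\\ A_\Psi&B_\Psi\begin{pmatrix}C\\ 0\end{pmatrix}&B_\Psi\begin{pmatrix}D\\ I_k\end{pmatrix}\\ 0&A&B\\ C_\Psi&D_\Psi\begin{pmatrix}C\\ 0\end{pmatrix}&D_\Psi\begin{pmatrix}D\\ I_k\end{pmatrix}\end{pmatrix},$$ and $$X-\begin{pmatrix}P(P_0,Y)&0\\ 0&0\end{pmatrix}\succ0.$$ Here, for a symmetric matrix $S\in\mathbb{S}^{\nu p}$ (with $p=m_\psi$ for $S=M$ and $p=n_\psi$ for $S=Y$), $$P(P_0,S):=\big(I_2\otimes\mathrm{vec}(I_\nu)\otimes I_p\big)^T(P_0\otimes S)\big(I_2\otimes\mathrm{vec}(I_\nu)\otimes I_p\big).$$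
   Context: $\mathbb{S}^n$ is the set of real symmetric $n\times n$ matrices; $\otimes$ is the Kronecker product; $\mathrm{vec}(S)$ is the vectorization of the matrix $S$ (a column vector); ${}^*$ is the conjugate transpose; $L_{2e}^n$ is the space of locally square integrable functions $[0,\infty)\to\mathbb{R}^n$; $\mathrm{RH}_\infty^{m\times n}$ is the space of real rational $m\times n$ matrices without poles in the extended closed right half-plane. $A\in\mathbb{R}^{n\times n}$, $B\in\mathbb{R}^{n\times l}$, $C\in\mathbb{R}^{k\times n}$, $D\in\mathbb{R}^{k\times l}$ are given real matrices (here $l=k$). Uncertainties: $\Delta$ is a stable LTI system with input-output map $\Delta:L_{2e}^k\to L_{2e}^l$, $$\Delta(z)(t)=\int_0^tC_\Delta e^{A_\Delta(t-s)}B_\Delta z(s)\,ds+D_\Delta z(t),$$ for some real matrices $A_\Delta,B_\Delta,C_\Delta,D_\Delta$. The same symbol denotes its transfer matrix $\Delta(s)=C_\Delta(sI-A_\Delta)^{-1}B_\Delta+D_\Delta$; stability means $\Delta\in\mathrm{RH}_\infty^{l\times k}$. For $\mathbf{V}\subset\mathbb{C}^{l\times k}$, $\mathbf{\Delta}(\mathbf{V})$ is the set of all such $\Delta$ with $\Delta(i\omega)\in\mathbf{V}$ for all $\omega\in\mathbb{R}\cup\{\infty\}$. Robust stability: the interconnection is robustly stable if it is well-posed, i.e., $\det(I-DV)\ne0$ for all $V\in\mathbf{V}$, and if there exists a constant $M_0>0$ such that the state-trajectories satisfy $\lim_{t\to\infty}x(t)=0$ and $\|x(t)\|\le M_0\|x(0)\|$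 for all $t\ge0$, for all initial conditions $x(0)\in\mathbb{R}^n$ and any $\Delta\in\mathbf{\Delta}(\mathbf{V})$. *)

(* Defs.v *)
From HB Require Import structures.
From mathcomp Require Import all_boot all_order all_algebra.
From mathcomp Require Import all_classical all_reals all_analysis.
From mathcomp Require Import complex mxtens.

Set Implicit Arguments.
Unset Strict Implicit.
Unset Printing Implicit Defensive.

Import Order.TTheory GRing.Theory Num.Theory.
Import numFieldNormedType.Exports.

Local Open Scope classical_set_scope.
Local Open Scope sesquilinear_scope.
Local Open Scope complex_scope.
Local Open Scope ring_scope.

Definition cplxmx (R : realType) (m n : nat) (A : 'M[R]_(m, n)) : 'M[R[i]]_(m, n) :=
  map_mx (fun a => a%:C) A.

Definition posdefmx (R : realType) (n : nat) (A : 'M[R]_n) : Prop :=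
  A^T = A /\ forall x : 'cV[R]_n, x != 0 -> 0 < (x^T *m A *m x) 0 0.

Definition negdefmx (R : realType) (n : nat) (A : 'M[R]_n) : Prop :=
  A^T = A /\ forall x : 'cV[R]_n, x != 0 -> (x^T *m A *m x) 0 0 < 0.

Definition negsemidefmx (R : realType) (n : nat) (A : 'M[R]_n) : Prop :=
  A^T = A /\ forall x : 'cV[R]_n, (x^T *m A *m x) 0 0 <= 0.

Definition cpossemidefmx (R : realType) (n : nat) (A : 'M[R[i]]_n) : Prop :=
  A^t* = A /\ forall x : 'cV[R[i]]_n, 0 <= (x^t* *m A *m x) 0 0.

Definition hurwitz (R : realType) (n : nat) (A : 'M[R]_n) : Prop :=
  forall s : R[i], eigenvalue (cplxmx A) s -> complex.Re s < 0.

(* [mxtens_unindex] splits the index j * m + i into (j, i): [vec] stacks the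
   columns of [S], in the numbering used by the Kronecker product [*t]. *)
Definition vec (R : realType) (m n : nat) (S : 'M[R]_(m, n)) : 'cV[R]_(n * m) :=
  \col_(k < n * m) S (mxtens_unindex k).2 (mxtens_unindex k).1.

Definition mxdiag2 (R : realType) (m n : nat) (J : 'M[R]_(m, n)) :
  'M[R]_(m + m, n + n) := block_mx J 0 0 J.

Definition enorm (R : realType) (n : nat) (x : 'cV[R]_n) : R :=
  Num.sqrt (\sum_i x i 0 ^+ 2).

(* Entrywise limit of the exponential series. *)
Definition expmx (R : realType) (n : nat) (A : 'M[R]_n) : 'M[R]_n :=
  \matrix_(i, j) limn (series (fun m => (m`!%:R^-1 *: A ^+ m) i j)).

Definition mxRintegral (R : realType) (m n : nat) (a b : R) (f : R -> 'M[R]_(m, n)) :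
  'M[R]_(m, n) :=
  \matrix_(i, j) Rintegral (@lebesgue_measure R) `[a, b] (fun s => f s i j).

(* A signal on [0, oo[ is a total function on R of which only the values at
   nonnegative times are ever used. *)
Definition L2e (R : realType) (n : nat) (z : R -> 'cV[R]_n) : Prop :=
  forall i : 'I_n,
    measurable_fun (`[0, +oo[ : set R) (fun t : R => z t i 0) /\
    forall T : R, 0 <= T ->
      (@lebesgue_measure R).-integrable `[0, T] (fun t : R => (z t i 0 ^+ 2)%:E).

(* A state-space realization of an LTI system with [q] inputs and [p] outputs. *)
Record lti (R : realType) (p q : nat) := Lti {
  lti_dim : nat;
  lti_A : 'M[R]_lti_dim;
  lti_B : 'M[R]_(lti_dim, q);
  lti_C : 'M[R]_(p, lti_dim);
  lti_D : 'M[R]_(p, q) }.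

Definition lti_map (R : realType) (p q : nat) (G : lti R p q) (z : R -> 'cV[R]_q)
    (t : R) : 'cV[R]_p :=
  mxRintegral 0 t
    (fun s => lti_C G *m expmx ((t - s) *: lti_A G) *m lti_B G *m z s)
  + lti_D G *m z t.

Definition ratconst_mx (R : realType) (m n : nat) (A : 'M[R]_(m, n)) :
  'M[{fraction {poly R}}]_(m, n) := map_mx (fun a => tofrac a%:P) A.

Definition transfer (R : realType) (p q : nat) (G : lti R p q) :
  'M[{fraction {poly R}}]_(p, q) :=
  ratconst_mx (lti_C G) *m
    invmx ((tofrac 'X)%:M - ratconst_mx (lti_A G)) *m
    ratconst_mx (lti_B G)
  + ratconst_mx (lti_D G).

(* [s] is not a pole of [g], and [g] takes the value [v] at [s] (after
   cancellation of common factors). *)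
Definition rat_value (R : realType) (g : {fraction {poly R}}) (s v : R[i]) : Prop :=
  exists num den : {poly R},
    [/\ (map_poly (fun a => a%:C) den).[s] != 0,
        g = tofrac num / tofrac den &
        v = (map_poly (fun a => a%:C) num).[s] / (map_poly (fun a => a%:C) den).[s]].

(* [g] has no pole at infinity, i.e. it is proper, and takes the value [v]
   there. *)
Definition rat_value_infty (R : realType) (g : {fraction {poly R}}) (v : R[i]) : Prop :=
  exists num den : {poly R},
    [/\ den != 0, (size num <= size den)%N,
        g = tofrac num / tofrac den &
        v = (num`_(size den).-1 / lead_coef den)%:C].

Definition ratmx_value (R : realType) (p q : nat) (G : 'M[{fraction {poly R}}]_(p, q))
    (s : R[i]) (W : 'M[R[i]]_(p, q)) : Prop :=
  forall i j, rat_value (G i j) s (W i j).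

Definition ratmx_value_infty (R : realType) (p q : nat)
    (G : 'M[{fraction {poly R}}]_(p, q)) (W : 'M[R[i]]_(p, q)) : Prop :=
  forall i j, rat_value_infty (G i j) (W i j).

Definition RHoo (R : realType) (p q : nat) (G : 'M[{fraction {poly R}}]_(p, q)) : Prop :=
  (forall s : R[i], 0 <= complex.Re s -> exists W, ratmx_value G s W) /\
  (exists W, ratmx_value_infty G W).

(* The system has a stable transfer matrix; the realization itself need not be
   minimal, so [lti_A] is not required to be Hurwitz. *)
Definition uncertainty_class (R : realType) (l k : nat) (V : set 'M[R[i]]_(l, k))
    (Delta : lti R l k) : Prop :=
  [/\ RHoo (transfer Delta),
      forall omega : R, exists2 W, ratmx_value (transfer Delta) (0 +i* omega) W & V W &
      exists2 W, ratmx_value_infty (transfer Delta) W & V W].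

(* Signals in L2e are classes modulo null sets, so the algebraic relations hold
   almost everywhere; the differential equation is understood in the sense of
   Caratheodory, through its integral form. *)
Definition trajectory (R : realType) (n l k : nat)
    (A : 'M[R]_n) (B : 'M[R]_(n, l)) (C : 'M[R]_(k, n)) (D : 'M[R]_(k, l))
    (Delta : lti R l k) (x0 : 'cV[R]_n)
    (x : R -> 'cV[R]_n) (w : R -> 'cV[R]_l) (z : R -> 'cV[R]_k) : Prop :=
  [/\ L2e w /\ L2e z,
      forall i : 'I_n, {within (`[0, +oo[ : set R), continuous (fun t : R => x t i 0)},
      forall t : R, 0 <= t ->
        x t = x0 + mxRintegral 0 t (fun s => A *m x s + B *m w s),
      {ae @lebesgue_measure R, forall t, 0 <= t -> z t = C *m x t + D *m w t} &
      {ae @lebesgue_measure R, forall t, 0 <= t -> w t = lti_map Delta z t}].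

Definition well_posed (R : realType) (l k : nat) (D : 'M[R]_(k, l))
    (V : set 'M[R[i]]_(l, k)) : Prop :=
  forall W, V W -> \det (1%:M - cplxmx D *m W) != 0.

Definition robustly_stable (R : realType) (n l k : nat)
    (A : 'M[R]_n) (B : 'M[R]_(n, l)) (C : 'M[R]_(k, n)) (D : 'M[R]_(k, l))
    (V : set 'M[R[i]]_(l, k)) : Prop :=
  well_posed D V /\
  exists2 M0 : R, 0 < M0 &
    forall (x0 : 'cV[R]_n) (Delta : lti R l k), uncertainty_class V Delta ->
    forall x w z, trajectory A B C D Delta x0 x w z ->
      enorm (x t) @[t --> +oo] --> (0 : R) /\
      forall t : R, 0 <= t -> enorm (x t) <= M0 * enorm (x 0).

Definition scalar_values (R : realType) (k nu : nat) (P0 : 'M[R]_(nu + nu)) :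
    set 'M[R[i]]_k :=
  [set W | exists v : R[i], W = v%:M /\
     let I_v : 'M[R[i]]_(nu + nu, nu) := col_mx 1%:M v%:M in
     cpossemidefmx (I_v^t* *m cplxmx P0 *m I_v)].

Arguments scalar_values {R} k {nu} P0.

Lemma multP_rows (nu p : nat) : (2 * (nu * nu) * p = (nu + nu) * (nu * p))%N.
Proof. by rewrite addnn -mul2n !mulnA. Qed.

Lemma multP_cols (p : nat) : (2 * 1 * p = p + p)%N.
Proof. by rewrite muln1 mul2n addnn. Qed.

(* The cast only identifies provably equal dimensions; both sides number the
   entries lexicographically. *)
Definition multP_outer (R : realType) (nu p : nat) :
  'M[R]_((nu + nu) * (nu * p), p + p) :=
  castmx (multP_rows nu p, multP_cols p)
    ((1%:M : 'M[R]_2) *t vec (1%:M : 'M[R]_nu) *t (1%:M : 'M[R]_p)).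

Definition multP (R : realType) (nu p : nat) (P0 : 'M[R]_(nu + nu))
    (S : 'M[R]_(nu * p)) : 'M[R]_(p + p) :=
  (multP_outer R nu p)^T *m (P0 *t S) *m multP_outer R nu p.

Definition lmi_middle (R : realType) (a b : nat) (X : 'M[R]_a) (M : 'M[R]_b) :
  'M[R]_(a + (a + b)) :=
  block_mx 0 (row_mx X 0)
           (col_mx X 0) (block_mx 0 0
                                  0 M).

Definition filter_outer (R : realType) (nu k npsi mpsi : nat)
    (Apsi : 'M[R]_npsi) (Bpsi : 'M[R]_(npsi, k))
    (Cpsi : 'M[R]_(mpsi, npsi)) (Dpsi : 'M[R]_(mpsi, k)) :
  'M[R]_(nu * npsi + (nu * npsi + nu * mpsi), nu * npsi + nu * k) :=
  let I_nu : 'M[R]_nu := 1%:M in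
  col_mx (row_mx (I_nu *t (1%:M : 'M[R]_npsi)) 0)
 (col_mx (row_mx (I_nu *t Apsi) (I_nu *t Bpsi))
         (row_mx (I_nu *t Cpsi) (I_nu *t Dpsi))).

Definition system_outer (R : realType) (n k npsi mpsi : nat)
    (A : 'M[R]_n) (B : 'M[R]_(n, k)) (C : 'M[R]_(k, n)) (D : 'M[R]_k)
    (Apsi : 'M[R]_npsi) (Bpsi : 'M[R]_(npsi, k))
    (Cpsi : 'M[R]_(mpsi, npsi)) (Dpsi : 'M[R]_(mpsi, k)) :
  'M[R]_((npsi + npsi + n) + ((npsi + npsi + n) + (mpsi + mpsi)),
         npsi + npsi + n + k) :=
  let C0 : 'M[R]_(k + k, n) := col_mx C 0 in
  let DI : 'M[R]_(k + k, k) := col_mx D 1%:M in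
  let APsi := mxdiag2 Apsi in let BPsi := mxdiag2 Bpsi in
  let CPsi := mxdiag2 Cpsi in let DPsi := mxdiag2 Dpsi in
  col_mx (col_mx (row_mx (row_mx 1%:M 0) 0)
                 (row_mx (row_mx 0 1%:M) 0))
 (col_mx (col_mx (row_mx (row_mx APsi (BPsi *m C0)) (BPsi *m DI))
                 (row_mx (row_mx 0 A) B))
         (row_mx (row_mx CPsi (DPsi *m C0)) (DPsi *m DI))).

(* Main.v *)
Require Import Defs.
From HB Require Import structures.
From mathcomp Require Import all_boot all_order all_algebra.
From mathcomp Require Import all_classical all_reals all_analysis.
From mathcomp Require Import complex mxtens measurable_realfun.
From mathcomp Require Import ring lra zify.

Set Implicit Arguments.
Unset Strict Implicit.
Unset Printing Implicit Defensive.

Import Order.TTheory GRing.Theory Num.Theory.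
Import numFieldNormedType.Exports.

Local Open Scope ring_scope.

(** The proof is a dissipation argument in the time domain. Along the filtered
    interconnection, with filter states [xz] and [xw] driven by [z] and [w], the
    second matrix inequality says that the storage given by [X], supplied through
    the multiplier [multP P0 M], decreases strictly. The multiplier integral may
    well be negative; what bounds it is a storage function of the uncertainty,
    which the first matrix inequality provides.

    A square root of the first matrix inequality turns the multiplier supply, up
    to the derivative of the terminal cost [multP P0 Y], into a finite sum
    [\sum_c s_c^T P0 s_c] (lemma [filter_channels]). Each [s_c] stacks a signal
    [p_c] with [nu] components, a linear output of the filter driven by [z], and
    the same output of the filter driven by [w]. As the uncertainty is a scalar
    transfer function times the identity, it commutes with the filter, so the
    second half of [s_c] is the scalar uncertainty applied to [p_c] (lemma
    [uncertainty_channels]). Moving the terminal cost to the left changes [X]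
    into [Xt = X - diag (multP P0 Y, 0)], which is positive definite by the third
    matrix inequality (lemma [interconnection_dissipation]).

    It remains to see that the channels store a nonnegative energy. The values of
    the scalar transfer function on the imaginary axis and at infinity lie in the
    region defined by [P0], which is a frequency inequality for the quadratic form
    of [P0]. The Kalman-Yakubovich-Popov lemma (lemma [kyp]) converts it into a
    storage function [Z], for the supply increased by an arbitrarily small
    multiple [e] of the squared norm; in this form it holds for every linear
    system, controllable or not, and follows from compactness and convex
    separation. Since the lower right block of [P0] is negative semidefinite, the
    zero input response is never supplied energy, and a comparison of Lyapunov
    functions of the stable state matrix gives [Z >= - e L] with [L] independent
    of [e] (lemma [kyp_hurwitz]).

    The given realization of the uncertainty may be unstable although its transfer
    matrix is stable. The storage function is therefore built on the companion
    realization of the reduced fraction, which has the same Markov parameters,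
    hence the same impulse response (lemmas [uncertainty_realization] and
    [impulse_eq]).

    Integration over [0, T] and [e -> 0] give, for the stacked state [xs],
    [xs(T)^T Xt xs(T) + e0 \int_0^T (|xs|^2 + |w|^2) <= xs(0)^T Xt xs(0)], where
    the filter states vanish at time zero. This bounds [|x(T)|] by a multiple of
    [|x(0)|] that depends neither on the trajectory nor on the uncertainty, and it
    makes [x] and its derivative square integrable, so [x] tends to zero (lemma
    [l2_decay]). All signals are differentiated in the sense of Lebesgue; the
    calculus rests on a product rule deduced from Fubini's theorem. Well-posedness
    is the same dissipation inequality at the zero state, applied to the real and
    imaginary parts of a kernel vector of [1 - D W]. *)

(** * Real quadratic forms *)

Definition bf (R : realType) (m n : nat) (M : 'M[R]_(m, n))
  (x : 'cV[R]_m) (y : 'cV[R]_n) : R := (x^T *m M *m y) 0 0.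

Definition sqn (R : realType) (n : nat) (x : 'cV[R]_n) : R := bf 1%:M x x.

Section QuadraticForms.
Variable R : realType.

Lemma bfE m n (M : 'M[R]_(m, n)) x y :
  bf M x y = \sum_i \sum_j x i 0 * M i j * y j 0.
Proof.
rewrite /bf mxE exchange_big /=; apply: eq_bigr => j _.
by rewrite mxE big_distrl /=; apply: eq_bigr => i _; rewrite mxE.
Qed.

Lemma bf_tr m n (M : 'M[R]_(m, n)) x y : bf M^T y x = bf M x y.
Proof.
rewrite /bf; have -> : y^T *m M^T *m x = (x^T *m M *m y)^T.
  by rewrite !trmx_mul trmxK mulmxA.
by rewrite mxE.
Qed.

Lemma bfDr m n (M : 'M[R]_(m, n)) x y z : bf M x (y + z) = bf M x y + bf M x z.
Proof. by rewrite /bf mulmxDr mxE. Qed.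
Lemma bfZr m n (M : 'M[R]_(m, n)) x a y : bf M x (a *: y) = a * bf M x y.
Proof. by rewrite /bf -scalemxAr mxE. Qed.
Lemma bfDl m n (M : 'M[R]_(m, n)) x y z : bf M (x + y) z = bf M x z + bf M y z.
Proof. by rewrite -bf_tr bfDr !bf_tr. Qed.
Lemma bfZl m n (M : 'M[R]_(m, n)) a x z : bf M (a *: x) z = a * bf M x z.
Proof. by rewrite -bf_tr bfZr !bf_tr. Qed.
Lemma bf0r m n (M : 'M[R]_(m, n)) x : bf M x 0 = 0.
Proof. by rewrite -(scale0r 0) bfZr mul0r. Qed.
Lemma bf0l m n (M : 'M[R]_(m, n)) x : bf M 0 x = 0.
Proof. by rewrite -(scale0r 0) bfZl mul0r. Qed.
Lemma bf_addm m n (M N : 'M[R]_(m, n)) x y : bf (M + N) x y = bf M x y + bf N x y.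
Proof. by rewrite /bf mulmxDr mulmxDl mxE. Qed.
Lemma bf_scalem m n a (M : 'M[R]_(m, n)) x y : bf (a *: M) x y = a * bf M x y.
Proof. by rewrite /bf -scalemxAr -scalemxAl mxE. Qed.
Lemma bf_oppm m n (M : 'M[R]_(m, n)) x y : bf (- M) x y = - bf M x y.
Proof. by rewrite -scaleN1r bf_scalem mulN1r. Qed.
Lemma bf_subm m n (M N : 'M[R]_(m, n)) x y : bf (M - N) x y = bf M x y - bf N x y.
Proof. by rewrite bf_addm bf_oppm. Qed.
Lemma bf_0m m n x y : bf (0 : 'M[R]_(m, n)) x y = 0.
Proof. by rewrite /bf mulmx0 mul0mx mxE. Qed.
Lemma bf_mul m n p q (A : 'M[R]_(m, n)) (M : 'M[R]_(m, p)) (B : 'M[R]_(p, q)) x y :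
  bf (A^T *m M *m B) x y = bf M (A *m x) (B *m y).
Proof. by rewrite /bf trmx_mul !mulmxA. Qed.
Lemma bf_mulr m p q (M : 'M[R]_(m, p)) (B : 'M[R]_(p, q)) x y :
  bf (M *m B) x y = bf M x (B *m y).
Proof. by rewrite /bf !mulmxA. Qed.

Lemma bf_sym n (M : 'M[R]_n) x y : M^T = M -> bf M x y = bf M y x.
Proof. by move=> Ms; rewrite -bf_tr Ms. Qed.

Lemma bf_block m1 m2 n1 n2 (A : 'M[R]_(m1, n1)) B C (D : 'M[R]_(m2, n2)) x1 x2 y1 y2 :
  bf (block_mx A B C D) (col_mx x1 x2) (col_mx y1 y2) =
  bf A x1 y1 + bf B x1 y2 + (bf C x2 y1 + bf D x2 y2).
Proof.
rewrite /bf tr_col_mx mul_row_block mul_row_col !mulmxDl !mxE.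
by rewrite addrACA.
Qed.

Lemma sqnE n (x : 'cV[R]_n) : sqn x = \sum_i x i 0 ^+ 2.
Proof.
by rewrite /sqn /bf mulmx1 mxE; apply: eq_bigr => i _; rewrite mxE expr2.
Qed.

Lemma sqn_ge0 n (x : 'cV[R]_n) : 0 <= sqn x.
Proof. by rewrite sqnE sumr_ge0 // => i _; rewrite sqr_ge0. Qed.

Lemma sqn_eq0 n (x : 'cV[R]_n) : (sqn x == 0) = (x == 0).
Proof.
apply/eqP/eqP => [|->]; last by rewrite /sqn bf0l.
rewrite sqnE => /eqP; rewrite psumr_eq0 => [/allP h|i _]; last exact: sqr_ge0.
apply/colP => i; rewrite mxE; have /implyP := h i (mem_index_enum _).
by move=> /(_ isT); rewrite sqrf_eq0 => /eqP.
Qed.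

Lemma sqn_gt0 n (x : 'cV[R]_n) : (0 < sqn x) = (x != 0).
Proof. by rewrite lt_def sqn_ge0 andbT sqn_eq0. Qed.

Lemma sqn_col_mx m n (x : 'cV[R]_m) (y : 'cV[R]_n) :
  sqn (col_mx x y) = sqn x + sqn y.
Proof.
rewrite !sqnE big_split_ord /=; congr (_ + _); apply: eq_bigr => i _.
  by rewrite col_mxEu.
by rewrite col_mxEd.
Qed.

Lemma bf_gram m n (F : 'M[R]_(m, n)) x : bf (F^T *m F) x x = sqn (F *m x).
Proof. by rewrite /sqn -bf_mul mulmx1. Qed.

Lemma bf_bound m n (M : 'M[R]_(m, n)) :
  exists2 c, 0 < c & forall x y, `|bf M x y| <= c * (sqn x + sqn y).
Proof.
exists (1 + \sum_i \sum_j `|M i j|).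
  by rewrite ltr_pwDl // sumr_ge0 // => i _; rewrite sumr_ge0.
move=> x y; rewrite mulrDl mul1r.
apply: (@le_trans _ _ ((\sum_i \sum_j `|M i j|) * (sqn x + sqn y))); last first.
  by rewrite lerDr addr_ge0 // sqn_ge0.
rewrite bfE mulr_suml (le_trans (ler_norm_sum _ _ _)) //.
apply: ler_sum => i _; rewrite mulr_suml (le_trans (ler_norm_sum _ _ _)) //.
apply: ler_sum => j _; rewrite mulrAC mulrC normrM ler_wpM2l //.
have hx : x i 0 ^+ 2 <= sqn x.
  rewrite sqnE (bigD1 i) //= lerDl sumr_ge0 // => k _; exact: sqr_ge0.
have hy : y j 0 ^+ 2 <= sqn y.
  rewrite sqnE (bigD1 j) //= lerDl sumr_ge0 // => k _; exact: sqr_ge0.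
apply: le_trans (lerD hx hy).
rewrite ler_norml; nra.
Qed.

Definition psd n (M : 'M[R]_n) := M^T = M /\ forall x, 0 <= bf M x x.

(** Cholesky factorization, by taking Schur complements one coordinate at a
    time. *)
Lemma psd_factor n (M : 'M[R]_n) : psd M -> exists F : 'M[R]_n, M = F^T *m F.
Proof.
elim: n => [|n IHn] in M *.
  by move=> _; exists 0; apply/matrixP => -[].
move: M; rewrite -add1n => M [Ms Mp].
pose a := M 0 0; pose b : 'cV[R]_n := dlsubmx M; pose M' := drsubmx M.
have Ma : ulsubmx M = a%:M.
  by rewrite [LHS]mx11_scalar; congr (_%:M); rewrite !mxE; congr (M _ _); apply/val_inj.
have Mb : ursubmx M = b^T by rewrite /b trmx_dlsub Ms.
have ME : M = block_mx a%:M b^T b M' by rewrite -Ma -Mb submxK.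
have M's : M'^T = M' by rewrite /M' trmx_drsub Ms.
have form (t : R) (y : 'cV[R]_n) :
    bf M (col_mx t%:M y) (col_mx t%:M y) = a * t ^+ 2 + 2 * t * (b^T *m y) 0 0 + bf M' y y.
  rewrite ME bf_block -[bf b _ _]bf_tr.
  have -> : bf a%:M t%:M t%:M = a * t ^+ 2.
    by rewrite /bf tr_scalar_mx -!scalar_mxM mxE mulr1n; ring.
  have -> : bf b^T t%:M y = t * (b^T *m y) 0 0.
    by rewrite /bf tr_scalar_mx mul_scalar_mx -scalemxAl mxE.
  by ring.
have form_ge0 t y : 0 <= a * t ^+ 2 + 2 * t * (b^T *m y) 0 0 + bf M' y y.
  by rewrite -form.
have a_ge0 : 0 <= a.
  by have := form_ge0 1 0; rewrite mulmx0 mxE /= bf0r mulr0 !addr0 expr1n mulr1.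
have [a0|a_neq0] := eqVneq a 0.
  have b0 : b = 0.
    apply/colP => i; rewrite [RHS]mxE; apply/eqP/negP => /negP bi.
    pose y : 'cV[R]_n := delta_mx i 0.
    have := form_ge0 (- (bf M' y y + 1) / (2 * b i 0)) y.
    have -> : (b^T *m y) 0 0 = b i 0 by rewrite -colE !mxE.
    have -> : 2 * (- (bf M' y y + 1) / (2 * b i 0)) * b i 0 = - (bf M' y y + 1).
      by field.
    by rewrite a0; lra.
  have [|F FE] := IHn M'.
    split=> // y; have := form_ge0 0 y; by rewrite expr0n /= !(mulr0, mul0r, add0r).
  exists (block_mx 0 0 0 F); rewrite ME tr_block_mx mulmx_block.
  rewrite b0 a0 !trmx0 !(mulmx0, mul0mx) !addr0 !add0r FE; congr block_mx.
  by apply/matrixP => i j; rewrite !mxE mul0rn.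
have a_gt0 : 0 < a by rewrite lt_def a_neq0.
have [|F FE] := IHn (M' - a^-1 *: (b *m b^T)).
  split; first by rewrite linearB linearZ /= trmx_mul trmxK M's.
  move=> y; have := form_ge0 (- a^-1 * (b^T *m y) 0 0) y.
  rewrite bf_subm bf_scalem.
  have -> : bf (b *m b^T) y y = (b^T *m y) 0 0 ^+ 2.
    rewrite /bf mulmxA -mulmxA mxE big_ord1 expr2; congr (_ * _).
    by rewrite -[b^T *m y]trmxK trmx_mul trmxK [RHS]mxE.
  suff -> : a * (- a^-1 * (b^T *m y) 0 0) ^+ 2 +
     2 * (- a^-1 * (b^T *m y) 0 0) * (b^T *m y) 0 0 + bf M' y y =
     bf M' y y - a^-1 * (b^T *m y) 0 0 ^+ 2 by [].
  by field.
pose s := Num.sqrt a.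
have s0 : s != 0 by rewrite sqrtr_eq0 -ltNge.
have ss : s ^+ 2 = a by rewrite sqr_sqrtr.
exists (block_mx s%:M (s^-1 *: b^T) 0 F); rewrite ME tr_block_mx mulmx_block.
rewrite !trmx0 !(mulmx0, mul0mx) !addr0 tr_scalar_mx -scalar_mxM -expr2 ss.
have -> : (s^-1 *: b^T)^T = s^-1 *: b by apply/matrixP => i j; rewrite !mxE.
rewrite mul_scalar_mx mul_mx_scalar !scalerA mulfV // !scale1r.
congr block_mx; rewrite -FE -scalemxAl -scalemxAr scalerA -invfM -expr2 ss.
by rewrite addrC subrK.
Qed.

Lemma posdef_psd n (M : 'M[R]_n) : posdefmx M -> psd M.
Proof.
move=> [Ms Mp]; split=> // x; have [->|x0] := eqVneq x 0; first by rewrite bf0l.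
exact/ltW/Mp.
Qed.

Lemma posdef_coercive n (M : 'M[R]_n) : posdefmx M ->
  exists2 e, 0 < e & forall x, e * sqn x <= bf M x x.
Proof.
move=> Mp; have [F FE] := psd_factor (posdef_psd Mp).
have Funit : F \in unitmx.
  rewrite -unitmx_tr -row_free_unit -kermx_eq0; apply/eqP/row_matrixP => i.
  rewrite row0; apply/eqP/negP => /negP k0.
  pose y := (row i (kermx F^T))^T.
  have y0 : y != 0 by rewrite trmx_eq0.
  have := Mp.2 y y0; rewrite -/(bf M y y) FE bf_gram.
  have -> : F *m y = 0.
    by apply: trmx_inj; rewrite trmx_mul trmxK trmx0 -row_mul mulmx_ker row0.
  by rewrite /sqn bf0l ltxx.
have [c c0 cP] := bf_bound ((invmx F)^T *m invmx F).
exists (2 * c)^-1; first by rewrite invr_gt0 mulr_gt0.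
move=> x; rewrite FE bf_gram mulrC ler_pdivrMr ?mulr_gt0 //.
have := cP (F *m x) (F *m x).
rewrite bf_gram mulKmx // ger0_norm ?sqn_ge0 //; lra.
Qed.

End QuadraticForms.

(** * Spectral decomposition of skew-symmetric matrices *)

Section SkewSpectral.
Local Open Scope sesquilinear_scope.
Local Open Scope complex_scope.
Local Open Scope ring_scope.
Variable R : realType.

Lemma Re_sum (I : finType) (F : I -> R[i]) :
  complex.Re (\sum_i F i) = \sum_i complex.Re (F i).
Proof. by rewrite raddf_sum. Qed.
Lemma Im_sum (I : finType) (F : I -> R[i]) :
  complex.Im (\sum_i F i) = \sum_i complex.Im (F i).
Proof. by rewrite raddf_sum. Qed.
Lemma Re_scale (r : R) (z : R[i]) : complex.Re (r%:C * z) = r * complex.Re z.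
Proof. by case: z => x y /=; ring. Qed.
Lemma Im_scale (r : R) (z : R[i]) : complex.Im (r%:C * z) = r * complex.Im z.
Proof. by case: z => x y /=; ring. Qed.

(** Real form of the spectral theorem for [Om]: the columns of [a + i b] are an
    orthonormal basis of eigenvectors, and the last identity is the real part of
    the completeness relation. *)
Lemma skew_spectral n (Om : 'M[R]_n) : Om^T = - Om ->
  exists (a b : 'M[R]_n) (w : 'rV[R]_n),
    [/\ Om *m a = - (b *m diag_mx w), Om *m b = a *m diag_mx w &
        a *m a^T + b *m b^T = 1%:M].
Proof.
move=> Os; pose M : 'M[R[i]]_n := 'i *: cplxmx Om.
have Mh : M \is hermsymmx.
  apply/is_hermitianmxP; rewrite expr0 scale1r; apply/matrixP => i j.
  rewrite !mxE; have := congr1 (fun X : 'M[R]_n => X j i) Os; rewrite !mxE => ->.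
  by apply/eqP; rewrite eq_complex /=; apply/andP; split; apply/eqP; ring.
have Dr := hermitian_spectral_diag_real Mh.
have /orthomx_spectralP := hermitian_normalmx Mh.
have Pu := spectral_unitarymx M.
set P := spectralmx M in Pu *; set D := spectral_diag M in Dr *.
rewrite invmx_unitary // => ME.
set V := P^t* in ME.
have VM : M *m V = V *m diag_mx D.
  by rewrite ME -!mulmxA [P *m V](unitarymxP Pu) mulmx1.
have VV : V *m P = 1%:M by rewrite /V -(invmx_unitary Pu) mulVmx // unitarymx_unit.
pose a := map_mx (@complex.Re R) V; pose b := map_mx (@complex.Im R) V.
pose w := map_mx (fun z => - complex.Re z) D.
have DE j : D 0 j = (complex.Re (D 0 j))%:C.
  by have /mxOverP/(_ 0 j)/complex_realP[r ->] := Dr.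
exists a, b, w.
have E i j : \sum_k (Om i k * a k j) = - (b *m diag_mx w) i j /\
             \sum_k (Om i k * b k j) = (a *m diag_mx w) i j.
  have := congr1 (fun X : 'M[R[i]]_n => X i j) VM.
  rewrite -[M *m V]scalemxAl !mul_mx_diag !mxE DE => /eqP; rewrite eq_complex.
  have -> : \sum_k (cplxmx Om) i k * V k j =
      (\sum_k Om i k * a k j) +i* (\sum_k Om i k * b k j).
    apply/eqP; rewrite eq_complex /= Re_sum Im_sum.
    by apply/andP; split; apply/eqP; apply: eq_bigr => k _;
       rewrite !mxE ?Re_scale ?Im_scale.
  move: (Num.conj (P j i)) (\sum_k _) (\sum_k _) => [v v'] p q.
  case: (D 0 j) => d d' /=.
  by move=> /andP[/eqP h1 /eqP h2]; split; lra.
split.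
- by apply/matrixP => i j; rewrite mxE (E i j).1 [RHS]mxE.
- by apply/matrixP => i j; rewrite mxE (E i j).2.
- apply/matrixP => i j; have := congr1 (fun X : 'M[R[i]]_n => complex.Re (X i j)) VV.
  rewrite !mxE Re_sum -big_split /=.
  have -> : complex.Re ((i == j)%:R : R[i]) = (i == j)%:R by case: eqP.
  move=> <-; apply: eq_bigr => k _; rewrite !mxE.
  by case: (P k i) => x y; case: (P k j) => x' y' /=; ring.
Qed.

End SkewSpectral.

(** * The Kalman-Yakubovich-Popov lemma *)

Section KYP.
Variable R : realType.

Lemma gram_unit r n (A : 'M[R]_(r, n)) : row_free A -> A *m A^T \in unitmx.
Proof.
move=> Af; rewrite -row_free_unit -kermx_eq0; apply/eqP/row_matrixP => i.
rewrite row0; set u := row i _.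
have uk : u *m (A *m A^T) = 0 by rewrite /u -row_mul mulmx_ker row0.
have : sqn ((u *m A)^T) = 0.
  rewrite /sqn /bf mulmx1 trmxK trmx_mul !mulmxA.
  by rewrite -(mulmxA u) uk mul0mx mxE.
move/eqP; rewrite sqn_eq0 trmx_eq0 => /eqP uA.
by apply: (row_free_inj Af); rewrite uA mul0mx.
Qed.

(** Half of the Moore-Penrose conditions suffices to make [K A] the orthogonal
    projection on the row space of [A]; [K] comes from a rank factorization. *)
Lemma pseudo_inverse m n (A : 'M[R]_(m, n)) :
  exists K : 'M[R]_(n, m), (K *m A)^T = K *m A /\ A *m K *m A = A.
Proof.
have [r [E [F [AE Ef Ff]]]] : exists r (E : 'M[R]_(m, r)) (F : 'M[R]_(r, n)),
    [/\ A = E *m F, row_full E & row_free F].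
  exists (\rank A), (col_base A), (row_base A).
  by rewrite mulmx_base col_base_full row_base_free.
have Su : F *m F^T \in unitmx by exact: gram_unit.
have [E' Ev] : exists E', E' *m E = 1%:M by exists (pinvmx E); rewrite mulVpmx.
exists (F^T *m invmx (F *m F^T) *m E').
have KA : F^T *m invmx (F *m F^T) *m E' *m A = F^T *m invmx (F *m F^T) *m F.
  by rewrite {1}AE -!mulmxA (mulmxA E') Ev mul1mx.
rewrite -[A *m _ *m A]mulmxA KA; split.
  by rewrite !trmx_mul trmx_inv trmx_mul !trmxK mulmxA.
by rewrite {1}AE -!mulmxA (mulmxA F) (mulmxA (F *m F^T)) mulmxV // mul1mx -AE.
Qed.

(** With [K] the pseudo-inverse of [F] and [Pi = K F] the projection on its row
    space, take [Om = K G Pi]: the hypothesis that [G F^T] is skew-symmetric is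
    what allows [G Pi] to be factored through [F]. *)
Lemma skew_factor m n (F G : 'M[R]_(m, n)) : G *m F^T + F *m G^T = 0 ->
  exists Pi Om : 'M[R]_n,
    [/\ Pi^T = Pi, Pi *m Pi = Pi, Om^T = - Om, F *m Pi = F & G *m Pi = F *m Om].
Proof.
move=> /eqP; rewrite addr_eq0 => /eqP GF.
have [K [Ks FKF]] := pseudo_inverse F.
have KF : F^T *m K^T = K *m F by rewrite -trmx_mul.
exists (K *m F), (K *m G *m (K *m F)); split=> //.
- by rewrite mulmxA -(mulmxA K) -mulmxA FKF.
- rewrite -{1}KF !trmx_mul !trmxK !mulmxA -[K *m F *m G^T]mulmxA.
  have -> : F *m G^T = - (G *m F^T) by rewrite GF opprK.
  by rewrite mulmxN mulNmx -!mulmxA KF.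
- by rewrite mulmxA FKF.
- rewrite -KF (mulmxA (K *m G)) -(mulmxA K G) (mulmxA G) GF.
  by rewrite !(mulmxN, mulNmx) !mulmxA FKF.
Qed.

Lemma trace_gram n p (T : 'M[R]_n) (V : 'M[R]_(n, p)) :
  \tr (T *m (V *m V^T)) = \sum_j bf T (col j V) (col j V).
Proof.
rewrite mulmxA mxtrace_mulC mulmxA /mxtrace; apply: eq_bigr => j _.
rewrite /bf tr_col -row_mul mxE [RHS]mxE.
by apply: eq_bigr => k _; rewrite !mxE.
Qed.

(** Nonnegativity of the quadratic form [T] along the complex solutions of
    [i w x = A x + B u] and at [x = 0] (the frequency [w = oo]), with real and
    imaginary parts written out. *)
Definition freq_ineq m l (A : 'M[R]_m) (B : 'M[R]_(m, l)) (T : 'M[R]_(m + l)) :=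
  (forall w xa xb ua ub, A *m xa + B *m ua = - (w *: xb) ->
     A *m xb + B *m ub = w *: xa ->
     0 <= bf T (col_mx xa ua) (col_mx xa ua) + bf T (col_mx xb ub) (col_mx xb ub)) /\
  (forall u, 0 <= bf T (col_mx 0 u) (col_mx 0 u)).

(** A positive semidefinite [F F^T] that is stationary for the system is a sum of
    rank one terms, each one supported at a single frequency. *)
Lemma stationary_ge0 m l p (A : 'M[R]_m) (B : 'M[R]_(m, l)) T (F : 'M[R]_(m + l, p)) :
  freq_ineq A B T ->
  let F1 := usubmx F in let G := row_mx A B *m F in
  G *m F1^T + F1 *m G^T = 0 -> 0 <= \tr (T *m (F *m F^T)).
Proof.
move=> [fin foo] F1 G GF.
have [Pi [Om [Pis Pi2 Oms FPi GPi]]] := skew_factor GF.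
have [a [b [w [Oa Ob ab1]]]] := skew_spectral Oms.
have split_col (v : 'cV_p) : F *m v = col_mx (F1 *m v) (dsubmx F *m v).
  by rewrite -mul_col_mx vsubmxK.
have colM q r (N : 'M[R]_(q, p)) (V : 'M[R]_(p, r)) j : col j (N *m V) = N *m col j V.
  by rewrite !colE mulmxA.
have GE (v : 'cV_p) : G *m v = A *m (F1 *m v) + B *m (dsubmx F *m v).
  by rewrite /G -mulmxA split_col mul_row_col.
pose Q := 1%:M - Pi.
have QQ : Q *m Q^T = Q.
  have -> : Q^T = Q by rewrite /Q raddfB /= trmx1 Pis.
  by rewrite mulmxBr mulmx1 mulmxBl mul1mx Pi2 subrr subr0.
have -> : F *m F^T = F *m Q *m (F *m Q)^T +
    (F *m (Pi *m a) *m (F *m (Pi *m a))^T + F *m (Pi *m b) *m (F *m (Pi *m b))^T).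
  have gram (V : 'M[R]_p) : F *m V *m (F *m V)^T = F *m (V *m V^T) *m F^T.
    by rewrite trmx_mul !mulmxA.
  have gramPi (V : 'M[R]_p) : (Pi *m V) *m (Pi *m V)^T = Pi *m (V *m V^T) *m Pi.
    by rewrite trmx_mul Pis !mulmxA.
  rewrite !gram -!mulmxDl -!mulmxDr QQ !gramPi -mulmxDl -mulmxDr ab1 mulmx1 Pi2.
  by rewrite /Q subrK mulmx1.
have col_eig (V : 'M[R]_p) j : col j (V *m diag_mx w) = w 0 j *: col j V.
  by apply/colP => i; rewrite mul_mx_diag !mxE mulrC.
rewrite !(mulmxDr T) !mxtraceD !trace_gram -big_split /=; apply: addr_ge0.
  apply: sumr_ge0 => j _; rewrite colM split_col -[F1 *m _]colM.
  have -> : F1 *m Q = 0 by rewrite mulmxBr mulmx1 FPi subrr.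
  by rewrite colE mul0mx.
have F1Pi j (V : 'M[R]_p) : F1 *m col j (Pi *m V) = F1 *m col j V.
  by rewrite -!colM mulmxA FPi.
have GPiE j (V : 'M[R]_p) : G *m col j (Pi *m V) = F1 *m col j (Om *m V).
  by rewrite -!colM !mulmxA GPi.
apply: sumr_ge0 => j _; rewrite !(colM _ _ F) !split_col; apply: (fin (w 0 j)).
  rewrite -GE !F1Pi GPiE Oa.
  have -> : col j (- (b *m diag_mx w)) = - (w 0 j *: col j b).
    by rewrite -col_eig; apply/colP => i; rewrite [LHS]mxE [RHS]mxE !mxE.
  by rewrite mulmxN scalemxAr.
by rewrite -GE !F1Pi GPiE Ob col_eig -scalemxAr.
Qed.

End KYP.

Section KYPMin.
Variable R : realType.

Definition cont_mx (T : topologicalType) m n (f : T -> 'M[R]_(m, n)) :=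
  forall i j, continuous (fun t => f t i j).

Section ContMx.
Variable T : topologicalType.

Lemma continuous_sum (I : Type) (r : seq I) (F : I -> T -> R) :
  (forall i, continuous (F i)) -> continuous (fun t => \sum_(i <- r) F i t).
Proof.
move=> Fc; elim: r => [|i r IH] t.
  under eq_fun do rewrite big_nil; exact: cst_continuous.
under eq_fun do rewrite big_cons; apply: continuousD; [exact: Fc|exact: IH].
Qed.

Lemma continuous_add (f g : T -> R) :
  continuous f -> continuous g -> continuous (fun t => f t + g t).
Proof. by move=> fc gc t; apply: continuousD; [exact: fc|exact: gc]. Qed.

Lemma continuous_mul (f g : T -> R) :
  continuous f -> continuous g -> continuous (fun t => f t * g t).
Proof. by move=> fc gc t; apply: continuousM; [exact: fc|exact: gc]. Qed.

Lemma continuous_norm (f : T -> R) :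
  continuous f -> continuous (fun t => `|f t|).
Proof. by move=> fc t; apply: cvg_norm; exact: fc. Qed.

Lemma cont_mx_cst m n (A : 'M[R]_(m, n)) : cont_mx (fun _ : T => A).
Proof. by move=> i j t; exact: cst_continuous. Qed.

Lemma cont_mx_mul m n p (f : T -> 'M[R]_(m, n)) (g : T -> 'M[R]_(n, p)) :
  cont_mx f -> cont_mx g -> cont_mx (fun t => f t *m g t).
Proof.
move=> fc gc i j; under eq_fun do rewrite mxE.
apply: continuous_sum => k t; apply: continuousM; [exact: fc|exact: gc].
Qed.

Lemma cont_mx_add m n (f g : T -> 'M[R]_(m, n)) :
  cont_mx f -> cont_mx g -> cont_mx (fun t => f t + g t).
Proof.
move=> fc gc i j; under eq_fun do rewrite mxE.
by move=> t; apply: continuousD; [exact: fc|exact: gc].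
Qed.

Lemma cont_mx_tr m n (f : T -> 'M[R]_(m, n)) :
  cont_mx f -> cont_mx (fun t => (f t)^T).
Proof. by move=> fc i j; under eq_fun do rewrite mxE; exact: fc. Qed.

Lemma continuous_trace n (f : T -> 'M[R]_n) :
  cont_mx f -> continuous (fun t => \tr (f t)).
Proof. by move=> fc; apply: continuous_sum => i; exact: fc. Qed.

End ContMx.

Lemma cont_vec_mx m n : cont_mx (@vec_mx R m n).
Proof.
move=> i j; under eq_fun do rewrite mxE; exact: coord_continuous.
Qed.

(** The square matrices [F] of Frobenius norm one parametrize the positive
    semidefinite matrices [F F^T] of trace one over which [kyp] minimizes. *)
Lemma min_unit_sphere n (f : 'M[R]_n -> R) : (0 < n)%N ->
  continuous (fun v : 'rV[R]_(n * n) => f (vec_mx v)) ->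
  exists2 F : 'M[R]_n, \tr (F *m F^T) = 1 &
    forall G, \tr (G *m G^T) = 1 -> f F <= f G.
Proof.
move=> n0 fc.
pose nrm (v : 'rV[R]_(n * n)) : R := \tr (vec_mx v *m (vec_mx v : 'M[R]_n)^T).
have nrmE (F : 'M[R]_n) : \tr (F *m F^T) = \sum_i \sum_j F i j ^+ 2.
  by apply: eq_bigr => i _; rewrite mxE; apply: eq_bigr => j _; rewrite mxE expr2.
pose K : set 'rV[R]_(n * n) := [set v | nrm v = 1]%classic.
have Kcl : closed K.
  apply: (@closed_comp _ _ nrm [set 1]%classic).
    move=> v _; apply: continuous_trace; apply: cont_mx_mul; first exact: cont_vec_mx.
    exact/cont_mx_tr/cont_vec_mx.
  exact: closed_eq.
have Kb : bounded_set K.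
  exists 1; split=> // M M1 v Kv /=; apply: le_trans (ltW M1).
  rewrite [leLHS]mx_normrE; apply: bigmax_le => // -[l k] _ /=.
  rewrite ord1; case/mxvec_indexP: k => i j.
  have -> : v 0 (mxvec_index i j) = (vec_mx v : 'M[R]_n) i j by rewrite mxE.
  move: Kv; rewrite /K /nrm /= nrmE => Kv.
  rewrite -(@expr_le1 _ 2) // real_normK ?num_real // -Kv (bigD1 i) //= (bigD1 j) //= -addrA lerDl.
  by rewrite addr_ge0 ?sumr_ge0 // => *; rewrite ?sumr_ge0 // => *; exact: sqr_ge0.
have n0' : n%:R != 0 :> R by rewrite pnatr_eq0 -lt0n.
have K0 : (K !=set0)%classic.
  pose i0 := Ordinal n0; exists (mxvec (delta_mx i0 i0)).
  rewrite /K /nrm /= mxvecK trmx_delta mul_delta_mx /mxtrace (bigD1 i0) //=.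
  by rewrite mxE !eqxx big1 ?addr0 // => i /negbTE ii0; rewrite mxE ii0.
have [v vK vmin] := @compact_EVT_min _ R (fun v => f (vec_mx v)) K K0
   (bounded_closed_compact Kb Kcl) (continuous_subspaceT fc).
exists (vec_mx v); first by move: vK; rewrite inE.
move=> G GK; have := vmin (mxvec G); rewrite mxvecK; apply.
by rewrite inE /K /nrm /= mxvecK.
Qed.

(** First order optimality of [t = 0] for the squared norm along a segment, [Q]
    being the inner product of the two ends. *)
Lemma quadratic_min (P Q S : R) :
  (forall t, 0 <= t <= 1 -> P <= (1 - t) ^+ 2 * P + 2 * t * (1 - t) * Q + t ^+ 2 * S) ->
  P <= Q.
Proof.
move=> h; rewrite leNgt; apply/negP => QP.
pose d := P - Q; pose e := `|P - 2 * Q + S| + d + 1.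
have d0 : 0 < d by rewrite subr_gt0.
have e0 : 0 < e by rewrite /e ltr_pwDr // addr_ge0 // ltW.
have te : d / e * e = d by rewrite divfK // gt_eqF.
have t0 : 0 < d / e by rewrite divr_gt0.
have t1 : d / e <= 1.
  rewrite ler_pdivrMr // mul1r /e; have := normr_ge0 (P - 2 * Q + S); lra.
have := h (d / e); rewrite (ltW t0) t1 => /(_ isT).
move: (d / e) te t0 t1 => t te t0 t1.
have : t * (P - 2 * Q + S) <= t * e.
  rewrite ler_wpM2l ?(ltW t0) // (le_trans (ler_norm _)) // /e; lra.
rewrite te; have -> : (1 - t) ^+ 2 * P + 2 * t * (1 - t) * Q + t ^+ 2 * S =
  P + t * (t * (P - 2 * Q + S) - 2 * d) by rewrite /d; ring.
move=> h1; rewrite lerDl pmulr_rge0 // => h2; lra.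
Qed.

Section Frequency.
Variables (m l : nat) (A : 'M[R]_m) (B : 'M[R]_(m, l)).

Let E : 'M[R]_(m, m + l) := row_mx A B.
Let J : 'M[R]_(m, m + l) := row_mx 1%:M 0.
Let L (W : 'M[R]_(m + l)) := E *m W *m J^T + J *m W *m E^T.
Let inner (P Q : 'M[R]_m) := \tr (P^T *m Q).

Let inner_sqr P : inner P P = \sum_i \sum_j P i j ^+ 2.
Proof.
rewrite /inner /mxtrace exchange_big /=; apply: eq_bigr => i _; rewrite mxE.
by apply: eq_bigr => j _; rewrite mxE expr2.
Qed.

Let inner_rank1 (Z : 'M[R]_m) (v : 'cV_(m + l)) : Z^T = Z ->
  inner Z (L (v *m v^T)) = 2 * bf Z (J *m v) (E *m v).
Proof.
move=> Zs; rewrite /inner /L Zs mulmxDr mxtraceD.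
have tr1 (x y : 'cV[R]_m) : \tr (Z *m (x *m y^T)) = bf Z y x.
  by rewrite mulmxA mxtrace_mulC mulmxA /mxtrace big_ord1.
have -> : E *m (v *m v^T) *m J^T = (E *m v) *m (J *m v)^T.
  by rewrite trmx_mul !mulmxA.
have -> : J *m (v *m v^T) *m E^T = (J *m v) *m (E *m v)^T.
  by rewrite trmx_mul !mulmxA.
by rewrite !tr1 (bf_sym _ _ Zs); ring.
Qed.

Let L_sym W : W^T = W -> (L W)^T = L W.
Proof. by move=> Ws; rewrite /L raddfD /= !trmx_mul !trmxK Ws !mulmxA addrC. Qed.

Let L_lin s t V W : L (s *: V + t *: W) = s *: L V + t *: L W.
Proof.
rewrite /L !mulmxDr !mulmxDl -!scalemxAr -!scalemxAl !scalerDr.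
by rewrite addrACA.
Qed.

Let innerDr P Q S s t : inner P (s *: Q + t *: S) = s * inner P Q + t * inner P S.
Proof. by rewrite /inner mulmxDr mxtraceD -!scalemxAr !mxtraceZ. Qed.
Let inner_tr P Q : inner P Q = inner Q P.
Proof. by rewrite /inner -mxtrace_tr trmx_mul trmxK. Qed.
Let inner_comb s t P Q : inner (s *: P + t *: Q) (s *: P + t *: Q) =
  s ^+ 2 * inner P P + 2 * t * s * inner P Q + t ^+ 2 * inner Q Q.
Proof.
rewrite innerDr inner_tr (inner_tr _ Q) !innerDr (inner_tr Q P); ring.
Qed.

(** Existence of a storage function, by minimizing over the trace one positive
    semidefinite [W] the distance of [(L W, <T + e I, W>)] to the ray
    [{0} x ]-oo, 0]]. By [stationary_ge0] this distance is positive, and the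
    minimizer separates the two convex sets: the part of the separating functional
    that acts on [L W] is, up to a factor, the storage matrix. *)
Lemma kyp (T : 'M[R]_(m + l)) : freq_ineq A B T ->
  forall e, 0 < e -> exists2 Z : 'M[R]_m, Z^T = Z &
    forall x u, 2 * bf Z x (A *m x + B *m u) <=
      bf T (col_mx x u) (col_mx x u) + e * (sqn x + sqn u).
Proof.
move=> fdi e e0.
suff [Z Zs ZP] : exists2 Z : 'M[R]_m, Z^T = Z &
    forall v, 2 * bf Z (J *m v) (E *m v) <= bf T v v + e * sqn v.
  exists Z => // x u; have := ZP (col_mx x u).
  by rewrite /J /E !mul_row_col mul1mx mul0mx addr0 sqn_col_mx.
case: (posnP (m + l)%N) => [ml0|ml0].
  exists 0; first exact: trmx0.
  move=> v; have -> : v = 0 by apply/colP => i; have := ltn_ord i; rewrite {2}ml0.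
  by rewrite /sqn !mulmx0 !bf0r !mulr0 addr0.
pose tW (W : 'M[R]_(m + l)) := \tr (T *m W) + e * \tr W.
pose rho (F : 'M[R]_(m + l)) := let W := F *m F^T in
  inner (L W) (L W) + Num.max 0 (tW W) ^+ 2.
have rho_cont : continuous (fun v : 'rV[R]_((m + l) * (m + l)) => rho (vec_mx v)).
  have FF : cont_mx (fun v : 'rV[R]_((m + l) * (m + l)) => (vec_mx v : 'M[R]_(m + l)) *m (vec_mx v)^T).
    by apply: cont_mx_mul; [|apply: cont_mx_tr]; exact: cont_vec_mx.
  have cL : cont_mx (fun v : 'rV[R]_((m + l) * (m + l)) => L ((vec_mx v : 'M[R]_(m + l)) *m (vec_mx v)^T)).
    apply: cont_mx_add; apply: cont_mx_mul; try exact: cont_mx_cst;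
      by apply: cont_mx_mul => //; exact: cont_mx_cst.
  have ct : continuous (fun v : 'rV[R]_((m + l) * (m + l)) => tW ((vec_mx v : 'M[R]_(m + l)) *m (vec_mx v)^T)).
    have c1 : continuous (fun v : 'rV[R]_((m + l) * (m + l)) => \tr (T *m ((vec_mx v : 'M[R]_(m + l)) *m (vec_mx v)^T))).
      by apply: continuous_trace; apply: cont_mx_mul => //; exact: cont_mx_cst.
    have c2 := continuous_trace FF.
    apply: continuous_add; first exact: c1.
    by apply: continuous_mul; [exact: cst_continuous|exact: c2].
  have ci : continuous (fun v : 'rV[R]_((m + l) * (m + l)) =>
      inner (L ((vec_mx v : 'M[R]_(m + l)) *m (vec_mx v)^T)) (L ((vec_mx v : 'M[R]_(m + l)) *m (vec_mx v)^T))).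
    by apply: continuous_trace; apply: cont_mx_mul => //; exact: cont_mx_tr.
  have cm : continuous (fun v : 'rV[R]_((m + l) * (m + l)) =>
      Num.max 0 (tW ((vec_mx v : 'M[R]_(m + l)) *m (vec_mx v)^T))).
    under eq_fun do rewrite maxr_absE sub0r normrN add0r.
    apply: continuous_mul; last exact: cst_continuous.
    by apply: continuous_add; [exact: ct|exact: continuous_norm].
  apply: continuous_add; first exact: ci.
  by under eq_fun do rewrite expr2; exact: continuous_mul.
have [F trF Fmin] := min_unit_sphere ml0 rho_cont.
pose W0 := F *m F^T; pose Z0 := L W0; pose tau := Num.max 0 (tW W0).
have W0s : W0^T = W0 by rewrite trmx_mul trmxK.
have Z0s : Z0^T = Z0 by exact: L_sym.
have tau0 : 0 <= tau by rewrite le_max lexx.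
(* At distance zero [W0] would be stationary with [<T, W0> <= - e]. *)
have rho_gt0 : 0 < rho F.
  have i0 : 0 <= inner Z0 Z0.
    by rewrite inner_sqr sumr_ge0 // => i _; rewrite sumr_ge0 // => j _; rewrite sqr_ge0.
  rewrite /rho /= -/W0 -/Z0 -/tau lt_def addr_ge0 ?sqr_ge0 // andbT paddr_eq0 ?sqr_ge0 //.
  apply/negP => /andP[Z00]; rewrite sqrf_eq0 => /eqP tau00.
  have Z0E : Z0 = 0.
    apply/matrixP => i j; rewrite [RHS]mxE; move: Z00; rewrite inner_sqr psumr_eq0.
      move=> /allP/(_ i (mem_index_enum _)) /=; rewrite psumr_eq0 => [|k _]; last exact: sqr_ge0.
      by move=> /allP/(_ j (mem_index_enum _)) /=; rewrite sqrf_eq0 => /eqP.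
    by move=> k _; rewrite sumr_ge0 // => k' _; exact: sqr_ge0.
  have /= := @stationary_ge0 R m l _ A B T F fdi.
  have -> : usubmx F = J *m F.
    by rewrite /J -{2}(vsubmxK F) mul_row_col mul1mx mul0mx addr0.
  rewrite -/E; have -> : E *m F *m (J *m F)^T + J *m F *m (E *m F)^T = 0.
    by rewrite -Z0E /Z0 /L /W0 !trmx_mul !mulmxA.
  move=> /(_ erefl) T0.
  have : tW W0 <= 0 by rewrite -tau00 le_max lexx orbT.
  by rewrite /tW trF mulr1; rewrite -/W0 in T0 *; lra.
(* Optimality of [W0] in the direction of the rank one matrix [W1]. *)
have var v : v != 0 ->
    rho F * sqn v <= 2 * bf Z0 (J *m v) (E *m v) + tau * (bf T v v + e * sqn v).
  move=> v0; have sv : 0 < sqn v by rewrite sqn_gt0.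
  pose W1 := (sqn v)^-1 *: (v *m v^T).
  have trv (M : 'M[R]_(m + l)) : \tr (M *m (v *m v^T)) = bf M v v.
    by rewrite mulmxA mxtrace_mulC mulmxA /mxtrace big_ord1.
  have tr1 : \tr W1 = 1.
    by rewrite mxtraceZ -[v *m v^T]mul1mx trv -/(sqn v) mulVf ?gt_eqF.
  have tW1 : tW W1 = (sqn v)^-1 * bf T v v + e by rewrite /tW tr1 -scalemxAr mxtraceZ trv mulr1.
  suff : rho F <= inner Z0 (L W1) + tau * tW W1.
    have -> : L W1 = (sqn v)^-1 *: L (v *m v^T).
      by have := L_lin (sqn v)^-1 0 (v *m v^T) 0; rewrite !scale0r !addr0.
    have -> : inner Z0 ((sqn v)^-1 *: L (v *m v^T)) = (sqn v)^-1 * inner Z0 (L (v *m v^T)).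
      by rewrite /inner -scalemxAr mxtraceZ.
    rewrite inner_rank1 // tW1 -(ler_pM2r sv) => /le_trans; apply.
    rewrite le_eqVlt; apply/orP; left; by apply/eqP; field; rewrite gt_eqF.
  apply: (@quadratic_min _ _ (inner (L W1) (L W1) + tW W1 ^+ 2)) => t /andP[t0 t1].
  pose Wt := (1 - t) *: W0 + t *: W1.
  have Wtp : psd Wt^T.
    split.
      rewrite trmxK /Wt raddfD /= !linearZ /= W0s trmx_mul trmxK //.
    move=> x; rewrite bf_tr /Wt bf_addm !bf_scalem addr_ge0 //.
      by rewrite mulr_ge0 ?subr_ge0 // /W0 -{1}[F]trmxK bf_gram sqn_ge0.
    rewrite !mulr_ge0 ?invr_ge0 ?(ltW sv) //.
    by rewrite -{1}[v]trmxK bf_gram sqn_ge0.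
  have [G GE] := psd_factor Wtp.
  have WtE : Wt = G^T *m (G^T)^T by rewrite -[Wt]trmxK GE trmx_mul.
  have tW0 : \tr W0 = 1 by [].
  have tWt : tW Wt = (1 - t) * tW W0 + t * tW W1.
    by rewrite /tW /Wt mulmxDr !mxtraceD -!scalemxAr !mxtraceZ; ring.
  have trWt : \tr (G^T *m (G^T)^T) = 1.
    by rewrite -WtE /Wt mxtraceD (mxtraceZ _ W0) (mxtraceZ _ W1) tW0 tr1; ring.
  apply: (le_trans (Fmin _ trWt)).
  rewrite /rho /= -!WtE -/W0 -/tau -/Z0.
  have -> : inner (L Wt) (L Wt) = (1 - t) ^+ 2 * inner Z0 Z0 +
      2 * t * (1 - t) * inner Z0 (L W1) + t ^+ 2 * inner (L W1) (L W1).
    have -> : L Wt = (1 - t) *: Z0 + t *: L W1 by exact: L_lin.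
    exact: inner_comb.
  have : Num.max 0 (tW Wt) ^+ 2 <= ((1 - t) * tau + t * tW W1) ^+ 2.
    have le1 : tW Wt <= (1 - t) * tau + t * tW W1.
      by rewrite tWt lerD2r ler_wpM2l ?subr_ge0 // le_max lexx orbT.
    case: (leP (tW Wt) 0) => h; first by rewrite expr0n /= sqr_ge0.
    by rewrite ler_sqr ?nnegrE ?(ltW h) // (le_trans (ltW h)).
  move=> h; rewrite (le_trans (lerD (lexx _) h)) // le_eqVlt; apply/orP; left.
  by apply/eqP; ring.
have [tau00|tau_neq0] := eqVneq tau 0; last first.
  have tau_gt0 : 0 < tau by rewrite lt_def tau_neq0.
  exists (- tau^-1 *: Z0) => [|v]; first by rewrite linearZ /= Z0s.
  have [->|v0] := eqVneq v 0; first by rewrite /sqn !mulmx0 !bf0r !mulr0 addr0.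
  have := var v v0; rewrite bf_scalem => h.
  rewrite -(ler_pM2l tau_gt0).
  have -> : tau * (2 * (- tau^-1 * bf Z0 (J *m v) (E *m v))) = - (2 * bf Z0 (J *m v) (E *m v)).
    by field.
  have : 0 <= rho F * sqn v by rewrite mulr_ge0 ?sqn_ge0 // ltW.
  lra.
(* Here the separating functional only sees [L W], so [Z0] is strictly
   dissipative and a large multiple of it dominates [T]. *)
have [c c0 cP] := bf_bound T.
pose k := 2 * c / rho F.
exists (- k *: Z0) => [|v]; first by rewrite linearZ /= Z0s.
have [->|v0] := eqVneq v 0; first by rewrite /sqn !mulmx0 !bf0r !mulr0 addr0.
have := var v v0; rewrite tau00 mul0r addr0 => h.
have k0 : 0 <= k by rewrite divr_ge0 ?mulr_ge0 // ltW.
have := ler_wpM2l k0 h; rewrite {1}/k mulrA divfK ?gt_eqF // bf_scalem => h1.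
have := cP v v; rewrite ler_norml => /andP[h2 _].
have := sqn_ge0 v; have : 0 <= e * sqn v by rewrite mulr_ge0 ?sqn_ge0 // ltW.
lra.
Qed.

End Frequency.

End KYPMin.

(** * Lyapunov functions of Hurwitz matrices *)

Section Lyapunov.
Variable R : realType.

(** [A] has no complex eigenvalue [t + i w] with [0 <= t], the eigenvector being
    [xa + i xb]. *)
Definition hurwitz_real n (A : 'M[R]_n) := forall t w (xa xb : 'cV[R]_n), 0 <= t ->
  A *m xa = t *: xa - w *: xb -> A *m xb = t *: xb + w *: xa -> xa = 0 /\ xb = 0.

Lemma psd_null n (M : 'M[R]_n) x : psd M -> bf M x x = 0 -> M *m x = 0.
Proof.
move=> /psd_factor[F ->]; rewrite bf_gram => /eqP; rewrite sqn_eq0 => /eqP Fx.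
by rewrite -mulmxA Fx mulmx0.
Qed.

Lemma bf_upper n (M : 'M[R]_n) : exists2 c, 0 < c & forall x, `|bf M x x| <= c * sqn x.
Proof.
have [c c0 cP] := bf_bound M; exists (2 * c); first by rewrite mulr_gt0.
by move=> x; apply: le_trans (cP x x) _; rewrite le_eqVlt; apply/orP; left; apply/eqP; ring.
Qed.

(** Sliding [K + s L] along the positive definite [L]: the first [s] at which
    semidefiniteness is lost leaves a kernel vector, on which the Lyapunov
    inequalities contradict each other unless [s = 0]. *)
Lemma lyapunov_compare n (A L K : 'M[R]_n) : posdefmx L ->
  (forall x, x != 0 -> bf L x (A *m x) < 0) ->
  K^T = K -> (forall x, bf K x (A *m x) <= 0) -> forall x, 0 <= bf K x x.
Proof.
move=> Lp LA Ks KA.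
pose S : set R := [set s | 0 <= s /\ forall x, 0 <= bf K x x + s * bf L x x]%classic.
have [e e0 eP] := posdef_coercive Lp.
have [c c0 cP] := bf_upper K.
have [d d0 dP] := bf_upper L.
have S0 : (S !=set0)%classic.
  exists (c / e); split=> [|x]; first by rewrite divr_ge0 // ltW.
  have := cP x; rewrite ler_norml => /andP[h _].
  have : c / e * (e * sqn x) <= c / e * bf L x x by rewrite ler_wpM2l // divr_ge0 // ltW.
  rewrite mulrA divfK ?gt_eqF //; lra.
have Slb : has_lbound S by exists 0 => s [].
have Sinf : has_inf S by [].
pose s := inf S.
have s0 : 0 <= s by apply: lb_le_inf => // t [].
have Ss x : 0 <= bf K x x + s * bf L x x.
  rewrite leNgt; apply/negP => h.
  have [|t [t0 tP] ts] := @inf_adherent _ S (- (bf K x x + s * bf L x x) / (d * sqn x + 1)) _ Sinf.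
    by rewrite divr_gt0 ?oppr_gt0 // ltr_wpDl // mulr_ge0 ?sqn_ge0 // ltW.
  have := tP x; have := dP x; rewrite ler_norml => /andP[_ h2].
  have ds : 0 < d * sqn x + 1 by rewrite ltr_wpDl // mulr_ge0 ?sqn_ge0 // ltW.
  have L0 : 0 <= bf L x x by apply: (posdef_psd Lp).2.
  move: ts; rewrite -/s -ltrBlDl ltr_pdivlMr // => h3 h4.
  have st : s <= t by apply: ge_inf => //.
  have : (t - s) * bf L x x <= (t - s) * (d * sqn x + 1).
    by rewrite ler_wpM2l ?subr_ge0 // (le_trans h2) // lerDl.
  lra.
have [s_eq0|s_neq0] := eqVneq s 0.
  by move=> x; have := Ss x; rewrite s_eq0 mul0r addr0.
have s_gt0 : 0 < s by rewrite lt_def s_neq0.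
pose M := K + s *: L.
have ME x y : bf M x y = bf K x y + s * bf L x y by rewrite bf_addm bf_scalem.
have Mpsd : psd M.
  split; first by rewrite /M raddfD /= linearZ /= Ks Lp.1.
  by move=> x; rewrite ME.
have Mp : posdefmx M.
  split; first exact: Mpsd.1.
  move=> x x0; rewrite lt_def -/(bf M x x) Mpsd.2 andbT; apply/eqP => h.
  have := psd_null Mpsd h => Mx.
  have : bf M (A *m x) x = 0 by rewrite -[x in bf _ _ x]mul1mx /bf -mulmxA mul1mx Mx mulmx0 mxE.
  rewrite (bf_sym _ _ Mpsd.1) ME => h1.
  have := KA x; have := LA x x0; rewrite -(pmulr_rlt0 _ s_gt0); lra.
have [e' e'0 e'P] := posdef_coercive Mp.
pose h := Num.min s (e' / d).
have h0 : 0 < h by rewrite lt_min s_gt0 divr_gt0.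
suff : S (s - h) by move=> /(ge_inf Slb); rewrite -/s; lra.
split=> [|x]; first by rewrite subr_ge0 ge_min lexx.
have := e'P x; rewrite ME; have := dP x; rewrite ler_norml => /andP[_ h1].
have : h * bf L x x <= e' / d * (d * sqn x).
  apply: le_trans (_ : h * (d * sqn x) <= _).
    by rewrite ler_wpM2l // ltW.
  by rewrite ler_wpM2r ?mulr_ge0 ?sqn_ge0 ?(ltW d0) // ge_min lexx orbT.
rewrite mulrA divfK ?gt_eqF //; lra.
Qed.

Lemma hurwitz_real_shift n (A : 'M[R]_n) s : hurwitz_real A -> 0 <= s ->
  hurwitz_real (A - s%:M).
Proof.
move=> hA s0 t w xa xb t0; rewrite !mulmxBl !mul_scalar_mx => ha hb.
apply: (hA (t + s) w); first exact: addr_ge0.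
  by move/eqP: ha; rewrite subr_eq => /eqP ->; rewrite scalerDl addrAC.
by move/eqP: hb; rewrite subr_eq => /eqP ->; rewrite scalerDl addrAC.
Qed.

(** The lemma [kyp] with no input, the frequency inequality being vacuous for
    want of imaginary eigenvalues. The storage found need not be positive. *)
Lemma hurwitz_storage n (A : 'M[R]_n) : hurwitz_real A ->
  exists2 Z : 'M[R]_n, Z^T = Z & forall x, bf Z x (A *m x) <= - sqn x.
Proof.
move=> hA; pose T : 'M[R]_(n + 0) := (- 3)%:M.
have TE x (u : 'cV[R]_0) : bf T (col_mx x u) (col_mx x u) = - 3 * sqn x.
  rewrite /T -scalemx1 bf_scalem -/(sqn _) sqn_col_mx [sqn u]sqnE big_ord0.
  by rewrite addr0.
have fdi : freq_ineq A (0 : 'M[R]_(n, 0)) T.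
  split=> [w xa xb ua ub|u]; last by rewrite TE /sqn bf0r mulr0.
  rewrite !mul0mx !addr0 => ha hb.
  have ha' : A *m xa = 0 *: xa - w *: xb by rewrite ha scale0r sub0r.
  have hb' : A *m xb = 0 *: xb + w *: xa by rewrite hb scale0r add0r.
  have [-> ->] := hA 0 w xa xb (lexx _) ha' hb'.
  by rewrite !TE /sqn !bf0r !mulr0 addr0.
have [Z Zs ZP] := kyp fdi ltr01; exists Z => // x.
have := ZP x 0; rewrite TE mulmx0 addr0 [sqn (0 : 'cV[R]_0)]sqnE big_ord0; lra.
Qed.

(** Homotopy along [A - s I]: the identity is a Lyapunov matrix for large [s], and
    the set of [s >= 0] that admit a positive definite one is open, and closed
    because [lyapunov_compare] with a neighbouring [s + h] makes the storage of
    [hurwitz_storage] at [s] positive. So it contains [0]. *)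
Lemma lyapunov_pd n (A : 'M[R]_n) : hurwitz_real A ->
  exists2 L : 'M[R]_n, posdefmx L & forall x, bf L x (A *m x) <= - sqn x.
Proof.
move=> hA.
pose P (s : R) := exists2 L : 'M[R]_n, posdefmx L &
  forall x, bf L x (A *m x) - s * bf L x x <= - sqn x.
suff [L Lp LP] : P 0 by exists L => // x; have := LP x; rewrite mul0r subr0.
have Pmono s s' : s <= s' -> P s -> P s'.
  move=> ss [L Lp LP]; exists L => // x; apply: le_trans (LP x).
  by rewrite lerD2l lerN2 ler_wpM2r // (posdef_psd Lp).2.
have Pbig : exists2 s, 0 <= s & P s.
  have [c c0 cP] := bf_upper A.
  exists (c + 1); first by rewrite addr_ge0 // ltW.
  exists 1%:M.
    by split; [exact: trmx1 | move=> x x0; rewrite -/(bf _ _ _) -/(sqn x) sqn_gt0].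
  move=> x; rewrite -bf_mulr mul1mx -/(sqn x).
  have := cP x; rewrite ler_norml => /andP[_]; lra.
have Pleft s : P s -> exists2 h, 0 < h & P (s - h).
  move=> [L Lp LP]; have [d d0 dP] := bf_upper L.
  exists (2 * d)^-1; first by rewrite invr_gt0 mulr_gt0.
  exists (2 *: L).
    split; first by rewrite linearZ /= Lp.1.
    by move=> x x0; rewrite -/(bf _ _ _) bf_scalem mulr_gt0 //; exact: Lp.2.
  move=> x; rewrite !bf_scalem; have := LP x; have := dP x.
  rewrite ler_norml => /andP[_ h1].
  have : (2 * d)^-1 * (2 * bf L x x) <= sqn x.
    by rewrite ler_pdivrMl ?mulr_gt0 // -mulrA ler_pM2l.
  lra.
have Pright s : 0 <= s -> exists2 h, 0 < h & (P (s + h) -> P s).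
  move=> s0; have [Z Zs ZP] := hurwitz_storage (hurwitz_real_shift hA s0).
  have ZP' x : bf Z x (A *m x) - s * bf Z x x <= - sqn x.
    by have := ZP x; rewrite mulmxBl mul_scalar_mx -scaleNr bfDr bfZr mulNr.
  have [d d0 dP] := bf_upper Z.
  exists (2 * d)^-1; first by rewrite invr_gt0 mulr_gt0.
  move=> [L Lp LP]; exists Z => //.
  have Zpsd : psd Z.
    split=> //; apply: (@lyapunov_compare _ (A - (s + (2 * d)^-1)%:M) _ _ Lp) => //.
      move=> x x0; rewrite mulmxBl mul_scalar_mx -scaleNr bfDr bfZr mulNr.
      by apply: le_lt_trans (LP x) _; rewrite oppr_lt0 sqn_gt0.
    move=> x; rewrite mulmxBl mul_scalar_mx -scaleNr bfDr bfZr mulNr.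
    have := ZP' x; have := dP x; rewrite ler_norml => /andP[h1 _].
    have : - sqn x <= (2 * d)^-1 * (2 * bf Z x x).
      by rewrite ler_pdivlMl ?mulr_gt0 //; lra.
    have := sqn_ge0 x; lra.
  split=> // x x0; rewrite -/(bf Z x x) lt_def Zpsd.2 andbT; apply/eqP => h.
  have Zx := psd_null Zpsd h.
  have := ZP' x; rewrite h mulr0 subr0 (bf_sym _ _ Zs).
  have -> : bf Z (A *m x) x = 0 by rewrite /bf -mulmxA Zx mulmx0 mxE.
  by rewrite oppr_ge0 leNgt sqn_gt0 x0.
pose S : set R := [set s | 0 <= s /\ P s]%classic.
have S0 : (S !=set0)%classic by have [s s0 Ps] := Pbig; exists s.
have Slb : has_lbound S by exists 0 => s [].
have s0 : 0 <= inf S by apply: lb_le_inf => // t [].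
have [h h0 hP] := Pright _ s0.
have Ps : P (inf S).
  apply: hP; have [t [t0 Pt] th] := inf_adherent h0 (conj S0 Slb).
  exact: Pmono (ltW th) Pt.
have [<-//|s_neq0] := eqVneq (inf S) 0.
have s_gt0 : 0 < inf S by rewrite lt_def s_neq0.
have [h' h'0 Ph'] := Pleft _ Ps.
have : inf S <= Num.max 0 (inf S - h').
  apply: ge_inf => //; split; first by rewrite le_max lexx.
  by apply: Pmono Ph'; rewrite le_max lexx orbT.
by rewrite le_max => /orP[|]; lra.
Qed.

(** Without input the storage [Z] of [kyp] decreases up to [e |x|^2], which the
    decrease of [e L] absorbs; so [lyapunov_compare] applies to [Z + e L]. *)
Lemma kyp_hurwitz m l (A : 'M[R]_m) (B : 'M[R]_(m, l)) (T : 'M[R]_(m + l)) :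
  hurwitz_real A -> freq_ineq A B T ->
  (forall x, bf T (col_mx x 0) (col_mx x 0) <= 0) ->
  exists2 L : 'M[R]_m, posdefmx L &
    forall e, 0 < e -> exists2 Z : 'M[R]_m, Z^T = Z &
      (forall x u, 2 * bf Z x (A *m x + B *m u) <=
         bf T (col_mx x u) (col_mx x u) + e * (sqn x + sqn u)) /\
      (forall x, - (e * bf L x x) <= bf Z x x).
Proof.
move=> hA fdi T0; have [L Lp LP] := lyapunov_pd hA; exists L => // e e0.
have [Z Zs ZP] := kyp fdi e0; exists Z => //; split=> // x.
suff : 0 <= bf (Z + e *: L) x x by rewrite bf_addm bf_scalem; lra.
apply: (@lyapunov_compare _ A L) => // [y y0||y].
- by apply: le_lt_trans (LP y) _; rewrite oppr_lt0 sqn_gt0.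
- by rewrite raddfD /= linearZ /= Zs Lp.1.
have := ZP y 0; rewrite mulmx0 addr0 bf_addm bf_scalem {2}/sqn bf0r addr0.
have := ler_wpM2l (ltW e0) (LP y); have := T0 y.
have : 0 <= e * sqn y by rewrite mulr_ge0 ?sqn_ge0 // ltW.
lra.
Qed.

End Lyapunov.

(** * Complex vectors and the uncertainty region *)

Section ComplexForms.
Local Open Scope sesquilinear_scope.
Local Open Scope complex_scope.
Local Open Scope ring_scope.
Variable R : realType.

Definition cmx m n (a b : 'M[R]_(m, n)) : 'M[R[i]]_(m, n) :=
  \matrix_(i, j) (a i j +i* b i j).

Lemma cmx_inj m n (a b a' b' : 'M[R]_(m, n)) : cmx a b = cmx a' b' -> a = a' /\ b = b'.
Proof.
move=> h; split; apply/matrixP => i j;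
  by have := congr1 (fun X : 'M[R[i]]_(m, n) => X i j) h; rewrite !mxE => -[].
Qed.

Lemma cmxP m n (X : 'M[R[i]]_(m, n)) :
  X = cmx (map_mx (@complex.Re R) X) (map_mx (@complex.Im R) X).
Proof. by apply/matrixP => i j; rewrite !mxE; case: (X i j). Qed.

Lemma cplxmx_mul_cmx m n p (M : 'M[R]_(m, n)) (a b : 'M[R]_(n, p)) :
  cplxmx M *m cmx a b = cmx (M *m a) (M *m b).
Proof.
apply/matrixP => i j; rewrite !mxE; apply/eqP.
rewrite eq_complex /= Re_sum Im_sum; apply/andP; split; apply/eqP;
  by apply: eq_bigr => k _; rewrite !mxE ?Re_scale ?Im_scale.
Qed.

Lemma cmxD m n (a b a' b' : 'M[R]_(m, n)) :
  cmx a b + cmx a' b' = cmx (a + a') (b + b').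
Proof. by apply/matrixP => i j; rewrite !mxE. Qed.

Lemma cmxZ m n t w (a b : 'M[R]_(m, n)) :
  (t +i* w) *: cmx a b = cmx (t *: a - w *: b) (t *: b + w *: a).
Proof. by apply/matrixP => i j; rewrite !mxE; congr (_ +i* _); ring. Qed.

Lemma Re_form n (P : 'M[R]_n) (a b : 'cV[R]_n) :
  complex.Re (((cmx a b)^t* *m cplxmx P *m cmx a b) 0 0) = bf P a a + bf P b b.
Proof.
rewrite -mulmxA cplxmx_mul_cmx mxE Re_sum /bf -!mulmxA !mxE -big_split /=.
by apply: eq_bigr => i _; rewrite !mxE /=; ring.
Qed.

(** The condition on [v] in [scalar_values k P0], which does not involve [k]. *)
Definition in_region nu (P0 : 'M[R]_(nu + nu)) (v : R[i]) :=
  let I_v : 'M[R[i]]_(nu + nu, nu) := col_mx 1%:M v%:M in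
  cpossemidefmx (I_v^t* *m cplxmx P0 *m I_v).

Lemma in_region_real nu (P0 : 'M[R]_(nu + nu)) v (ua ub qa qb : 'cV[R]_nu) :
  in_region P0 v -> cmx qa qb = v *: cmx ua ub ->
  0 <= bf P0 (col_mx ua qa) (col_mx ua qa) + bf P0 (col_mx ub qb) (col_mx ub qb).
Proof.
move=> [_ /(_ (cmx ua ub)) h] q; rewrite -Re_form.
have E : col_mx 1%:M v%:M *m cmx ua ub = cmx (col_mx ua qa) (col_mx ub qb).
  rewrite mul_col_mx mul1mx mul_scalar_mx -q; apply/matrixP => i j.
  by rewrite !mxE; case: splitP => i' _; rewrite !mxE.
move: h; rewrite lecE => /andP[_ /=]; rewrite -E trmx_mul map_mxM !mulmxA //.
Qed.

End ComplexForms.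

(** * Markov parameters and transfer functions *)

Section Markov.
Variable F : fieldType.

(** [v / chi] is the solution [(X - A)^-1 b] over the rational functions. *)
Definition resolvent n (A : 'M[F]_n) (b : 'cV[F]_n) (chi : {poly F})
    (v : 'cV[{poly F}]_n) :=
  'X *: v = chi *: map_mx polyC b + map_mx polyC A *m v.

(** At an entry of [v] of largest degree, [X v = chi b + A v] can hold only if
    [chi b] raises the degree by one. *)
Lemma resolvent_size n (A : 'M[F]_n) b (chi : {poly F}) v : chi != 0 -> resolvent A b chi v ->
  forall i, (size (v i 0%R) < size chi)%N.
Proof.
move=> chi0 rv.
pose M := (\max_i size (v i 0%R))%N.
suff Mlt : (M < size chi)%N.
  by move=> i; apply: leq_ltn_trans Mlt; exact: (bigop.leq_bigmax).
rewrite ltnNge; apply/negP => chiM.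
have M0 : (0 < M)%N by apply: leq_trans chiM; rewrite size_poly_gt0.
have [i iM] : exists i, size (v i 0) = M.
  have n0 : (0 < #|'I_n|)%N.
    rewrite card_ord lt0n; apply/eqP => n0; move: M0.
    by rewrite /M big1 // => i; have := ltn_ord i; rewrite {2}n0.
  by have [i iM] := @bigop.eq_bigmax _ (fun i => size (v i 0%R)) n0; exists i; rewrite -iM.
have vi0 : v i 0 != 0 by rewrite -size_poly_gt0 iM.
have := congr1 (fun w : 'cV[{poly F}]_n => size (w i 0)) rv; rewrite !mxE mulrC size_mulX //.
rewrite iM; apply/eqP; rewrite neq_ltn; apply/orP; right.
rewrite ltnS (leq_trans (size_polyD _ _)) // geq_max; apply/andP; split.
  by rewrite mulrC mul_polyC (leq_trans (size_scale_leq _ _)).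
apply: leq_trans (size_sum _ _ _) _; apply/bigmax_leqP => j _.
by rewrite mxE mul_polyC (leq_trans (size_scale_leq _ _)) //; exact: (bigop.leq_bigmax).
Qed.

Lemma resolvent_row_size n (A : 'M[F]_n) b (chi : {poly F}) v (c : 'rV[F]_n) : chi != 0 ->
  resolvent A b chi v -> (size ((map_mx polyC c *m v)%R 0%R 0%R) < size chi)%N.
Proof.
move=> chi0 rv; rewrite mxE.
have h := resolvent_size chi0 rv.
have sz : (size chi).-1.+1 = size chi by rewrite prednK ?size_poly_gt0.
rewrite -sz ltnS.
apply: leq_trans (size_sum _ _ _) _; apply/bigmax_leqP => j _.
rewrite mxE mul_polyC (leq_trans (size_scale_leq _ _)) //.
by rewrite -ltnS sz.
Qed.

(** A strictly proper rational function vanishes if it equals a polynomial, so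
    equal transfer functions have equal expansions at infinity, one Markov
    parameter after the other. *)
Lemma markov_eq n1 n2 (A1 : 'M[F]_n1) (b1 : 'cV[F]_n1) (c1 : 'rV[F]_n1) d1 (chi1 : {poly F}) v1
    (A2 : 'M[F]_n2) (b2 : 'cV[F]_n2) (c2 : 'rV[F]_n2) d2 (chi2 : {poly F}) v2 :
  chi1 != 0 -> chi2 != 0 -> resolvent A1 b1 chi1 v1 -> resolvent A2 b2 chi2 v2 ->
  ((map_mx polyC c1 *m v1) 0 0 + d1%:P * chi1) * chi2 =
  ((map_mx polyC c2 *m v2) 0 0 + d2%:P * chi2) * chi1 ->
  d1 = d2 /\ forall m, (c1 *m A1 ^+ m *m b1) 0 0 = (c2 *m A2 ^+ m *m b2) 0 0.
Proof.
move=> x10 x20 r1 r2 tf.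
pose Q m := (map_mx polyC (c1 *m A1 ^+ m) *m v1) 0 0 * chi2 -
            (map_mx polyC (c2 *m A2 ^+ m) *m v2) 0 0 * chi1.
have x120 : chi1 * chi2 != 0 by rewrite mulf_neq0.
have Qsize m : (size (Q m) < size (chi1 * chi2)%R)%N.
  have szM (p q r : {poly F}) : q != 0 -> r != 0 -> (size p < size q)%N ->
      (size (p * r)%R < size (q * r)%R)%N.
    move=> q0 r0 pq; have [->|p0] := eqVneq p 0.
      by rewrite mul0r size_poly0 size_poly_gt0 mulf_neq0.
    rewrite !size_mul //; have : (0 < size r)%N by rewrite size_poly_gt0.
    by case: (size r) => // k _; rewrite !addnS /= ltn_add2r.
  rewrite (leq_ltn_trans (size_polyD _ _)) // gtn_max size_polyN.
  rewrite szM ?(resolvent_row_size _ _ r1) //= (mulrC chi1) szM //.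
  exact: resolvent_row_size r2.
have step n (A : 'M[F]_n) b (c : 'rV[F]_n) chi v m : resolvent A b chi v ->
    (map_mx polyC (c *m A ^+ m.+1) *m v) 0 0 =
    'X * (map_mx polyC (c *m A ^+ m) *m v) 0 0 - ((c *m A ^+ m *m b) 0 0)%:P * chi.
  move=> rv; rewrite exprSr -mulmxE mulmxA map_mxM -mulmxA.
  have -> : map_mx polyC A *m v = 'X *: v - chi *: map_mx polyC b.
    by rewrite rv addrC addKr.
  rewrite mulmxBr -!scalemxAr -map_mxM; rewrite !mxE; congr (_ - _).
  by rewrite mulrC.
have poly0 (p : {poly F}) a : p = a%:P * (chi1 * chi2) ->
    (size p < size (chi1 * chi2)%R)%N -> a = 0.
  move=> ->; rewrite mul_polyC; have [//|a0] := eqVneq a 0.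
  by rewrite size_scale // ltnn.
have Q0E : Q 0%N = (d2 - d1)%:P * (chi1 * chi2).
  rewrite /Q !expr0 !mulmx1 polyCB; move: tf; rewrite !mulrDl => /eqP.
  rewrite -subr_eq0 => /eqP tf; apply/eqP; rewrite -subr_eq0 -[X in _ == X]tf; apply/eqP.
  by ring.
have d12 : d1 = d2.
  by apply/esym/eqP; rewrite -subr_eq0; apply/eqP; exact: poly0 Q0E (Qsize _).
split=> //.
have Qstep m : Q m = 0 -> (c1 *m A1 ^+ m *m b1) 0 0 = (c2 *m A2 ^+ m *m b2) 0 0 /\ Q m.+1 = 0.
  move=> Qm.
  have QS : Q m.+1 = ((c2 *m A2 ^+ m *m b2) 0 0 - (c1 *m A1 ^+ m *m b1) 0 0)%:P * (chi1 * chi2).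
    rewrite /Q (step _ _ _ _ _ _ _ r1) (step _ _ _ _ _ _ _ r2) polyCB.
    have := congr1 ( *%R 'X) Qm; rewrite mulr0 /Q => /eqP; rewrite -subr_eq0 subr0 => /eqP h.
    rewrite -[RHS]add0r -h; ring.
  have a0 := poly0 _ _ QS (Qsize _).
  by move/eqP: (a0); rewrite subr_eq0 => /eqP; split=> //; rewrite QS a0 mul0r.
move=> m; suff : Q m = 0 by move=> /Qstep[].
elim: m => [|m /Qstep[] //]; by rewrite Q0E d12 subrr mul0r.
Qed.

Lemma adj_resolvent n (A : 'M[F]_n) b :
  resolvent A b (char_poly A) (\adj (char_poly_mx A) *m map_mx polyC b).
Proof.
rewrite /resolvent; have -> : char_poly A *: map_mx polyC b =
    char_poly_mx A *m (\adj (char_poly_mx A) *m map_mx polyC b).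
  by rewrite mulmxA mul_mx_adj mul_scalar_mx.
by rewrite /char_poly_mx mulmxBl mul_scalar_mx subrK.
Qed.

Definition companion (q : {poly F}) : 'M[F]_((size q).-1) :=
  \matrix_(i, j) ((i.+1 == j :> nat)%:R - (i.+1 == (size q).-1 :> nat)%:R * q`_j).
Definition companion_in (q : {poly F}) : 'cV[F]_((size q).-1) :=
  \col_i (i.+1 == (size q).-1 :> nat)%:R.

Lemma companion_mul (q : {poly F}) (K : comNzRingType) (f : {rmorphism F -> K})
    m (x : 'M[K]_((size q).-1, m)) (i : 'I_((size q).-1)) j :
  (map_mx f (companion q) *m x) i j =
  (if (insub i.+1 : option 'I_((size q).-1)) is Some i' then x i' j else 0) -
  (i.+1 == (size q).-1 :> nat)%:R * \sum_(l < (size q).-1) f q`_l * x l j.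
Proof.
rewrite mxE mulr_sumr.
under eq_bigr do rewrite !mxE rmorphB rmorphM !rmorph_nat mulrBl -mulrA.
rewrite sumrB; congr (_ - _).
case: insubP => [i' _ ii'|].
  rewrite (bigD1 i') //= ii' eqxx mul1r big1 ?addr0 // => k ki.
  case: eqP => [h|_]; last by rewrite mul0r.
  by case/eqP: ki; apply/val_inj; rewrite ii' /= h.
move=> h; rewrite big1 // => k _; case: eqP => [kE|_]; last by rewrite mul0r.
by move: h; rewrite kE ltn_ord.
Qed.

End Markov.

Section Companion.
Variable F : fieldType.

Lemma monic_sum (q : {poly F}) : q \is monic ->
  q = \sum_(l < (size q).-1) q`_l *: 'X^l + 'X^((size q).-1).
Proof.
move=> qm; have q0 : (0 < size q)%N by rewrite size_poly_gt0 monic_neq0.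
rewrite -{1}[q]coefK poly_def.
have E : (size q).-1.+1 = size q by rewrite prednK.
rewrite -(big_mkord xpredT (fun l => q`_l *: 'X^l)) -{1}E big_nat_recr //=.
by rewrite big_mkord -/(lead_coef q) (monicP qm) scale1r.
Qed.

Lemma companion_resolvent (q : {poly F}) : q \is monic ->
  resolvent (companion q) (companion_in q) q (\col_i 'X^i).
Proof.
move=> qm; apply/colP => i; rewrite [RHS]mxE companion_mul !mxE.
case: insubP => [i' _ /= ii'|/=]; rewrite ?mxE.
  have -> : (i.+1 == (size q).-1) = false.
    by apply/negbTE; rewrite neq_ltn -ii' ltn_ord.
  by rewrite rmorph0 mulr0 add0r mul0r subr0 ii' exprS.
rewrite -leqNgt => Ni; have /eqP iN : i.+1 == (size q).-1.
  by rewrite eqn_leq Ni ltn_ord.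
rewrite iN eqxx rmorph1 mulr1 mul1r sub0r -exprS iN.
have -> : \sum_(l < (size q).-1) (q`_l)%:P * (\col_(i0 < (size q).-1) 'X^i0) l 0 =
    q - 'X^((size q).-1).
  apply/eqP; rewrite eq_sym subr_eq; apply/eqP; rewrite [LHS](monic_sum qm).
  by congr (_ + _); apply: eq_bigr => l _; rewrite mxE mul_polyC.
by rewrite opprB addrCA subrr addr0.
Qed.

Lemma row_powers N (p : {poly F}) : (size p <= N)%N ->
  (map_mx polyC (\row_(j < N) p`_j) *m \col_i 'X^i) 0 0 = p.
Proof.
move=> pN; rewrite mxE; have -> : p = \poly_(i < N) p`_i.
  apply/polyP => i; rewrite coef_poly; case: ltnP => // Ni.
  by rewrite nth_default // (leq_trans pN).
rewrite [RHS]poly_def; apply: eq_bigr => l _; rewrite !mxE mul_polyC.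
by rewrite coef_poly ltn_ord.
Qed.

(** The solutions of [s x = A x + u b] for a companion pair [(A, b)] are
    multiples of the vector of the powers of [s]; the last row then gives the
    characteristic equation. *)
Lemma companion_sol (q : {poly F}) (K : comNzRingType) (f : {rmorphism F -> K})
    (s u : K) (x : 'cV[K]_((size q).-1)) : q \is monic ->
  s *: x = map_mx f (companion q) *m x + u *: map_mx f (companion_in q) ->
  exists xi, (forall i, x i 0 = s ^+ i * xi) /\ u = (map_poly f q).[s] * xi.
Proof.
move=> qm sx.
have E i : s * x i 0 = (if (insub i.+1 : option 'I_((size q).-1)) is Some i' then x i' 0 else 0) -
    (i.+1 == (size q).-1 :> nat)%:R * (\sum_(l < (size q).-1) f q`_l * x l 0) +
    u * (i.+1 == (size q).-1 :> nat)%:R.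
  have := congr1 (fun X : 'cV[K]_((size q).-1) => X i 0) sx.
  by rewrite !mxE -companion_mul mxE rmorph_nat.
have hq : (map_poly f q).[s] = \sum_(l < (size q).-1) f q`_l * s ^+ l + s ^+ (size q).-1.
  rewrite {1}(monic_sum qm) rmorphD rmorph_sum /= map_polyXn hornerD horner_sum hornerXn.
  by congr (_ + _); apply: eq_bigr => l _; rewrite map_polyZ map_polyXn hornerZ hornerXn.
have [N0|N0] := posnP (size q).-1.
  exists u; split=> [i|]; first by have := ltn_ord i; rewrite {2}N0.
  rewrite hq (_ : \sum_(l < _) _ = 0) ?add0r ?N0 ?expr0 ?mul1r //.
  by apply: big1 => -[l hl] _; move: (hl); rewrite ?N0.
exists (x (Ordinal N0) 0).
have X i (h : (i < (size q).-1)%N) : x (Ordinal h) 0 = s ^+ i * x (Ordinal N0) 0.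
  elim: i h => [|i IH] h; first by rewrite mul1r; congr (x _ _); apply/val_inj.
  have := E (Ordinal (ltnW h)); rewrite (insubT (fun i => i < (size q).-1)%N h) /=.
  rewrite (ltn_eqF h) mul0r mulr0 subr0 addr0 IH mulrA -exprS => ->.
  by congr (x _ _); apply/val_inj.
have X' i : x i 0 = s ^+ i * x (Ordinal N0) 0 by case: i => i h; exact: X.
split=> //.
have lN : ((size q).-2 < (size q).-1)%N by rewrite -{2}(prednK N0).
have := E (Ordinal lN); rewrite insubF /= prednK ?ltnn // eqxx mul1r mulr1 sub0r X'.
rewrite /= mulrA -exprS prednK // => /eqP; rewrite addrC -subr_eq opprK => /eqP <-.
rewrite hq mulrDl mulr_suml addrC; congr (_ + _).
by apply: eq_bigr => l _; rewrite X' mulrA.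
Qed.

End Companion.

Section CompanionReal.
Local Open Scope complex_scope.
Local Open Scope ring_scope.
Variable R : realType.

Definition ceval (p : {poly R}) (s : R[i]) : R[i] := (map_poly (fun a => a%:C) p).[s].

Lemma companion_hurwitz (q : {poly R}) : q \is monic ->
  (forall s : R[i], 0 <= complex.Re s -> ceval q s != 0) ->
  hurwitz_real (companion q).
Proof.
move=> qm qs t w xa xb t0 ha hb.
have sx : (t +i* w) *: cmx xa xb =
    map_mx (real_complex R) (companion q) *m cmx xa xb +
    0 *: map_mx (real_complex R) (companion_in q).
  by rewrite scale0r addr0 cmxZ -ha -hb -cplxmx_mul_cmx.
have [xi [xE /esym/eqP]] := companion_sol qm sx.
rewrite mulf_eq0 (negbTE (qs _ _)) //= => /eqP xi0.
apply: cmx_inj; apply/colP => i; rewrite xE xi0 mulr0 !mxE.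
by [].
Qed.

(** By [companion_sol] the state is [xi] times the powers of [s] and the input is
    [q(s) xi], so that the output, read off the coefficients of [p], is [p(s) xi].
    Complex numbers are written out for use with [freq_ineq]. *)
Lemma companion_gain (p q : {poly R}) (s : R[i]) (d : R) (xa xb : 'cV[R]_((size q).-1))
    (ua ub : R) : q \is monic -> (size (p - d *: q)%R <= (size q).-1)%N -> ceval q s != 0 ->
  let c := \row_(j < (size q).-1) (p - d *: q)`_j in
  s *: cmx xa xb = cmx (companion q *m xa + ua *: companion_in q)
                       (companion q *m xb + ub *: companion_in q) ->
  ((c *m xa) 0 0 + d * ua) +i* ((c *m xb) 0 0 + d * ub) =
  ceval p s / ceval q s * (ua +i* ub).
Proof.
move=> qm pq qs0 c sx.
have sx' : s *: cmx xa xb =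
    map_mx (real_complex R) (companion q) *m cmx xa xb +
    (ua +i* ub) *: map_mx (real_complex R) (companion_in q).
  rewrite sx -cmxD -cplxmx_mul_cmx; congr (_ + _).
  by apply/matrixP => i j; rewrite !mxE; apply/eqP; rewrite eq_complex /=;
    apply/andP; split; apply/eqP; ring.
have [xi [xE uE]] := companion_sol qm sx'.
have cE : ((c *m xa) 0 0) +i* ((c *m xb) 0 0) = ceval (p - d *: q) s * xi.
  have -> : ((c *m xa) 0 0) +i* ((c *m xb) 0 0) = (cplxmx c *m cmx xa xb) 0 0.
    by rewrite cplxmx_mul_cmx [RHS]mxE.
  rewrite mxE /ceval (@horner_coef_wide _ (size q).-1); last first.
    by rewrite (leq_trans (size_poly _ _)).
  rewrite mulr_suml; apply: eq_bigr => l _.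
  by rewrite xE coef_map_id0 // !mxE mulrA.
have -> : ((c *m xa) 0 0 + d * ua) +i* ((c *m xb) 0 0 + d * ub) =
   (c *m xa) 0 0 +i* (c *m xb) 0 0 + d%:C * (ua +i* ub).
  by apply/eqP; rewrite eq_complex /=; apply/andP; split; apply/eqP; ring.
rewrite cE uE -/(ceval q s).
have -> : ceval (p - d *: q) s = ceval p s - d%:C * ceval q s.
  by rewrite /ceval -/(real_complex R) rmorphB /= map_polyZ hornerD hornerN hornerZ.
by field.
Qed.

End CompanionReal.

Section Realization.
Local Open Scope sesquilinear_scope.
Local Open Scope complex_scope.
Local Open Scope ring_scope.
Variable R : realType.

Lemma cevalM (p q : {poly R}) s : ceval (p * q) s = ceval p s * ceval q s.
Proof. by rewrite /ceval -/(real_complex R) rmorphM hornerM. Qed.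
Lemma cevalB (p q : {poly R}) s : ceval (p - q) s = ceval p s - ceval q s.
Proof. by rewrite /ceval -/(real_complex R) rmorphB hornerD hornerN. Qed.

Lemma cevalD (p q : {poly R}) s : ceval (p + q) s = ceval p s + ceval q s.
Proof. by rewrite /ceval -/(real_complex R) rmorphD hornerD. Qed.
Lemma ceval1 s : ceval 1 s = 1 :> R[i].
Proof. by rewrite /ceval -/(real_complex R) rmorph1 hornerC. Qed.

(** The imaginary axis is infinite. *)
Lemma ceval_eq0 (p : {poly R}) : (forall w : R, ceval p (0 +i* w) = 0) -> p = 0.
Proof.
move=> p0; apply/eqP; rewrite -(map_poly_eq0 (real_complex R)); apply/negPn/negP => pn0.
pose s := [seq (0 +i* n%:R : R[i]) | n <- iota 0 (size (map_poly (real_complex R) p))].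
have := max_poly_roots (rs := s) pn0.
rewrite size_map size_iota ltnn => h; suff : false by []; apply: h.
  by apply/allP => _ /mapP[n _ ->]; apply/eqP; exact: p0.
rewrite map_inj_uniq ?iota_uniq // => a b [] /eqP.
by rewrite eqr_nat => /eqP.
Qed.

Lemma rat_value_frac (n q : {poly R}) s v : q != 0 ->
  rat_value (tofrac n / tofrac q) s v -> ceval n s = v * ceval q s.
Proof.
move=> q0 [num [den [den0 E ->]]].
have d0 : den != 0 by apply: contra den0 => /eqP ->; rewrite map_poly0 horner0.
have {E} : n * den = num * q.
  apply/eqP; rewrite -tofrac_eq !tofracM.
  by move/eqP: E; rewrite eqr_div ?tofrac_eq0.
move/(congr1 (fun p => ceval p s)); rewrite !cevalM => h.
by apply: (mulIf den0); rewrite -/(ceval den s) h mulrAC -/(ceval num s) divfK.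
Qed.

Definition transfer_num p q (G : lti R p q) : 'M[{poly R}]_(p, q) :=
  map_mx polyC (lti_C G) *m (\adj (char_poly_mx (lti_A G)) *m map_mx polyC (lti_B G)) +
  char_poly (lti_A G) *: map_mx polyC (lti_D G).

Lemma transferE p q (G : lti R p q) i j :
  transfer G i j = tofrac (transfer_num G i j) / tofrac (char_poly (lti_A G)).
Proof.
have x0 : char_poly (lti_A G) != 0 by rewrite monic_neq0 ?char_poly_monic.
have rc m n (A : 'M[R]_(m, n)) : ratconst_mx A = map_mx (@tofrac _) (map_mx polyC A).
  by apply/matrixP => a b; rewrite !mxE.
rewrite /transfer !rc.
have -> : (tofrac 'X)%:M - map_mx (@tofrac _) (map_mx polyC (lti_A G)) =
    map_mx (@tofrac _) (char_poly_mx (lti_A G)).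
  by rewrite /char_poly_mx map_mxB map_scalar_mx.
rewrite /invmx unitmxE det_map_mx unitfE tofrac_eq0 x0 -map_mx_adj.
rewrite -scalemxAr -scalemxAl -mulmxA -!map_mxM.
rewrite [LHS]mxE [X in X + _]mxE [X in _ * X + _]mxE [X in _ + X]mxE.
rewrite (_ : transfer_num G i j = (map_mx polyC (lti_C G) *m
  (\adj (char_poly_mx (lti_A G)) *m map_mx polyC (lti_B G))) i j +
  char_poly (lti_A G) * (map_mx polyC (lti_D G)) i j); last first.
  by rewrite /transfer_num [LHS]mxE [X in _ + X]mxE.
rewrite tofracD tofracM mulrDl (mulrAC (tofrac (char_poly _))) divff ?tofrac_eq0 //.
by rewrite mul1r [in LHS]mulrC; congr (_ + _); rewrite mxE.
Qed.

(** On the imaginary axis the transfer matrix is a multiple of the identity; an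
    identity of polynomials that holds there holds everywhere, so the transfer
    matrix is a scalar fraction times the identity. In the reduced fraction
    [p / q] no unstable root of [q] survives, since a common pole of all
    representations would contradict the stability of the transfer matrix. The
    Markov parameters are then compared by [markov_eq]. *)
Lemma uncertainty_realization k nu (P0 : 'M[R]_(nu + nu)) (G : lti R k.+1 k.+1) :
  uncertainty_class (scalar_values k.+1 P0) G ->
  exists (p q : {poly R}) (d : R),
    [/\ q \is monic /\ (size (p - d *: q)%R <= (size q).-1)%N,
        forall s : R[i], 0 <= complex.Re s -> ceval q s != 0,
        forall w : R, in_region P0 (ceval p (0 +i* w) / ceval q (0 +i* w)),
        in_region P0 d%:C &
        forall i j, lti_D G i j = (i == j)%:R * d /\
          forall m, (lti_C G *m lti_A G ^+ m *m lti_B G) i j =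
            (i == j)%:R * (\row_(l < (size q).-1) (p - d *: q)`_l *m
              companion q ^+ m *m companion_in q) 0 0].
Proof.
move=> [[Grhp _] Gaxis [Winf Ginf [vinf [Winf_eq vinf_in]]]].
pose chi := char_poly (lti_A G); pose n := transfer_num G 0 0.
have chim : chi \is monic by exact: char_poly_monic.
have chi0 : chi != 0 by exact: monic_neq0.
have TE i j := transferE G i j; rewrite -/chi in TE.
pose g := gcdp n chi.
have g0 : g != 0 by rewrite gcdp_eq0 negb_and chi0 orbT.
have nE : n = n %/ g * g by rewrite divpK // dvdp_gcdl.
have chiE : chi = chi %/ g * g by rewrite divpK // dvdp_gcdr.
have qq0 : chi %/ g != 0 by apply: contra chi0 => /eqP h; rewrite chiE h mul0r.
pose l := lead_coef (chi %/ g); have l0 : l != 0 by rewrite lead_coef_eq0.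
pose q := l^-1 *: (chi %/ g); pose p := l^-1 *: (n %/ g).
have qm : q \is monic by rewrite monicE lead_coefZ mulVf.
have q0 : q != 0 by exact: monic_neq0.
have cop : coprimep p q.
  by rewrite coprimepZl ?invr_eq0 // coprimepZr ?invr_eq0 // coprimep_div_gcd // chi0 orbT.
have pq : p * chi = n * q.
  by rewrite {1}chiE {1}nE /p /q -!scalerAl -scalerAr; congr (_ *: _); ring.
clearbody p q.
have frac num den : den != 0 -> transfer G 0 0 = tofrac num / tofrac den ->
    p * den = num * q.
  move=> den0; rewrite TE => /eqP; rewrite eqr_div ?tofrac_eq0 // -!tofracM tofrac_eq.
  move=> /eqP E; apply: (mulIf chi0); rewrite mulrAC pq mulrAC E; ring.
have qs (s : R[i]) : 0 <= complex.Re s -> ceval q s != 0.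
  move=> s0; have [W /(_ 0 0) [num [den [den0 E _]]]] := Grhp s s0.
  have d0 : den != 0 by apply: contra den0 => /eqP ->; rewrite map_poly0 horner0.
  have := congr1 (fun r => ceval r s) (frac _ _ d0 E); rewrite !cevalM => h.
  apply/negP => /eqP qs0; move: h; rewrite qs0 mulr0 => /eqP.
  rewrite mulf_eq0 (negbTE (den0 : ceval den s != 0)) orbF => /eqP ps0.
  have /Bezout_eq1_coprimepP[[u v] /= /(congr1 (fun r => ceval r s))] := cop.
  rewrite cevalD !cevalM ps0 qs0 !mulr0 addr0 ceval1 => /eqP.
  by rewrite eq_sym oner_eq0.
have axis w : exists v, [/\ in_region P0 v, ceval p (0 +i* w) = v * ceval q (0 +i* w) &
    forall i j, ceval (transfer_num G i j) (0 +i* w) =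
      (i == j)%:R * (v * ceval chi (0 +i* w))].
  have [W GW [v [WE vin]]] := Gaxis w; exists v; split=> // [|i j].
    have := GW 0 0; rewrite WE [v%:M _ _]mxE eqxx mulr1n => -[num [den [den0 E ->]]].
    have d0 : den != 0 by apply: contra den0 => /eqP ->; rewrite map_poly0 horner0.
    have := congr1 (fun r => ceval r (0 +i* w)) (frac _ _ d0 E); rewrite !cevalM => h.
    by apply: (mulIf den0); rewrite -/(ceval den _) h mulrAC -/(ceval num _) divfK.
  have := GW i j; rewrite TE => /(rat_value_frac chi0) ->.
  by rewrite WE [v%:M _ _]mxE -[v *+ _]mulr_natl mulrA.
have nE' i j : transfer_num G i j = (i == j)%:R * n.
  apply/eqP; rewrite -subr_eq0; apply/eqP; apply: ceval_eq0 => w.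
  have [v [_ _ vP]] := axis w; rewrite cevalB vP.
  case: (i == j); rewrite ?mul0r; last by rewrite /ceval map_poly0 horner0 subr0.
  by rewrite !mul1r /n vP eqxx mul1r subrr.
have [num [den [den0 szn E vE]]] := Ginf 0 0.
have sq0 : (0 < size q)%N by rewrite size_poly_gt0.
have sd0 : (0 < size den)%N by rewrite size_poly_gt0.
have pden : p * den = num * q by exact: frac.
have szp : (size p <= size q)%N.
  have [->|p0] := eqVneq p 0; first by rewrite size_poly0.
  have num0 : num != 0.
    by apply/eqP => h; move/eqP: pden; rewrite h mul0r mulf_eq0 (negbTE p0) (negbTE den0).
  have h : size (p * den) = size (num * q) by rewrite pden.
  move: h; rewrite !size_mul // => h.
  move: (size p) (size q) (size den) (size num) szn h sq0 sd0.
  by move=> a b e f; clear; lia.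
pose d := p`_(size q).-1.
have topcoef (a b : {poly R}) i j : (size a <= i.+1)%N -> (size b <= j.+1)%N ->
    (a * b)`_(i + j)%N = a`_i * b`_j.
  move=> ai bj; rewrite coefM (bigD1 (inord i)) //= inordK ?ltnS ?leq_addr // addKn.
  rewrite big1 ?addr0 // => m mi.
  have [mlt|mge] := ltnP m i.
    rewrite (@nth_default _ _ b) ?mulr0 // (leq_trans bj) //; clear -mlt; lia.
  rewrite (@nth_default _ _ a) ?mul0r // (leq_trans ai) // ltn_neqAle mge andbT.
  by apply: contra mi => /eqP im; apply/eqP/val_inj; rewrite /= inordK ?ltnS ?leq_addr.
have dE : d = num`_(size den).-1 / lead_coef den.
  have h1 : (p * den)`_((size q).-1 + (size den).-1)%N = d * lead_coef den.
    by rewrite topcoef ?prednK.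
  have h2 : (num * q)`_((size den).-1 + (size q).-1)%N = num`_(size den).-1.
    by rewrite topcoef ?prednK // -/(lead_coef q) (monicP qm) mulr1.
  by rewrite -h2 -pden addnC h1 mulfK ?lead_coef_eq0.
have szd : (size (p - d *: q)%R <= (size q).-1)%N.
  apply/leq_sizeP => j jq; rewrite coefB coefZ.
  have [<-|jneq] := eqVneq (size q).-1 j.
    by rewrite -/(lead_coef q) (monicP qm) mulr1 subrr.
  have jq' : (size q <= j)%N by rewrite -(prednK sq0) ltn_neqAle jneq.
  by rewrite (nth_default _ jq') (nth_default _ (leq_trans szp jq')) mulr0 subr0.
exists p, q, d; split.
- by split.
- exact: qs.
- move=> w; have [v [vin pv _]] := axis w.
  suff -> : ceval p (0 +i* w) / ceval q (0 +i* w) = v by [].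
  by rewrite pv mulfK // qs.
- suff -> : d%:C = vinf by [].
  by rewrite dE -vE Winf_eq mxE eqxx mulr1n.
move=> i j.
have rG := adj_resolvent (lti_A G) (col j (lti_B G)).
have rC := companion_resolvent qm.
pose c := \row_(l < (size q).-1) (p - d *: q)`_l.
have [|dd mm] := markov_eq (c1 := row i (lti_C G)) (d1 := lti_D G i j)
   (c2 := (i == j)%:R *: c) (d2 := (i == j)%:R * d) chi0 q0 rG rC.
  have -> : (map_mx polyC ((i == j)%:R *: c) *m \col_i0 'X^i0) 0 0 = (i == j)%:R * (p - d *: q).
    rewrite map_mxZ -scalemxAl mxE row_powers //; congr (_ * _).
    exact: rmorph_nat.
  have entry m1 m2 m3 m4 (T : comNzRingType) (X : 'M[T]_(m1, m2)) (Y : 'M[T]_(m2, m3))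
      (Z : 'M[T]_(m3, m4)) a b : (row a X *m (Y *m col b Z)) 0 0 = (X *m (Y *m Z)) a b.
    by rewrite colE !mulmxA -colE -!row_mul [LHS]mxE [LHS]mxE.
  have -> : (map_mx polyC (row i (lti_C G)) *m
       (\adj (char_poly_mx (lti_A G)) *m map_mx polyC (col j (lti_B G)))) 0 0
       + (lti_D G i j)%:P * chi = transfer_num G i j.
    rewrite /transfer_num [RHS]mxE [X in _ = _ + X]mxE [X in _ = _ + _ * X]mxE mulrC.
    by rewrite map_row map_col entry.
  have -> : ((i == j)%:R * d)%:P = (i == j)%:R * d%:P :> {poly R}.
    by rewrite polyCM; congr (_ * _); exact: rmorph_nat.
  by rewrite nE' -mulrA -pq -[in RHS](mulrA _ d%:P) -mulrDr mul_polyC subrK mulrA.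
split=> // m.
have -> : (lti_C G *m lti_A G ^+ m *m lti_B G) i j =
    (row i (lti_C G) *m lti_A G ^+ m *m col j (lti_B G)) 0 0.
  by rewrite colE mulmxA -colE -!row_mul [RHS]mxE [RHS]mxE.
by rewrite mm -!scalemxAl mxE.
Qed.

End Realization.

(** * A storage function for the scalar uncertainty *)

Section DeltaStorage.
Local Open Scope complex_scope.
Local Open Scope ring_scope.
Variable R : realType.

Definition vecc m n (X : 'M[R]_(m, n)) : 'cV[R]_(m * n) := (mxvec X)^T.

Lemma vecc_linear m n : linear (@vecc m n).
Proof. by move=> a X Y; rewrite /vecc linearP linearP. Qed.
HB.instance Definition _ m n :=
  GRing.isLinear.Build R _ _ _ (@vecc m n) (@vecc_linear m n).

Lemma vecc_inj m n : injective (@vecc m n).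
Proof. by move=> X Y /trmx_inj /(can_inj mxvecK). Qed.

Lemma vecc_surj m n (x : 'cV[R]_(m * n)) : exists X, x = vecc X.
Proof. by exists (vec_mx x^T); rewrite /vecc vec_mxK trmxK. Qed.

(** The lemma [kyp_hurwitz] for [nu] parallel copies of the companion realization
    of [p / q], whose joint state is a matrix [X] with one column per copy. The
    form [T] is [P0] evaluated on the input [u] and the output [c X + d u]; the
    frequency inequality for it is the membership of [p / q] in the region. *)
Lemma delta_storage nu (P0 : 'M[R]_(nu + nu)) (p q : {poly R}) (d : R) :
  P0^T = P0 -> (forall y, bf P0 (col_mx 0 y) (col_mx 0 y) <= 0) ->
  q \is monic -> (size (p - d *: q)%R <= (size q).-1)%N ->
  (forall s : R[i], 0 <= complex.Re s -> ceval q s != 0) ->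
  (forall w : R, in_region P0 (ceval p (0 +i* w) / ceval q (0 +i* w))) ->
  in_region P0 d%:C ->
  let A := companion q in let b := companion_in q in
  let c := \row_(l < (size q).-1) (p - d *: q)`_l in
  exists2 L : 'M[R]_((size q).-1 * nu), posdefmx L &
    forall e, 0 < e -> exists2 Z : 'M[R]_((size q).-1 * nu), Z^T = Z &
      (forall X (u : 'rV_nu), let s := col_mx u^T (c *m X + d *: u)^T in
         2 * bf Z (vecc X) (vecc (A *m X + b *m u)) <=
         bf P0 s s + e * (sqn (vecc X) + sqn u^T)) /\
      (forall X, - (e * bf L (vecc X) (vecc X)) <= bf Z (vecc X) (vecc X)).
Proof.
move=> P0s R0n qm szd qs axis infty A b c.
have Ah : hurwitz_real A by exact: companion_hurwitz.
pose AA : 'M[R]_((size q).-1 * nu) := (lin_mx (mulmx A))^T.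
pose bu : {linear 'rV[R]_nu -> 'M[R]_((size q).-1, nu)} := mulmx b.
pose BB : 'M[R]_((size q).-1 * nu, nu) := (lin1_mx (mxvec \o bu))^T.
pose cx : {linear 'M[R]_((size q).-1, nu) -> 'rV[R]_nu} := mulmx c.
pose CC : 'M[R]_(nu, (size q).-1 * nu) := (lin1_mx (cx \o vec_mx))^T.
pose K : 'M[R]_(nu + nu, (size q).-1 * nu + nu) := block_mx 0 1%:M CC d%:M.
pose T := K^T *m P0 *m K.
have AAE X : AA *m vecc X = vecc (A *m X) by rewrite -trmx_mul mul_vec_lin.
have BBE (u : 'rV[R]_nu) : BB *m u^T = vecc (b *m u) by rewrite -trmx_mul mul_rV_lin1.
have CCE X : CC *m vecc X = (c *m X)^T by rewrite -trmx_mul mul_rV_lin1 /= mxvecK.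
have TE X (u : 'rV[R]_nu) : let s := col_mx u^T (c *m X + d *: u)^T in
    bf T (col_mx (vecc X) u^T) (col_mx (vecc X) u^T) = bf P0 s s.
  rewrite /T bf_mul /K mul_block_col mul0mx add0r mul1mx CCE mul_scalar_mx /=.
  by rewrite linearD /= [(d *: u)^T]linearZ.
have colM m n r (N : 'M[R]_(m, n)) (V : 'M[R]_(n, r)) j : col j (N *m V) = N *m col j V.
  by rewrite !colE mulmxA.
have colin (u : 'rV[R]_nu) j : col j (b *m u) = u 0 j *: b.
  rewrite colM (_ : col j u = (u 0 j)%:M) ?mul_mx_scalar //.
  by rewrite [LHS]mx11_scalar mxE.
have colD X (v : 'rV[R]_nu) j :
    col j (A *m X + b *m v) = companion q *m col j X + v 0 j *: companion_in q.
  by rewrite linearD /= colM colin.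
have fdi : freq_ineq AA BB T.
  split=> [w xa xb ua ub|u].
    have [Xa ->] := vecc_surj xa; have [Xb ->] := vecc_surj xb.
    rewrite -(trmxK ua) -(trmxK ub) !TE !AAE !BBE; set va := ua^T; set vb := ub^T.
    move=> ha hb; move: ha; rewrite -linearD -linearZ -linearN => /vecc_inj ha.
    move: hb; rewrite -linearD -linearZ => /vecc_inj hb.
    have qsw : ceval q (0 +i* w) != 0 by apply: qs.
    apply: (in_region_real (axis w)); apply/colP => j.
    have gain := @companion_gain R p q (0 +i* w) d (col j Xa) (col j Xb)
      (va 0 j) (vb 0 j) qm szd qsw.
    have out X (v : 'rV[R]_nu) : (c *m X + d *: v)^T j 0 = (c *m col j X) 0 0 + d * v 0 j.
      by rewrite -colM !mxE.
    rewrite [LHS]mxE !out gain.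
      by rewrite [RHS]mxE [cmx _ _ j 0]mxE !trmxK /va /vb !mxE.
    rewrite cmxZ !scale0r sub0r add0r; congr cmx.
      by rewrite -colD ha; apply/colP => i; rewrite !mxE.
    by rewrite -colD hb; apply/colP => i; rewrite !mxE.
  have -> : (0 : 'cV[R]_((size q).-1 * nu)) = vecc 0 by rewrite linear0.
  rewrite -(trmxK u) TE mulmx0 add0r linearZ /= trmxK.
  have := @in_region_real _ _ _ _ u 0 (d *: u) 0 infty.
  rewrite cmxZ !scaler0 scale0r subr0 addr0 => /(_ erefl).
  by rewrite col_mx0 [X in _ + X]bf0l addr0.
have AAh : hurwitz_real AA.
  move=> t w xa xb t0; have [Xa ->] := vecc_surj xa; have [Xb ->] := vecc_surj xb.
  rewrite !AAE => ha hb; move: ha; rewrite -!linearZ -linearB => /vecc_inj ha.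
  move: hb; rewrite -!linearZ -linearD => /vecc_inj hb.
  have h j : col j Xa = 0 /\ col j Xb = 0.
    apply: (Ah t w _ _ t0).
      by rewrite -colM ha; apply/colP => i; rewrite !mxE.
    by rewrite -colM hb; apply/colP => i; rewrite !mxE.
  have Xa0 : Xa = 0.
    by apply/matrixP => i j; have [/colP/(_ i) + _] := h j; rewrite !mxE.
  have Xb0 : Xb = 0.
    by apply/matrixP => i j; have [_ /colP/(_ i)] := h j; rewrite !mxE.
  by rewrite Xa0 Xb0 linear0.
have T0 x : bf T (col_mx x 0) (col_mx x 0) <= 0.
  have [X ->] := vecc_surj x; rewrite -(trmx0 R 1 nu) TE trmx0; exact: R0n.
have [L Lp LP] := kyp_hurwitz AAh fdi T0; exists L => // e e0.
have [Z Zs [Z1 Z2]] := LP e e0; exists Z => //; split=> [X u /=|X].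
  by have := Z1 (vecc X) u^T; rewrite AAE BBE -linearD TE.
exact: Z2.
Qed.

End DeltaStorage.

(** * Absolutely continuous functions on the half-line *)

Section AbsCont.
Local Open Scope classical_set_scope.
Local Open Scope ring_scope.
Variable R : realType.
Local Notation mu := (@lebesgue_measure R).

Definition locint (f : R -> R) :=
  forall T, 0 <= T -> mu.-integrable `[0, T] (EFin \o f).

(** [f] is a derivative of [F] on [0, +oo[ in the sense of Lebesgue. *)
Definition prim (F f : R -> R) :=
  locint f /\ forall t, 0 <= t -> F t = F 0 + \int[mu]_(s in `[0, t]) f s.

(** Fubini's theorem on the triangle [0 <= s <= t <= T], for [a(s) b(t)]. *)
Lemma integral_triangle (a b : R -> R) (T : R) : 0 <= T ->
  mu.-integrable `[0, T] (EFin \o a) -> mu.-integrable `[0, T] (EFin \o b) ->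
  (\int[mu]_(s in `[0%R, T]) ((a s)%:E * \int[mu]_(t in `[s, T]) (b t)%:E) =
   \int[mu]_(t in `[0%R, T]) ((b t)%:E * \int[mu]_(s in `[0%R, t]) (a s)%:E))%E.
Proof.
move=> T0 ai bi.
pose a' := a \_ `[0, T]; pose b' := b \_ `[0, T].
have a'i : mu.-integrable setT (EFin \o a').
  by rewrite -restrict_EFin; apply: (integrable_mkcond _ _).1.
have b'i : mu.-integrable setT (EFin \o b').
  by rewrite -restrict_EFin; apply: (integrable_mkcond _ _).1.
have a'm : measurable_fun setT a' by apply/measurable_EFinP; exact: measurable_int a'i.
have b'm : measurable_fun setT b' by apply/measurable_EFinP; exact: measurable_int b'i.
pose f (z : R * R) : \bar R := (if z.1 <= z.2 then a' z.1 * b' z.2 else 0)%:E.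
have fm : measurable_fun setT f.
  apply/measurable_EFinP; apply: measurable_fun_ifT => //=.
    exact: measurable_fun_ler.
  by apply: measurable_funM; exact: measurableT_comp.
have fi : (mu \x mu)%E.-integrable setT f.
  apply/integrable12ltyP => //.
  pose Kb := (\int[mu]_t `|(b' t)%:E|)%E.
  have Kb_ge0 : (0 <= Kb)%E by apply: integral_ge0.
  have Kb_lty : (Kb < +oo)%E by case/integrableP : b'i.
  have abs_m (c : R -> R) : measurable_fun setT c ->
      measurable_fun setT (fun s => `|(c s)%:E|%E).
    by move=> cm; apply: measurableT_comp => //; exact/measurable_EFinP.
  apply: (@le_lt_trans _ _ (\int[mu]_s (`|(a' s)%:E| * Kb))%E); last first.
    rewrite ge0_integralZr //; last exact: abs_m.
    by rewrite lte_mul_pinfty ?integral_ge0 // ?ge0_fin_numE ?integral_ge0 //;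
      case/integrableP : a'i.
  apply: ge0_le_integral => //.
  - by move=> s _; apply: integral_ge0.
  - have fam : measurable_fun setT (abse \o f) by exact: measurableT_comp.
    by have := @measurable_fun_fubini_tonelli_F _ _ _ _ _ mu _ fam (fun z => abse_ge0 (f z)).
  - by apply: emeasurable_funM => //; exact: abs_m.
  move=> s _; rewrite /Kb -ge0_integralZl //; last exact: abs_m.
  apply: ge0_le_integral => //.
  - apply: measurableT_comp => //; apply: (measurableT_comp fm).
    exact: measurable_pair1.
  - by apply: emeasurable_funM => //; exact: abs_m.
  move=> t _; rewrite /f /=; case: ifP => _; first by rewrite normrM EFinM.
  by rewrite normr0 mule_ge0.
have patchE (c : R -> R) (D : set R) x : x \in D -> (c \_ D) x = c x.
  by move=> xD; rewrite patchE xD.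
have patchN (c : R -> R) (D : set R) x : x \notin D -> (c \_ D) x = 0.
  by move=> xD; rewrite /patch (negbTE xD).
have := @Fubini _ _ _ _ _ mu mu f fi.
have -> : (\int[mu]_x \int[mu]_y f (x, y) =
    \int[mu]_(s in `[0%R, T]) ((a s)%:E * \int[mu]_(t in `[s, T]) (b t)%:E))%E.
  rewrite [RHS]integral_mkcond; apply: eq_integral => s _.
  rewrite /patch; case: ifPn => sT; last first.
    apply: integral0_eq => t _; rewrite /f /= /a' patchN //.
    by rewrite mul0r if_same.
  move: (sT); rewrite inE /= in_itv /= => /andP[s0 sT'].
  rewrite [in RHS]integral_mkcond -integralZl //; last first.
    apply: (integrable_mkcond _ _).1 => //; apply: integrableS bi => //.
    by apply: subset_itvr; rewrite bnd_simp.
  apply: eq_integral => t _; rewrite /f /= /a' patchE // /b' /patch.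
  rewrite !mem_setE !in_itv /=.
  case: (leP s t) => st /=; last by rewrite mule0.
  by rewrite (le_trans s0 st) /=; case: ifP; rewrite ?mulr0 ?mule0.
have -> : (\int[mu]_y \int[mu]_x f (x, y) =
    \int[mu]_(t in `[0%R, T]) ((b t)%:E * \int[mu]_(s in `[0%R, t]) (a s)%:E))%E.
  rewrite [RHS]integral_mkcond; apply: eq_integral => t _.
  rewrite /patch; case: ifPn => tT; last first.
    apply: integral0_eq => s _; rewrite /f /= /b' patchN //.
    by rewrite mulr0 if_same.
  move: (tT); rewrite inE /= in_itv /= => /andP[t0 tT'].
  rewrite [in RHS]integral_mkcond -integralZl //; last first.
    apply: (integrable_mkcond _ _).1 => //; apply: integrableS ai => //.
    by apply: subset_itvl; rewrite bnd_simp.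
  apply: eq_integral => s _; rewrite /f /= /b' patchE // /a' /patch.
  rewrite !mem_setE !in_itv /=.
  case: (leP s t) => st /=; last by rewrite andbF mule0.
  rewrite andbT (le_trans st tT') andbT.
  by case: ifP; rewrite ?mul0r ?mule0 // mulrC.
by [].
Qed.

End AbsCont.

Section AbsContCalculus.
Local Open Scope classical_set_scope.
Local Open Scope ring_scope.
Variable R : realType.
Local Notation mu := (@lebesgue_measure R).

Definition loccont (f : R -> R) := forall T, 0 <= T -> {within `[0, T], continuous f}.

Lemma loccont_meas f (T : R) : loccont f -> 0 <= T -> measurable_fun `[0, T] f.
Proof. by move=> fc T0; apply: subspace_continuous_measurable_fun => //; exact: fc. Qed.

Lemma loccont_bounded f (T : R) : loccont f -> 0 <= T -> [bounded f x | x in `[0, T]].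
Proof.
move=> fc T0; have /compact_bounded[M [Mr Mb]] :=
  continuous_compact (fc T T0) (@segment_compact _ 0 T).
by exists M; split=> // M' MM x xT; apply: Mb MM _ _; exists x.
Qed.

Lemma locint_ext (f g : R -> R) : (forall t, 0 <= t -> f t = g t) -> locint f -> locint g.
Proof.
move=> fg fi T T0; apply: eq_integrable (fi T T0) => //.
by move=> x; rewrite inE /= in_itv /= => /andP[x0 _]; rewrite /= fg.
Qed.

Lemma locint_cont (f : R -> R) : loccont f -> locint f.
Proof.
move=> fc T T0; apply: continuous_compact_integrable; [exact: segment_compact|exact: fc].
Qed.

Lemma locintD (f g : R -> R) : locint f -> locint g -> locint (fun t => f t + g t).
Proof.
move=> fi gi T T0; have := @integrableD _ _ _ mu _ (measurable_itv `[0, T]) _ _ (fi T T0) (gi T T0).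
by apply: eq_integrable => // x _ /=; rewrite EFinD.
Qed.

Lemma locintZ c (f : R -> R) : locint f -> locint (fun t => c * f t).
Proof.
move=> fi T T0; have := @integrableZl _ _ _ mu _ (measurable_itv `[0, T]) c _ (fi T T0).
by apply: eq_integrable => // x _ /=; rewrite EFinM.
Qed.

Lemma locint0 : locint (fun=> 0 : R).
Proof. by move=> T T0; exact: integrable0. Qed.

Lemma locint_sum (I : Type) (r : seq I) (F : I -> R -> R) :
  (forall i, locint (F i)) -> locint (fun t => \sum_(i <- r) F i t).
Proof.
move=> Fi; elim: r => [|i r IH].
  by apply: locint_ext locint0 => t _; rewrite big_nil.
by apply: locint_ext (locintD (Fi i) IH) => t _; rewrite big_cons.
Qed.

Lemma locintM (f g : R -> R) : loccont f -> locint g -> locint (fun t => f t * g t).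
Proof.
move=> fc gi T T0.
have := @integrableMr _ _ _ mu _ (measurable_itv `[0, T]) _ _ (loccont_meas fc T0) (loccont_bounded fc T0) (gi T T0).
by apply: eq_integrable => // x _ /=; rewrite EFinM.
Qed.

Lemma locint_sub (f : R -> R) (s t : R) : locint f -> 0 <= s -> s <= t -> mu.-integrable `[s, t] (EFin \o f).
Proof.
move=> fi s0 st; apply: integrableS (fi t (le_trans s0 st)) => //.
by apply: subset_itvr; rewrite bnd_simp.
Qed.

Lemma RintE (f : R -> R) (s t : R) : locint f -> 0 <= s -> s <= t ->
  (\int[mu]_(x in `[s, t]) (f x)%:E)%E = (\int[mu]_(x in `[s, t]) f x)%:E.
Proof.
move=> fi s0 st; rewrite /Rintegral fineK //.
exact: integrable_fin_num (locint_sub fi s0 st).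
Qed.

Lemma Rint_split (f : R -> R) (s t : R) : locint f -> 0 <= s -> s <= t ->
  \int[mu]_(x in `[s, t]) f x =
  \int[mu]_(x in `[0, t]) f x - \int[mu]_(x in `[0, s]) f x.
Proof.
move=> fi s0 st; rewrite Rintegral_itvB; last 3 first.
- exact: fi (le_trans s0 st).
- by rewrite bnd_simp.
- by rewrite bnd_simp.
rewrite Rintegral_itv_obnd_cbnd //; apply: integrableS (locint_sub fi s0 st) => //.
by apply: subset_itvr; rewrite bnd_simp.
Qed.

Lemma prim_cont (F f : R -> R) : prim F f -> loccont F.
Proof.
move=> [fi FE] T T0.
have h := parameterized_integral_continuous T0 (fi T T0).
have : {within `[0, T], continuous (fun t : R => F 0 + \int[mu]_(s in `[0, t]) f s)}.
  by move=> x; apply: cvgD; [exact: cvg_cst|exact: h].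
apply: subspace_eq_continuous => x; rewrite inE /= in_itv /= => /andP[x0 _].
exact/esym/FE.
Qed.

Lemma prim_ext (F f G g : R -> R) : (forall t, 0 <= t -> F t = G t) ->
  (forall t, 0 <= t -> f t = g t) -> prim F f -> prim G g.
Proof.
move=> FG fg [fi FE]; split; first exact: locint_ext fg fi.
move=> t t0; rewrite -FG // (FE t) // FG //; congr (_ + _).
by apply: eq_Rintegral => x; rewrite inE /= in_itv /= => /andP[x0 _]; rewrite fg.
Qed.

Lemma prim_cst (c : R) : prim (fun=> c) (fun=> 0).
Proof.
split; first exact: locint0.
by move=> t t0; rewrite Rintegral_cst // mul0r addr0.
Qed.

Lemma primD (F f G g : R -> R) : prim F f -> prim G g ->
  prim (fun t => F t + G t) (fun t => f t + g t).
Proof.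
move=> [fi FE] [gi GE]; split; first exact: locintD.
by move=> t t0; rewrite RintegralD ?(FE t) ?(GE t) //; [ring|exact: fi|exact: gi].
Qed.

Lemma primZ c (F f : R -> R) : prim F f -> prim (fun t => c * F t) (fun t => c * f t).
Proof.
move=> [fi FE]; split; first exact: locintZ.
by move=> t t0; rewrite RintegralZl ?(FE t) //; [ring|exact: fi].
Qed.

Lemma prim_sum (I : Type) (r : seq I) (F f : I -> R -> R) :
  (forall i, prim (F i) (f i)) ->
  prim (fun t => \sum_(i <- r) F i t) (fun t => \sum_(i <- r) f i t).
Proof.
move=> Fi; elim: r => [|i r IH].
  by apply: prim_ext (prim_cst 0) => t _; rewrite big_nil.
by apply: prim_ext (primD (Fi i) IH) => t _; rewrite big_cons.
Qed.

(** The product rule. The increments of [F] and [G] being integrals, the integral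
    of [F g] is an iterated one, and [integral_triangle] exchanges the order. *)
Lemma primM (F f G g : R -> R) : prim F f -> prim G g ->
  prim (fun t => F t * G t) (fun t => f t * G t + F t * g t).
Proof.
move=> pF pG; have Fc := prim_cont pF; have Gc := prim_cont pG.
move: (pF) (pG) => [fi FE] [gi GE].
have fGi : locint (fun t => f t * G t).
  by apply: locint_ext (locintM Gc fi) => t _; rewrite mulrC.
have Fgi := locintM Fc gi.
split; first exact: locintD.
move=> T T0; rewrite RintegralD //; [|exact: fGi|exact: Fgi].
pose a t := \int[mu]_(s in `[0, t]) f s; pose b t := \int[mu]_(s in `[0, t]) g s.
have ac : loccont a.
  apply: (@prim_cont _ f); split=> // t t0; rewrite {2}/a set_itv1 Rintegral_set1 add0r //.
have bc : loccont b.
  apply: (@prim_cont _ g); split=> // t t0; rewrite {2}/b set_itv1 Rintegral_set1 add0r //.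
have bfi := locintM bc fi; have agi := locintM ac gi.
have -> : \int[mu]_(x in `[0, T]) (f x * G x) =
    G 0 * a T + \int[mu]_(x in `[0, T]) (b x * f x).
  rewrite -RintegralZl //; last exact: fi.
  rewrite -RintegralD //; [|exact: locintZ|exact: bfi].
  apply: eq_Rintegral => x; rewrite inE /= in_itv /= => /andP[x0 _].
  by rewrite (GE x) // /b; ring.
have -> : \int[mu]_(x in `[0, T]) (F x * g x) =
    F 0 * b T + \int[mu]_(x in `[0, T]) (a x * g x).
  rewrite -RintegralZl //; last exact: gi.
  rewrite -RintegralD //; [|exact: locintZ|exact: agi].
  apply: eq_Rintegral => x; rewrite inE /= in_itv /= => /andP[x0 _].
  by rewrite (FE x) // /a; ring.
have tri := integral_triangle T0 (fi T T0) (gi T T0).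
have tri' : \int[mu]_(x in `[0, T]) (f x * (b T - b x)) = \int[mu]_(x in `[0, T]) (a x * g x).
  congr fine; move: tri; congr (_ = _); apply: eq_integral => x;
    rewrite inE /= in_itv /= => /andP[x0 xT].
    by rewrite RintE // Rint_split // EFinM.
  by rewrite RintE // /a -EFinM mulrC.
have E : \int[mu]_(x in `[0, T]) (f x * (b T - b x)) =
    b T * a T - \int[mu]_(x in `[0, T]) (b x * f x).
  rewrite -RintegralZl //; last exact: fi.
  rewrite -RintegralB //; [|exact: locintZ|exact: bfi].
  by apply: eq_Rintegral => x _; ring.
rewrite (FE T) // (GE T) // -/(a T) -/(b T) -tri' E; ring.
Qed.

Lemma prim_C1 (F f : R -> R) : (forall x : R, is_derive x (1 : R) F (f x)) -> continuous f -> prim F f.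
Proof.
move=> dF fc; have fi : locint f.
  by apply: locint_cont => T T0; exact: continuous_subspaceT.
have Fc : continuous F.
  move=> x; apply: differentiable_continuous; apply/derivable1_diffP.
  by have [] := dF x.
split=> // t; rewrite le_eqVlt => /predU1P[<-|t0].
  by rewrite set_itv1 Rintegral_set1 addr0.
have dLR : derivable_oo_LRcontinuous F 0 t.
  split.
  - by move=> x _; have [] := dF x.
  - exact: cvg_at_right_filter (Fc 0).
  - exact: cvg_at_left_filter (Fc t).
have dE : {in `]0, t[, F^`()%classic =1 f}.
  by move=> x _; rewrite derive1E; have [] := dF x.
have := continuous_FTC2 t0 (continuous_subspaceT fc) dLR dE.
by rewrite RintE // ?ltW // -EFinB => -[->]; rewrite addrC subrK.
Qed.

Lemma prim_le (F f G g : R -> R) : prim F f -> prim G g -> F 0 <= G 0 ->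
  {ae mu, forall t, 0 <= t -> f t <= g t} -> forall T, 0 <= T -> F T <= G T.
Proof.
move=> [fi FE] [gi GE] FG fg T T0; rewrite (FE T) // (GE T) //; apply: lerD => //.
(* Replacing [g] by the maximum, which is almost everywhere the same, makes the
   inequality hold at every point. *)
have -> : \int[mu]_(s in `[0, T]) g s = \int[mu]_(s in `[0, T]) Num.max (f s) (g s).
  congr fine; apply: ae_eq_integral => //.
  - by apply: measurable_int (gi T T0).
  - apply/measurable_EFinP; apply: measurable_maxr; apply/measurable_EFinP.
      by apply: measurable_int (fi T T0).
    by apply: measurable_int (gi T T0).
  move: fg; apply: filterS; first exact: (ae_filter_ringOfSetsType mu).
  move=> t h; rewrite /= in_itv /= => /andP[t0 _].
  by rewrite (max_idPr _) // h.
apply: le_Rintegral => //; [exact: fi| |by move=> x _; rewrite le_max lexx].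
have := fi T T0; have := gi T T0 => gi' fi'.
apply: le_integrable (@integrableD _ _ _ mu _ (measurable_itv `[0, T]) _ _ (integrable_abse fi') (integrable_abse gi')) => //.
  apply/measurable_EFinP; apply: measurable_maxr; apply/measurable_EFinP.
    exact: measurable_int fi'.
  exact: measurable_int gi'.
move=> t _ /=; rewrite lee_fin [leRHS]ger0_norm ?addr_ge0 //.
by case: (leP (f t) (g t)) => _; rewrite ?lerDl ?lerDr.
Qed.

End AbsContCalculus.

(** * Matrix exponentials and linear differential equations *)

Section MatrixPrim.
Local Open Scope classical_set_scope.
Local Open Scope ring_scope.
Variable R : realType.
Local Notation mu := (@lebesgue_measure R).

Definition locint_mx m n (f : R -> 'M[R]_(m, n)) :=
  forall i j, locint (fun t => f t i j).
Definition prim_mx m n (F f : R -> 'M[R]_(m, n)) :=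
  forall i j, prim (fun t => F t i j) (fun t => f t i j).

Lemma prim_mx_ext m n (F f G g : R -> 'M[R]_(m, n)) :
  (forall t, 0 <= t -> F t = G t) -> (forall t, 0 <= t -> f t = g t) ->
  prim_mx F f -> prim_mx G g.
Proof.
move=> FG fg pF i j; apply: prim_ext (pF i j) => t t0; first by rewrite FG.
by rewrite fg.
Qed.

Lemma prim_mx_cst m n (M : 'M[R]_(m, n)) : prim_mx (fun=> M) (fun=> 0).
Proof.
by move=> i j; apply: prim_ext (prim_cst (M i j)) => // t _; rewrite mxE.
Qed.

Lemma prim_mxD m n (F f G g : R -> 'M[R]_(m, n)) : prim_mx F f -> prim_mx G g ->
  prim_mx (fun t => F t + G t) (fun t => f t + g t).
Proof.
move=> pF pG i j; apply: prim_ext (primD (pF i j) (pG i j)) => t _; by rewrite mxE.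
Qed.

Lemma prim_mxM m n p (F f : R -> 'M[R]_(m, n)) (G g : R -> 'M[R]_(n, p)) :
  prim_mx F f -> prim_mx G g ->
  prim_mx (fun t => F t *m G t) (fun t => f t *m G t + F t *m g t).
Proof.
move=> pF pG i j.
apply: prim_ext (prim_sum (index_enum 'I_n) (fun k => primM (pF i k) (pG k j))) => t _.
  by rewrite mxE.
by rewrite !mxE -big_split.
Qed.

Lemma prim_mxMl m n p (M : 'M[R]_(m, n)) (G g : R -> 'M[R]_(n, p)) :
  prim_mx G g -> prim_mx (fun t => M *m G t) (fun t => M *m g t).
Proof.
move=> pG; apply: prim_mx_ext (prim_mxM (prim_mx_cst M) pG) => // t _.
by rewrite mul0mx add0r.
Qed.

Lemma prim_mxMr m n p (F f : R -> 'M[R]_(m, n)) (M : 'M[R]_(n, p)) :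
  prim_mx F f -> prim_mx (fun t => F t *m M) (fun t => f t *m M).
Proof.
move=> pF; apply: prim_mx_ext (prim_mxM pF (prim_mx_cst M)) => // t _.
by rewrite mulmx0 addr0.
Qed.

Lemma prim_mx_tr m n (F f : R -> 'M[R]_(m, n)) :
  prim_mx F f -> prim_mx (fun t => (F t)^T) (fun t => (f t)^T).
Proof. by move=> pF i j; apply: prim_ext (pF j i) => t _; rewrite mxE. Qed.

Lemma prim_mx0 m n (F f : R -> 'M[R]_(m, n)) : prim_mx F f ->
  (forall t, 0 <= t -> f t = 0) -> forall t, 0 <= t -> F t = F 0.
Proof.
move=> pF f0 t t0; apply/matrixP => i j; have [_ ->] := pF i j; rewrite //.
rewrite (_ : \int[mu]_(s in `[0, t]) f s i j = 0) ?addr0 //.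
rewrite -[RHS](mul0r (fine (mu `[0, t]))) -Rintegral_cst //.
apply: eq_Rintegral => s; rewrite inE /= in_itv /= => /andP[s0 _].
by rewrite f0 // mxE.
Qed.

Lemma locint_mxM m n p (F : R -> 'M[R]_(m, n)) (g : R -> 'M[R]_(n, p)) :
  (forall i j, loccont (fun t => F t i j)) -> locint_mx g ->
  locint_mx (fun t => F t *m g t).
Proof.
move=> Fc gi i j.
have := locint_sum (index_enum 'I_n) (fun k => locintM (Fc i k) (gi k j)).
by apply: locint_ext => t _; rewrite mxE.
Qed.

Lemma loccont_cst (c : R) : loccont (fun=> c).
Proof. by apply: prim_cont (prim_cst c). Qed.

Lemma locint_mxMl m n p (M : 'M[R]_(m, n)) (g : R -> 'M[R]_(n, p)) :
  locint_mx g -> locint_mx (fun t => M *m g t).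
Proof. by apply: locint_mxM => i j; exact: loccont_cst. Qed.

Lemma mxRintegralMl m n p (M : 'M[R]_(m, n)) (g : R -> 'M[R]_(n, p)) t :
  0 <= t -> locint_mx g ->
  mxRintegral 0 t (fun s => M *m g s) = M *m mxRintegral 0 t g.
Proof.
move=> t0 gi.
have pg : prim_mx (fun t => mxRintegral 0 t g) g.
  move=> i j; split; first exact: gi.
  by move=> s s0; rewrite !mxE set_itv1 Rintegral_set1 add0r.
have z : M *m mxRintegral 0 0 g = 0.
  apply/matrixP => i j; rewrite mxE [RHS]mxE big1 // => k _.
  by rewrite mxE set_itv1 Rintegral_set1 mulr0.
apply/matrixP => i j; have [_ /(_ t t0) ->] := prim_mxMl M pg i j.
by rewrite [LHS]mxE z [X in _ = X + _]mxE add0r.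
Qed.

End MatrixPrim.

Section MatrixExp.
Local Open Scope classical_set_scope.
Local Open Scope ring_scope.
Variable R : realType.

Definition mx_coeff m n p (P : 'M[R]_(m, n)) (A : 'M[R]_n) (Q : 'M[R]_(n, p)) i j : R^nat :=
  fun k => (P *m A ^+ k *m Q) i j / k`!%:R.

Lemma cvgn_sum (I : Type) (r : seq I) (u : I -> R^nat) (l : I -> R) :
  (forall i, u i @ \oo --> l i) ->
  (fun n => \sum_(i <- r) u i n) @ \oo --> \sum_(i <- r) l i.
Proof.
move=> ul; elim: r => [|i r IH].
  by rewrite big_nil; under eq_fun do rewrite big_nil; exact: cvg_cst.
by rewrite big_cons; under eq_fun do rewrite big_cons; apply: cvgD.
Qed.

Lemma pow_bound n (A : 'M[R]_n) : exists2 a, 0 <= a &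
  forall k i j, `|(A ^+ k) i j| <= a ^+ k.
Proof.
exists (\sum_i \sum_j `|A i j|) => [|k].
  by rewrite sumr_ge0 // => i _; rewrite sumr_ge0.
elim: k => [|k IH] i j; first by rewrite !expr0 mxE; case: eqP; rewrite ?normr1 ?normr0.
rewrite exprS -mulmxE mxE (le_trans (ler_norm_sum _ _ _)) // exprS.
apply: (@le_trans _ _ (\sum_l `|A i l| * (\sum_i \sum_j `|A i j|) ^+ k)).
  by apply: ler_sum => l _; rewrite normrM ler_wpM2l.
rewrite -mulr_suml ler_wpM2r //.
  by rewrite exprn_ge0 // sumr_ge0 // => ? _; rewrite sumr_ge0.
by rewrite [leRHS](bigD1 i) //= lerDl sumr_ge0 // => ? _; rewrite sumr_ge0.
Qed.

Lemma pow_scale n (A : 'M[R]_n) t k : (t *: A) ^+ k = t ^+ k *: A ^+ k.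
Proof.
elim: k => [|k IH]; first by rewrite !expr0 scale1r.
by rewrite !exprS IH -!mulmxE -scalemxAl -scalemxAr scalerA.
Qed.

Lemma cvg_mx_coeff1 n (A : 'M[R]_n) i j t :
  cvgn (pseries (mx_coeff 1%:M A 1%:M i j) t).
Proof.
have [a a0 aP] := pow_bound A.
apply: normed_cvg.
apply: (@series_le_cvg _ _ (exp_coeff (a * `|t|))).
- by move=> k; rewrite normr_ge0.
- by move=> k; rewrite exp_coeff_ge0 // mulr_ge0.
- move=> k; rewrite /exp_coeff /mx_coeff /= mul1mx mulmx1.
  rewrite !normrM normrV ?unitfE ?pnatr_eq0 -?lt0n ?fact_gt0 //.
  rewrite normr_nat normrX exprMn mulrAC ler_wpM2r // ?invr_ge0 //.
  by rewrite ler_wpM2r // exprn_ge0.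
exact: is_cvg_series_exp_coeff.
Qed.

(** The matrix exponential is reduced to scalar power series, entry by entry; the
    factors [P] and [Q] let the same lemma handle derivatives and impulse
    responses. *)
Lemma expmx_entry m n p (P : 'M[R]_(m, n)) (A : 'M[R]_n) (Q : 'M[R]_(n, p)) i j t :
  pseries (mx_coeff P A Q i j) t @ \oo --> (P *m expmx (t *: A) *m Q) i j.
Proof.
have base k l : pseries (mx_coeff 1%:M A 1%:M k l) t @ \oo --> expmx (t *: A) k l.
  have -> : expmx (t *: A) k l = limn (pseries (mx_coeff 1%:M A 1%:M k l) t).
    rewrite mxE; congr (limn (series _)); apply/funext => d.
    by rewrite /mx_coeff /= mul1mx mulmx1 pow_scale !mxE; ring.
  exact: cvg_mx_coeff1.
have -> : pseries (mx_coeff P A Q i j) t = (fun d => \sum_l \sum_k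
    P i k * Q l j * pseries (mx_coeff 1%:M A 1%:M k l) t d).
  apply/funext => d; rewrite /pseries /series /=.
  rewrite [LHS](eq_bigr (fun s => \sum_l \sum_k P i k * Q l j *
      (mx_coeff 1%:M A 1%:M k l s * t ^+ s))) => [|s _].
    rewrite exchange_big /=; apply: eq_bigr => l _.
    rewrite exchange_big /=; apply: eq_bigr => k _.
    by rewrite mulr_sumr.
  rewrite /mx_coeff mxE mulr_suml mulr_suml; apply: eq_bigr => l _.
  rewrite mxE !mulr_suml; apply: eq_bigr => k _.
  by rewrite mul1mx mulmx1; ring.
have -> : (P *m expmx (t *: A) *m Q) i j = \sum_l \sum_k P i k * Q l j * expmx (t *: A) k l.
  rewrite mxE; apply: eq_bigr => l _; rewrite mxE mulr_suml.
  by apply: eq_bigr => k _; rewrite mulrAC.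
apply: cvgn_sum => l; apply: cvgn_sum => k.
by apply: cvgM; [exact: cvg_cst|exact: base].
Qed.

Lemma expmx_comm n (A : 'M[R]_n) t : A *m expmx (t *: A) = expmx (t *: A) *m A.
Proof.
apply/matrixP => i j.
have h1 := @expmx_entry _ _ _ A A 1%:M i j t.
have h2 := @expmx_entry _ _ _ 1%:M A A i j t.
rewrite mulmx1 in h1; rewrite mul1mx in h2.
have E : mx_coeff A A 1%:M i j = mx_coeff 1%:M A A i j.
  by apply/funext => k; rewrite /mx_coeff mulmx1 mul1mx !mulmxE -exprS exprSr.
by rewrite -E in h2; exact: (cvg_unique _ h1 h2).
Qed.

Lemma expmx0 n (A : 'M[R]_n) : expmx (0 *: A) = 1%:M.
Proof.
apply/matrixP => i j.
have := @expmx_entry _ _ _ 1%:M A 1%:M i j 0; rewrite mul1mx mulmx1 => h.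
apply: (cvg_unique _ h) => //; apply: cvg_near_cst; exists 1%N => // k /= k0.
rewrite /pseries /series /= big_ltn // big_nat_cond big1 => [|l].
  by rewrite addr0 /mx_coeff !expr0 fact0 divr1 mulr1 !mul1mx.
by rewrite andbT => /andP[l0 _]; rewrite expr0n (gtn_eqF l0) mulr0.
Qed.

Lemma expmx_derive n (A : 'M[R]_n) i j (t : R) :
  is_derive t (1 : R) (fun t => expmx (t *: A) i j) ((A *m expmx (t *: A)) i j).
Proof.
have E m p (P : 'M[R]_(m, n)) (Q : 'M[R]_(n, p)) k l s :
    (P *m expmx (s *: A) *m Q) k l = limn (pseries (mx_coeff P A Q k l) s).
  by apply/esym/cvg_lim => //; exact: expmx_entry.
have cvgP m p (P : 'M[R]_(m, n)) (Q : 'M[R]_(n, p)) k l s :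
    cvgn (pseries (mx_coeff P A Q k l) s) by apply/cvg_ex; eexists; exact: expmx_entry.
have D m (P : 'M[R]_(m, n)) k l :
    pseries_diffs (mx_coeff P A 1%:M k l) = mx_coeff (P *m A) A 1%:M k l.
  apply/funext => d; rewrite /pseries_diffs /mx_coeff !mulmx1.
  rewrite exprS -mulmxE mulmxA factS natrM invfM mulrCA; congr (_ * _).
  by rewrite mulVKf // pnatr_eq0.
have := @pseries_snd_diffs R (mx_coeff 1%:M A 1%:M i j) (`|t| + 1) t.
rewrite !D mul1mx -(E _ _ A 1%:M i j t) mulmx1 => H.
have -> : (fun t => expmx (t *: A) i j) = (fun x => limn (pseries (mx_coeff 1%:M A 1%:M i j) x)).
  by apply/funext => s; rewrite -E mul1mx mulmx1.
apply: H => //.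
by rewrite [ltRHS]ger0_norm ?ltrDl // addr_ge0.
Qed.

Definition derive_mx m n (F : R -> 'M[R]_(m, n)) (t : R) (f : 'M[R]_(m, n)) :=
  forall i j, is_derive t (1 : R) (fun t => F t i j) (f i j).

Lemma derive_mxM m n p (F : R -> 'M[R]_(m, n)) (G : R -> 'M[R]_(n, p)) t f g :
  derive_mx F t f -> derive_mx G t g ->
  derive_mx (fun t => F t *m G t) t (f *m G t + F t *m g).
Proof.
move=> dF dG i j.
have -> : (fun t => (F t *m G t) i j) = \sum_k ((fun t => F t i k) * (fun t => G t k j)).
  by apply/funext => s; rewrite mxE fct_sumE.
apply: is_derive_eq.
  by apply: is_derive_sum => k; apply: is_deriveM; [exact: dF|exact: dG].
rewrite !mxE -big_split /=; apply: eq_bigr => k _.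
by rewrite /GRing.scale /= addrC mulrC [X in _ + X]mulrC; congr (_ + _); rewrite mulrC.
Qed.

(** The left-hand side has derivative zero in [t]. *)
Lemma expmx_addV n (A : 'M[R]_n) s t :
  expmx ((- t) *: A) *m expmx ((t + s) *: A) = expmx (s *: A).
Proof.
pose H (t : R) := expmx (t *: (- A)) *m expmx ((t + s) *: A).
have dH x : derive_mx H x 0.
  have d2 : derive_mx (fun x => expmx ((x + s) *: A)) x (A *m expmx ((x + s) *: A)).
    move=> i j; apply: is_derive_eq.
      exact: (@is_derive1_comp _ (fun t => expmx (t *: A) i j) (fun x => x + s) x _ _ (expmx_derive _ _ _ _)).
    by rewrite /= /GRing.scale /= addr0 mulr1.
  have d1 : derive_mx (fun x => expmx (x *: (- A))) x (- A *m expmx (x *: - A)).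
    by move=> i j; exact: expmx_derive.
  have := derive_mxM d1 d2; congr derive_mx.
  by rewrite (expmx_comm (- A)) mulmxN mulNmx mulmxA addNr.
apply/matrixP => i j.
have E : (fun x : R => H x i j) t = (fun x => H x i j) 0.
  apply: (@is_derive_0_is_cst R (fun x : R => H x i j)) => x.
  by have := dH x i j; rewrite mxE.
by move: E; rewrite /H expmx0 mul1mx add0r scalerN scaleNr.
Qed.

Lemma expmx_sub n (A : 'M[R]_n) s t :
  expmx ((t - s) *: A) = expmx (t *: A) *m expmx ((- s) *: A).
Proof. by rewrite -(expmx_addV A (t - s) (- t)) opprK addKr. Qed.

Lemma expmxV n (A : 'M[R]_n) t : expmx (t *: A) *m expmx ((- t) *: A) = 1%:M.
Proof. by rewrite -expmx_sub subrr expmx0. Qed.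

Lemma prim_expmx n (A : 'M[R]_n) :
  prim_mx (fun t => expmx (t *: A)) (fun t => A *m expmx (t *: A)).
Proof.
move=> i j; apply: prim_C1; first by move=> x; exact: expmx_derive.
have cE k : continuous (fun t : R => expmx (t *: A) k j).
  move=> x; apply: differentiable_continuous; apply/derivable1_diffP.
  by have [] := expmx_derive A k j x.
under eq_fun do rewrite mxE.
by apply: continuous_sum => k; apply: continuous_mul => //; exact: cst_continuous.
Qed.

End MatrixExp.

Section LinearODE.
Local Open Scope classical_set_scope.
Local Open Scope ring_scope.
Variable R : realType.

Lemma prim_expmxN n (A : 'M[R]_n) :
  prim_mx (fun t => expmx ((- t) *: A)) (fun t => - (expmx ((- t) *: A) *m A)).
Proof.
apply: prim_mx_ext (prim_expmx (- A)) => t _; first by rewrite scalerN scaleNr.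
by rewrite expmx_comm mulmxN scalerN scaleNr.
Qed.

Lemma loccont_expmxN n (A : 'M[R]_n) i j : loccont (fun t => expmx ((- t) *: A) i j).
Proof. by apply: prim_cont (prim_expmxN A i j). Qed.

(** The solution of [y' = A y + f], [y(0) = 0], by variation of constants. *)
Definition ode_sol m n (A : 'M[R]_m) (f : R -> 'M[R]_(m, n)) (t : R) : 'M[R]_(m, n) :=
  expmx (t *: A) *m mxRintegral 0 t (fun s => expmx ((- s) *: A) *m f s).

Lemma mxRintegral0 m n (f : R -> 'M[R]_(m, n)) : mxRintegral 0 0 f = 0.
Proof. by apply/matrixP => i j; rewrite !mxE set_itv1 Rintegral_set1. Qed.

Lemma prim_mxRintegral m n (f : R -> 'M[R]_(m, n)) : locint_mx f ->
  prim_mx (fun t => mxRintegral 0 t f) f.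
Proof.
move=> fi i j; split; first exact: fi.
by move=> s s0; rewrite mxRintegral0 !mxE add0r.
Qed.

Lemma ode_sol0 m n (A : 'M[R]_m) (f : R -> 'M[R]_(m, n)) : ode_sol A f 0 = 0.
Proof. by rewrite /ode_sol mxRintegral0 mulmx0. Qed.

Lemma ode_solP m n (A : 'M[R]_m) (f : R -> 'M[R]_(m, n)) : locint_mx f ->
  prim_mx (ode_sol A f) (fun t => A *m ode_sol A f t + f t).
Proof.
move=> fi.
have gi := locint_mxM (@loccont_expmxN _ A) fi.
apply: prim_mx_ext (prim_mxM (prim_expmx A) (prim_mxRintegral gi)) => t t0 //.
by rewrite /ode_sol [expmx (t *: A) *m (_ *m f t)]mulmxA expmxV mul1mx mulmxA.
Qed.

Lemma ode_unique m n (A : 'M[R]_m) (F : R -> 'M[R]_(m, n)) :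
  prim_mx F (fun t => A *m F t) -> F 0 = 0 -> forall t, 0 <= t -> F t = 0.
Proof.
move=> pF F0 t t0.
have p := prim_mxM (prim_expmxN A) pF.
have := prim_mx0 p _ t0; rewrite F0 mulmx0 => h.
have {}h : expmx ((- t) *: A) *m F t = 0.
  by apply: h => s _; rewrite mulNmx mulmxA addNr.
by rewrite -[F t]mul1mx -(expmxV A t) -mulmxA h mulmx0.
Qed.

Lemma ode_sol_conv m n p q (A : 'M[R]_m) (C : 'M[R]_(n, m)) (B : 'M[R]_(m, p))
    (z : R -> 'M[R]_(p, q)) t : 0 <= t -> locint_mx z ->
  mxRintegral 0 t (fun s => C *m expmx ((t - s) *: A) *m B *m z s) =
  C *m ode_sol A (fun s => B *m z s) t.
Proof.
move=> t0 zi.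
have gi := locint_mxM (@loccont_expmxN _ A) (locint_mxMl B zi).
rewrite /ode_sol -mxRintegralMl // -mxRintegralMl //; last exact: locint_mxMl.
by congr mxRintegral; apply/funext => s; rewrite expmx_sub !mulmxA.
Qed.

(** The Markov parameters are the Taylor coefficients of the impulse response. *)
Lemma impulse_eq n1 n2 m p (A1 : 'M[R]_n1) (B1 : 'M[R]_(n1, p)) (C1 : 'M[R]_(m, n1))
    (A2 : 'M[R]_n2) (b : 'cV[R]_n2) (c : 'rV[R]_n2) k i j :
  (forall d, (C1 *m A1 ^+ d *m B1) i j = k * (c *m A2 ^+ d *m b) 0 0) ->
  forall t, (C1 *m expmx (t *: A1) *m B1) i j = k * (c *m expmx (t *: A2) *m b) 0 0.
Proof.
move=> h t; have h1 := @expmx_entry _ _ _ _ C1 A1 B1 i j t.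
have h2 : (fun d => k * pseries (mx_coeff c A2 b 0 0) t d) @ \oo -->
    k * (c *m expmx (t *: A2) *m b) 0 0.
  by apply: cvgM; [exact: cvg_cst|exact: expmx_entry].
have E : pseries (mx_coeff C1 A1 B1 i j) t =
    (fun d => k * pseries (mx_coeff c A2 b 0 0) t d).
  apply/funext => d; rewrite /pseries /series /= [RHS]mulr_sumr.
  by apply: eq_bigr => s _; rewrite /mx_coeff h !mulrA.
by rewrite E in h1; exact: (cvg_unique _ h1 h2).
Qed.

(** By [impulse_eq] the convolution kernel of the uncertainty is that of the
    scalar system [(A, b, c, d)] times the identity. Transposed signals turn the
    [k] parallel copies of this system into one system with a matrix state. *)
Lemma lti_map_scalar k (G : lti R k k) N (A : 'M[R]_N) (b : 'cV[R]_N) (c : 'rV[R]_N) d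
    (z : R -> 'cV[R]_k) t : 0 <= t -> locint_mx z ->
  (forall i j, lti_D G i j = (i == j)%:R * d /\ forall e,
     (lti_C G *m lti_A G ^+ e *m lti_B G) i j = (i == j)%:R * (c *m A ^+ e *m b) 0 0) ->
  (lti_map G z t)^T = c *m ode_sol A (fun s => b *m (z s)^T) t + d *: (z t)^T.
Proof.
move=> t0 zi Gd.
have DE : lti_D G = d%:M.
  by apply/matrixP => i j; rewrite (Gd i j).1 mxE mulr_natl.
have zti : locint_mx (fun s => (z s)^T).
  by move=> i j; apply: locint_ext (zi j i) => s _; rewrite mxE.
rewrite /lti_map DE mul_scalar_mx linearD /= [(d *: z t)^T]linearZ -ode_sol_conv //.
congr (_ + _); apply/matrixP => i j; rewrite !mxE; congr (Rintegral _ _ _).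
apply/funext => s; rewrite mxE [RHS]mxE big_ord1.
have E l := impulse_eq (fun e => (Gd j l).2 e) (t - s).
under eq_bigr do rewrite E.
rewrite (bigD1 j) //= eqxx mul1r ord1 big1 ?addr0 => [|l lj].
  by rewrite [X in _ = _ * X]mxE.
by rewrite eq_sym (negbTE lj) !mul0r.
Qed.

End LinearODE.

(** * The multiplier matrices *)

Section Multipliers.
Variable R : realType.

(** A vector with the single nonzero block [y], at position [a]. The actions of
    [multP_outer] and [filter_outer] are computed on these. *)
Definition ten nu p (a : 'I_nu) (y : 'cV[R]_p) : 'cV[R]_(nu * p) :=
  (delta_mx a 0 : 'cV[R]_nu) *t y.

Lemma tens_colE m p (u : 'cV[R]_m) (y : 'cV[R]_p) b l :
  (u *t y : 'cV[R]_(m * p)) (mxtens_index (b, l)) 0 = u b 0 * y l 0.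
Proof.
rewrite -tensmxE; congr (fun_of_matrix _ _ _); exact/val_inj.
Qed.

Lemma tenE nu p (a : 'I_nu) (y : 'cV[R]_p) b l :
  ten a y (mxtens_index (b, l)) 0 = (b == a)%:R * y l 0.
Proof.
by rewrite tens_colE mxE eqxx andbT.
Qed.

Lemma ten_mul nu p q (a : 'I_nu) (M : 'M[R]_(q, p)) (y : 'cV[R]_p) :
  ((1%:M : 'M[R]_nu) *t M) *m ten a y = ten a (M *m y).
Proof.
have := tensmx_mul (1%:M : 'M[R]_nu) M (delta_mx a 0 : 'cV[R]_nu) y.
by rewrite mul1mx; apply.
Qed.

Lemma tenD nu p (a : 'I_nu) (x y : 'cV[R]_p) : ten a (x + y) = ten a x + ten a y.
Proof.
apply/colP => i; case: (mxtens_indexP i) => b l.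
by rewrite [RHS]mxE !tenE mxE mulrDr.
Qed.

Lemma mul_ten nu p r (M : 'M[R]_(r, nu * p)) (a : 'I_nu) (y : 'cV[R]_p) c :
  (M *m ten a y) c 0 = \sum_l M c (mxtens_index (a, l)) * y l 0.
Proof.
rewrite mxE (reindex (@mxtens_index nu p)) /=; last first.
  by exists (@mxtens_unindex nu p) => i _; [exact: mxtens_indexK|exact: mxtens_unindexK].
transitivity (\sum_b \sum_l M c (mxtens_index (b, l)) * ten a y (mxtens_index (b, l)) 0).
  by rewrite pair_bigA; apply: eq_bigr => -[b l] _.
rewrite (bigD1 a) //= [X in _ + X]big1 => [|b ba].
  by rewrite addr0; apply: eq_bigr => l _; rewrite tenE eqxx mul1r.
by rewrite big1 // => l _; rewrite tenE (negbTE ba) mul0r mulr0.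
Qed.

Lemma bf_tens m n (P : 'M[R]_m) (S : 'M[R]_n) (u v : 'cV[R]_m) (y y' : 'cV[R]_n) :
  bf (P *t S) (u *t y : 'cV[R]_(m * n)) (v *t y' : 'cV[R]_(m * n)) = bf P u v * bf S y y'.
Proof.
have E : (u *t y)^T *m (P *t S) *m (v *t y') = (u^T *m P *m v) *t (y^T *m S *m y').
  by rewrite trmx_tens !tensmx_mul.
rewrite /bf -tensmxE -E; congr (fun_of_matrix _ _ _); exact/val_inj.
Qed.

(** Rows of [P0] as pairs of a block, [false] for the input and [true] for the
    output of the uncertainty, and a position in the block. *)
Definition half n (s : bool) (a : 'I_n) : 'I_(n + n) :=
  if s then rshift n a else lshift n a.

Lemma halfP n (i : 'I_(n + n)) : exists s a, i = half s a.
Proof.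
case: (fintype.split_ordP i) => a ->; [by exists false, a|by exists true, a].
Qed.

Lemma half_val n s (a : 'I_n) : half s a = (s * n + a)%N :> nat.
Proof. by case: s; rewrite /= ?mul1n. Qed.

Lemma half_eq n s t (a b : 'I_n) : (half s a == half t b) = (s == t) && (a == b).
Proof.
by case: s t => -[] //=; rewrite ?eq_rshift ?eq_lshift ?eq_rlshift ?eq_lrshift.
Qed.

Lemma sum_half n (F : 'I_(n + n) -> R) :
  \sum_i F i = \sum_s \sum_a F (half s a).
Proof. by rewrite big_split_ord big_bool /= addrC. Qed.

Lemma multP_outerE nu p s t (a b : 'I_nu) (l l' : 'I_p) :
  multP_outer R nu p (mxtens_index (half s a, mxtens_index (b, l))) (half t l') =
  (s == t)%:R * (a == b)%:R * (l == l')%:R.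
Proof.
pose o (s : bool) : 'I_2 := if s then 1 else 0.
have ov s' : o s' = s' :> nat by case: s'.
rewrite /multP_outer castmxE.
rewrite [cast_ord _ (mxtens_index _)](_ : _ =
   mxtens_index (mxtens_index (o s, mxtens_index (a, b)), l)); last first.
  by apply/val_inj; rewrite /= half_val ov; ring.
rewrite [cast_ord _ (half _ _)](_ : _ =
   mxtens_index (mxtens_index (o t, (0 : 'I_1)), l')); last first.
  by apply/val_inj; rewrite /= half_val ov muln1 addn0.
rewrite !tensmxE !mxE mxtens_indexK /= [b == a]eq_sym.
by congr (_%:R * _ * _); case: s; case: t.
Qed.

Definition part p (s : bool) (y1 y2 : 'cV[R]_p) := if s then y2 else y1.

Lemma col_mx_half p (y1 y2 : 'cV[R]_p) s l :
  col_mx y1 y2 (half s l) 0 = part s y1 y2 l 0.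
Proof. by case: s; rewrite ?col_mxEd ?col_mxEu. Qed.

Lemma multP_outer_mul nu p (y1 y2 : 'cV[R]_p) :
  multP_outer R nu p *m col_mx y1 y2 =
  \sum_s \sum_a ((delta_mx (half s a) 0 : 'cV[R]_(nu + nu)) *t ten a (part s y1 y2)
    : 'cV[R]_((nu + nu) * (nu * p))).
Proof.
apply/colP => i; case: (mxtens_indexP i) => r j; case: (mxtens_indexP j) => b l.
have [s [a ->]] := halfP r.
rewrite mxE sum_half summxE (bigD1 s) //= [X in _ + X]big1 => [|t ts]; last first.
  by apply: big1 => l' _; rewrite multP_outerE eq_sym (negbTE ts) !mul0r.
have E t (c : 'I_nu) : ((delta_mx (half t c) 0 : 'cV[R]_(nu + nu)) *t ten c (part t y1 y2)
    : 'cV[R]_((nu + nu) * (nu * p))) (mxtens_index (half s a, mxtens_index (b, l))) 0 =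
    ((s == t) && (a == c))%:R * ((b == c)%:R * part t y1 y2 l 0).
  by rewrite tens_colE mxE eqxx andbT half_eq tenE.
rewrite [RHS](bigD1 s) //= [X in _ = _ + X]big1 => [|t ts]; last first.
  rewrite summxE big1 // => c _; rewrite E eq_sym (negbTE ts) mul0r //.
rewrite !addr0 summxE (bigD1 l) //= [X in _ + X]big1 => [|l' ll']; last first.
  by rewrite multP_outerE [l == l']eq_sym (negbTE ll') mulr0 mul0r.
rewrite addr0 multP_outerE !eqxx mul1r mulr1 col_mx_half.
rewrite (bigD1 a) //= [X in _ = _ + X]big1 => [|c ca]; last first.
  by rewrite E [a == c]eq_sym (negbTE ca) andbF mul0r.
by rewrite addr0 E !eqxx mul1r [b == a]eq_sym.
Qed.

End Multipliers.

Section Channels.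
Variable R : realType.

Lemma bf_suml (I : Type) (r : seq I) m n (M : 'M[R]_(m, n)) (F : I -> 'cV_m) y :
  bf M (\sum_(i <- r) F i) y = \sum_(i <- r) bf M (F i) y.
Proof.
elim: r => [|i r IH]; first by rewrite !big_nil bf0l.
by rewrite !big_cons bfDl IH.
Qed.

Lemma bf_sumr (I : Type) (r : seq I) m n (M : 'M[R]_(m, n)) x (F : I -> 'cV_n) :
  bf M x (\sum_(i <- r) F i) = \sum_(i <- r) bf M x (F i).
Proof.
elim: r => [|i r IH]; first by rewrite !big_nil bf0r.
by rewrite !big_cons bfDr IH.
Qed.

Lemma bf_delta n (P : 'M[R]_n) i j : bf P (delta_mx i 0) (delta_mx j 0) = P i j.
Proof. by rewrite /bf trmx_delta -rowE -colE !mxE. Qed.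

Lemma bf_row m n1 n2 (A : 'M[R]_(m, n1)) (B : 'M[R]_(m, n2)) x y z :
  bf (row_mx A B) x (col_mx y z) = bf A x y + bf B x z.
Proof. by rewrite /bf -!mulmxA mul_row_col mulmxDr mxE. Qed.

Lemma bf_col m1 m2 n (A : 'M[R]_(m1, n)) (B : 'M[R]_(m2, n)) x y z :
  bf (col_mx A B) (col_mx x y) z = bf A x z + bf B y z.
Proof. by rewrite -bf_tr tr_col_mx bf_row !bf_tr. Qed.

Lemma lmi_middle_form a b (X : 'M[R]_a) (M : 'M[R]_b) x1 x2 x3 y1 y2 y3 :
  bf (lmi_middle X M) (col_mx x1 (col_mx x2 x3)) (col_mx y1 (col_mx y2 y3)) =
  bf X x1 y2 + bf X x2 y1 + bf M x3 y3.
Proof. by rewrite /lmi_middle !bf_block bf_row bf_col !bf_0m; ring. Qed.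

(** The entries of [multP P0 S] couple the entries of [P0] to the blocks of [S]
    with the same block indices. *)
Lemma multP_form nu p (P0 : 'M[R]_(nu + nu)) (S : 'M[R]_(nu * p)) y1 y2 y1' y2' :
  bf (multP P0 S) (col_mx y1 y2) (col_mx y1' y2') =
  \sum_s \sum_a \sum_t \sum_b P0 (half s a) (half t b) *
    bf S (ten a (part s y1 y2)) (ten b (part t y1' y2')).
Proof.
rewrite /multP bf_mul !multP_outer_mul bf_suml; apply: eq_bigr => s _.
rewrite bf_suml; apply: eq_bigr => a _.
rewrite bf_sumr; apply: eq_bigr => t _.
rewrite bf_sumr; apply: eq_bigr => b _.
by rewrite bf_tens bf_delta.
Qed.

Lemma filter_outer_mul nu k npsi mpsi (Apsi : 'M[R]_npsi) (Bpsi : 'M[R]_(npsi, k))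
    (Cpsi : 'M[R]_(mpsi, npsi)) (Dpsi : 'M[R]_(mpsi, k)) (a : 'I_nu) xi z :
  filter_outer nu Apsi Bpsi Cpsi Dpsi *m col_mx (ten a xi) (ten a z) =
  col_mx (ten a xi) (col_mx (ten a (Apsi *m xi + Bpsi *m z))
                            (ten a (Cpsi *m xi + Dpsi *m z))).
Proof.
rewrite /filter_outer !mul_col_mx !mul_row_col !ten_mul mul0mx addr0 mul1mx.
by rewrite -!tenD.
Qed.

(** Channel [c] is row [c] of a square root of the first matrix inequality,
    read as [nu] scalar outputs of the filter, which the scalar uncertainty
    commutes with. *)
Lemma filter_channels nu k npsi mpsi (P0 : 'M[R]_(nu + nu))
    (Apsi : 'M[R]_npsi) (Bpsi : 'M[R]_(npsi, k))
    (Cpsi : 'M[R]_(mpsi, npsi)) (Dpsi : 'M[R]_(mpsi, k))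
    (Y : 'M[R]_(nu * npsi)) (M : 'M[R]_(nu * mpsi))
    (G := filter_outer nu Apsi Bpsi Cpsi Dpsi) :
  psd (G^T *m lmi_middle Y M *m G) ->
  exists r (E : 'I_r -> 'M[R]_(npsi, nu)) (F : 'I_r -> 'M[R]_(k, nu)),
  forall xz xw z w,
    let fz := Apsi *m xz + Bpsi *m z in let fw := Apsi *m xw + Bpsi *m w in
    let hz := Cpsi *m xz + Dpsi *m z in let hw := Cpsi *m xw + Dpsi *m w in
    bf (multP P0 M) (col_mx hz hw) (col_mx hz hw) +
    (bf (multP P0 Y) (col_mx xz xw) (col_mx fz fw) +
     bf (multP P0 Y) (col_mx fz fw) (col_mx xz xw)) =
    \sum_c let s := col_mx (xz^T *m E c + z^T *m F c)^T (xw^T *m E c + w^T *m F c)^T in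
           bf P0 s s.
Proof.
move=> /psd_factor[L LE].
pose E c : 'M[R]_(npsi, nu) := \matrix_(l, a) lsubmx L c (mxtens_index (a, l)).
pose F c : 'M[R]_(k, nu) := \matrix_(l, a) rsubmx L c (mxtens_index (a, l)).
exists _, E, F => xz xw z w fz fw hz hw.
pose g a xi u := L *m col_mx (ten a xi) (ten a u).
have gE a xi u c : (g a xi u) c 0 = (xi^T *m E c + u^T *m F c) 0 a.
  rewrite /g -{1}(hsubmxK L) mul_row_col mxE !mul_ten [RHS]mxE !mxE.
  by congr (_ + _); apply: eq_bigr => l _; rewrite !mxE mulrC.
pose X s := part s xz xw; pose U s := part s z w.
have term s a t b :
    bf M (ten a (part s hz hw)) (ten b (part t hz hw)) +
    (bf Y (ten a (X s)) (ten b (part t fz fw)) +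
     bf Y (ten a (part s fz fw)) (ten b (X t))) =
    \sum_c (g a (X s) (U s)) c 0 * (g b (X t) (U t)) c 0.
  have -> : \sum_c (g a (X s) (U s)) c 0 * (g b (X t) (U t)) c 0 =
      bf (G^T *m lmi_middle Y M *m G) (col_mx (ten a (X s)) (ten a (U s)))
         (col_mx (ten b (X t)) (ten b (U t))).
    have -> : G^T *m lmi_middle Y M *m G = L^T *m 1%:M *m L by rewrite LE mulmx1.
    rewrite bf_mul /bf mulmx1 [RHS]mxE; apply: eq_bigr => c _.
    by rewrite [X in _ = X * _]mxE.
  rewrite bf_mul !filter_outer_mul lmi_middle_form addrC /X /U.
  by case: s; case: t.
rewrite !multP_form -!big_split /=.
have inner c : (let s := col_mx (xz^T *m E c + z^T *m F c)^T (xw^T *m E c + w^T *m F c)^T in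
    bf P0 s s) = \sum_s \sum_a \sum_t \sum_b P0 (half s a) (half t b) *
      ((g a (X s) (U s)) c 0 * (g b (X t) (U t)) c 0).
  have vE s a : col_mx (xz^T *m E c + z^T *m F c)^T (xw^T *m E c + w^T *m F c)^T (half s a) 0 =
      (g a (X s) (U s)) c 0.
    by rewrite col_mx_half gE; case: s; rewrite [LHS]mxE.
  rewrite /= bfE sum_half; apply: eq_bigr => s _; apply: eq_bigr => a _.
  rewrite sum_half; apply: eq_bigr => t _; apply: eq_bigr => b _.
  by rewrite !vE; ring.
rewrite [RHS](eq_bigr _ (fun c _ => inner c)).
rewrite [RHS]exchange_big /=; apply: eq_bigr => s _.
rewrite -!big_split [RHS]exchange_big /=; apply: eq_bigr => a _.
rewrite -!big_split [RHS]exchange_big /=; apply: eq_bigr => t _.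
rewrite -!big_split [RHS]exchange_big /=; apply: eq_bigr => b _.
by rewrite -mulr_sumr -term !mulrDr.
Qed.

Lemma system_outer_mul n k npsi mpsi
    (A : 'M[R]_n) (B : 'M[R]_(n, k)) (C : 'M[R]_(k, n)) (D : 'M[R]_k)
    (Apsi : 'M[R]_npsi) (Bpsi : 'M[R]_(npsi, k))
    (Cpsi : 'M[R]_(mpsi, npsi)) (Dpsi : 'M[R]_(mpsi, k))
    (xz xw : 'cV[R]_npsi) (x : 'cV[R]_n) (w : 'cV[R]_k) :
  let z := C *m x + D *m w in
  system_outer A B C D Apsi Bpsi Cpsi Dpsi *m col_mx (col_mx (col_mx xz xw) x) w =
  col_mx (col_mx (col_mx xz xw) x)
    (col_mx (col_mx (col_mx (Apsi *m xz + Bpsi *m z) (Apsi *m xw + Bpsi *m w))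
                    (A *m x + B *m w))
            (col_mx (Cpsi *m xz + Dpsi *m z) (Cpsi *m xw + Dpsi *m w))).
Proof.
move=> z; rewrite /system_outer.
have diag m q (J : 'M[R]_(m, q)) a b : mxdiag2 J *m col_mx a b = col_mx (J *m a) (J *m b).
  by move=> *; rewrite /mxdiag2 mul_block_col !mul0mx addr0 add0r.
rewrite !mul_col_mx !mul_row_col !mul0mx !mul1mx !addr0 !add0r.
rewrite !mulmx0 !mulmx1 !diag !mul_col_mx !add_col_mx !mul0mx !addr0.
by rewrite -!mulmxA -!addrA -!mulmxDr.
Qed.

End Channels.

(** * Energy estimates *)

Section Energy.
Local Open Scope classical_set_scope.
Local Open Scope ring_scope.
Variable R : realType.
Local Notation mu := (@lebesgue_measure R).

Definition l2loc (f : R -> R) :=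
  (forall T : R, 0 <= T -> measurable_fun `[0, T] f) /\ locint (fun t => f t ^+ 2).

Lemma locint_le (f g : R -> R) : (forall T : R, 0 <= T -> measurable_fun `[0, T] f) ->
  (forall t, `|f t| <= g t) -> locint g -> locint f.
Proof.
move=> fm fg gi T T0; apply: le_integrable (gi T T0) => //.
  by apply/measurable_EFinP; exact: fm.
by move=> t _ /=; rewrite lee_fin (le_trans (fg t)) // ler_norm.
Qed.

Lemma l2loc_cont f : loccont f -> l2loc f.
Proof.
move=> fc; split=> [T T0|]; first exact: loccont_meas.
by apply: locint_ext (locintM fc (locint_cont fc)) => t _; rewrite expr2.
Qed.

Lemma l2locM f g : l2loc f -> l2loc g -> locint (fun t => f t * g t).
Proof.
move=> [fm fi] [gm gi]; apply: (@locint_le _ (fun t => f t ^+ 2 + g t ^+ 2)).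
- by move=> T T0; apply: measurable_funM; [exact: fm|exact: gm].
- by move=> t; rewrite ler_norml; apply/andP; split; nra.
- exact: locintD.
Qed.

Lemma l2loc_int f : l2loc f -> locint f.
Proof.
move=> fl; apply: locint_ext (l2locM (l2loc_cont (@loccont_cst R 1)) fl) => t _.
by rewrite mul1r.
Qed.

Lemma l2locD f g : l2loc f -> l2loc g -> l2loc (fun t => f t + g t).
Proof.
move=> fl gl; split=> [T T0|].
  by apply: measurable_funD; [exact: fl.1|exact: gl.1].
apply: locint_ext (locintD (locintD fl.2 gl.2) (locintZ 2 (l2locM fl gl))) => t _.
by ring.
Qed.

Lemma l2locZ c f : l2loc f -> l2loc (fun t => c * f t).
Proof.
move=> fl; split=> [T T0|].
  by apply: measurable_funM; [exact: measurable_cst|exact: fl.1].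
by apply: locint_ext (locintZ (c ^+ 2) fl.2) => t _; ring.
Qed.

Lemma l2loc_ext f g : (forall t, f t = g t) -> l2loc f -> l2loc g.
Proof. by move=> fg; rewrite (_ : g = f) //; apply/funext => t. Qed.

Lemma l2loc_sum (I : Type) (r : seq I) (F : I -> R -> R) :
  (forall i, l2loc (F i)) -> l2loc (fun t => \sum_(i <- r) F i t).
Proof.
move=> Fi; elim: r => [|i r IH].
  by apply: l2loc_ext (l2loc_cont (@loccont_cst R 0)) => t; rewrite big_nil.
by apply: l2loc_ext (l2locD (Fi i) IH) => t; rewrite big_cons.
Qed.

Definition l2_mx m n (f : R -> 'M[R]_(m, n)) := forall i j, l2loc (fun t => f t i j).

Lemma l2_mxD m n (f g : R -> 'M[R]_(m, n)) :
  l2_mx f -> l2_mx g -> l2_mx (fun t => f t + g t).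
Proof.
by move=> fl gl i j; apply: l2loc_ext (l2locD (fl i j) (gl i j)) => t; rewrite mxE.
Qed.

Lemma l2_mxMl m n p (M : 'M[R]_(m, n)) (f : R -> 'M[R]_(n, p)) :
  l2_mx f -> l2_mx (fun t => M *m f t).
Proof.
move=> fl i j.
apply: l2loc_ext (l2loc_sum (index_enum 'I_n) (fun k => l2locZ (M i k) (fl k j))) => t.
by rewrite mxE.
Qed.

Lemma l2_mx_tr m n (f : R -> 'M[R]_(m, n)) : l2_mx f -> l2_mx (fun t => (f t)^T).
Proof. by move=> fl i j; apply: l2loc_ext (fl j i) => t; rewrite mxE. Qed.

Lemma l2_mx_prim m n (F f : R -> 'M[R]_(m, n)) : prim_mx F f -> l2_mx F.
Proof. by move=> pF i j; apply: l2loc_cont (prim_cont (pF i j)). Qed.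

Lemma l2_mx_int m n (f : R -> 'M[R]_(m, n)) : l2_mx f -> locint_mx f.
Proof. by move=> fl i j; apply: l2loc_int. Qed.

Lemma locint_sqn n (f : R -> 'cV[R]_n) : l2_mx f -> locint (fun t => sqn (f t)).
Proof.
move=> fl.
have := locint_sum (index_enum 'I_n) (fun i => (fl i 0).2).
by apply: locint_ext => t _; rewrite sqnE.
Qed.

Lemma L2e_l2 n (f : R -> 'cV[R]_n) : L2e f -> l2_mx f.
Proof.
move=> fl i j; rewrite ord1; have [fm fi] := fl i; split=> [T T0|T T0]; last exact: fi.
apply: measurable_funS fm => //; apply: subset_itvl; rewrite bnd_simp //.
Qed.

Lemma prim_bf n (M : 'M[R]_n) (x f : R -> 'cV[R]_n) : prim_mx x f ->
  prim (fun t => bf M (x t) (x t)) (fun t => bf M (f t) (x t) + bf M (x t) (f t)).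
Proof.
move=> px; have := prim_mxM (prim_mxMr M (prim_mx_tr px)) px => /(_ 0 0).
by apply: prim_ext => t _; rewrite // mxE.
Qed.

Lemma prim_int (f : R -> R) : locint f -> prim (fun t => \int[mu]_(s in `[0, t]) f s) f.
Proof.
by move=> fi; split=> // t t0; rewrite set_itv1 Rintegral_set1 add0r.
Qed.

(** Adding to the storage of the interconnection a storage [V] of the uncertainty
    cancels the supply [Q]; the uncertainty is dissipative only up to [e], which
    disappears in the limit because [a] and [b] do not depend on it. *)
Lemma energy_estimate n (X : 'M[R]_n) (x f : R -> 'cV[R]_n) (phi Q a b : R -> R) :
  X^T = X -> prim_mx x f -> locint phi -> locint b ->
  {ae mu, forall t, 0 <= t -> 2 * bf X (x t) (f t) + Q t <= - phi t} ->
  (forall e, 0 < e -> exists V v, [/\ prim V v, V 0 = 0,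
     forall t, 0 <= t -> - (e * a t) <= V t &
     forall t, 0 <= t -> v t <= Q t + e * b t]) ->
  forall T, 0 <= T ->
    bf X (x T) (x T) + \int[mu]_(s in `[0, T]) phi s <= bf X (x 0) (x 0).
Proof.
move=> Xs px phii bi diss stor T T0.
pose Phi t := \int[mu]_(s in `[0, t]) phi s.
pose Psi t := \int[mu]_(s in `[0, t]) b s.
suff H e : 0 < e -> bf X (x T) (x T) + Phi T <= bf X (x 0) (x 0) + e * (a T + Psi T).
  rewrite leNgt; apply/negP => lt.
  pose d := bf X (x T) (x T) + Phi T - bf X (x 0) (x 0).
  have d0 : 0 < d by rewrite subr_gt0.
  have dE : d = bf X (x T) (x T) + Phi T - bf X (x 0) (x 0) by [].
  clearbody d.
  pose c := `|a T + Psi T| + 1; have c0 : 0 < c by rewrite ltr_wpDl.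
  have := H (d / (2 * c)) _; rewrite divr_gt0 ?mulr_gt0 // => /(_ isT).
  have : d / (2 * c) * (a T + Psi T) <= d / (2 * c) * c.
    rewrite ler_wpM2l ?divr_ge0 ?(ltW d0) ?mulr_ge0 ?(ltW c0) //.
    by rewrite (le_trans (ler_norm _)) // lerDl.
  have -> : d / (2 * c) * c = d / 2 by field; rewrite gt_eqF.
  by move: (d / (2 * c) * _) => h; lra.
move=> e0; have [V [v [pV V0 Va vb]]] := stor e e0.
have pS := primD (prim_bf X px) pV.
have pG := primD (prim_cst (bf X (x 0) (x 0)))
  (primD (primZ (-1) (prim_int phii)) (primZ e (prim_int bi))).
have := @prim_le _ _ _ _ _ pS pG.
rewrite !set_itv1 !Rintegral_set1 V0 !mulr0 !addr0 => /(_ (lexx _)) H.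
have {}H : bf X (x T) (x T) + V T <= bf X (x 0) (x 0) + (-1 * Phi T + e * Psi T).
  apply: H => //; apply: (@filterS _ _ (ae_filter_ringOfSetsType mu) _ _ _ diss).
  move=> t h1 t0; have := h1 t0; have := vb t t0.
  by rewrite (bf_sym (f t) (x t) Xs); lra.
have := Va T T0; lra.
Qed.

(** The derivative of [|x|^2] is dominated by the integrable [|x|^2 + |w|^2].
    Hence [|x|^2] varies little over the late windows [t - 1, t], on which its
    mean is small. *)
Lemma l2_decay n m (A : 'M[R]_n) (B : 'M[R]_(n, m)) (x : R -> 'cV[R]_n)
    (w : R -> 'cV[R]_m) K :
  l2_mx w -> prim_mx x (fun t => A *m x t + B *m w t) ->
  (forall T, 0 <= T -> \int[mu]_(s in `[0, T]) (sqn (x s) + sqn (w s)) <= K) ->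
  enorm (x t) @[t --> +oo] --> (0 : R).
Proof.
move=> wl px PK; pose phi t := sqn (x t) + sqn (w t).
have xl := l2_mx_prim px.
have phii : locint phi by apply: locintD; exact: locint_sqn.
have phi0 t : 0 <= phi t by rewrite addr_ge0 ?sqn_ge0.
pose Phi t := \int[mu]_(s in `[0, t]) phi s.
have int_ge0 s t : 0 <= \int[mu]_(r in `[s, t]) phi r by exact: Rintegral_ge0.
have Phi_mono s t : 0 <= s -> s <= t -> Phi s <= Phi t.
  by move=> s0 st; rewrite -subr_ge0 -(Rint_split phii).
have [c c0 cP] : exists2 c, 0 < c & forall t,
    bf 1%:M (A *m x t + B *m w t) (x t) + bf 1%:M (x t) (A *m x t + B *m w t) <= c * phi t.
  have [c1 c10 c1P] := bf_bound A; have [c2 c20 c2P] := bf_bound B.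
  exists (2 * (2 * c1 + c2)) => [|t]; first by rewrite mulr_gt0 // addr_gt0 // mulr_gt0.
  rewrite (bf_sym _ (x t)) ?trmx1 // bfDr -!bf_mulr !mul1mx /phi.
  have := c1P (x t) (x t); have := c2P (x t) (w t).
  have := ler_norm (bf A (x t) (x t)); have := ler_norm (bf B (x t) (w t)).
  have : 0 <= c1 * sqn (w t) by rewrite mulr_ge0 ?sqn_ge0 // ltW.
  nra.
have py := prim_bf 1%:M px.
have incr s t : 0 <= s -> s <= t -> sqn (x t) <= sqn (x s) + c * (Phi t - Phi s).
  move=> s0 st; rewrite -lerBlDl.
  have [yi yE] := py.
  have -> : sqn (x t) - sqn (x s) = \int[mu]_(r in `[s, t])
     (bf 1%:M (A *m x r + B *m w r) (x r) + bf 1%:M (x r) (A *m x r + B *m w r)).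
    by rewrite (Rint_split yi) // /sqn (yE t) ?(yE s) ?(le_trans s0) //; ring.
  rewrite -(Rint_split phii) // -RintegralZl //; last exact: locint_sub.
  by apply: le_Rintegral => //; [exact: locint_sub|exact: locint_sub (locintZ c phii) _ _].
have tail : forall d, 0 < d -> exists2 T0, 0 <= T0 &
    forall s t, T0 <= s -> s <= t -> Phi t - Phi s <= d.
  move=> d d0; pose S : set R := [set y | exists2 t, 0 <= t & Phi t = y].
  have Sup : has_sup S.
    by split; [exists (Phi 0), 0|exists K => _ [t t0 <-]; exact: PK].
  have [_ [t1 t10 <-] h] := sup_adherent d0 Sup.
  exists t1 => // s t s1 st.
  have : Phi t <= sup S.
    apply: sup_ubound; first exact: Sup.2.
    by exists t => //; rewrite (le_trans t10) // (le_trans s1).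
  by have := Phi_mono t1 s t10 s1; lra.
have small d : 0 < d -> exists2 T0, 0 <= T0 & forall t, T0 <= t -> sqn (x t) <= (1 + c) * d.
  move=> d0; have [T0 T00 T0P] := tail d d0; exists (T0 + 1) => [|t tT].
    by rewrite addr_ge0.
  have s0 : T0 <= t - 1 by rewrite lerBrDr.
  have s00 : 0 <= t - 1 by exact: le_trans s0.
  have st : t - 1 <= t by rewrite gerBl.
  have : \int[mu]_(r in `[t - 1, t]) (sqn (x t) - c * d) <= \int[mu]_(r in `[t - 1, t]) phi r.
    have i1 : mu.-integrable `[t - 1, t] (EFin \o fun=> sqn (x t) - c * d).
      by apply: locint_sub => //; apply: locint_cont; exact: loccont_cst.
    apply: (le_Rintegral _ i1 (locint_sub phii s00 st)) => // r.
    rewrite /= in_itv /= => /andP[r1 rt].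
    have := incr r t (le_trans s00 r1) rt.
    have : c * (Phi t - Phi r) <= c * d by rewrite ler_pM2l // T0P // (le_trans s0).
    by have := sqn_ge0 (w r); rewrite /phi; lra.
  have mu1 : mu `[t - 1, t] = 1%E.
    by rewrite lebesgue_measure_itv /= lte_fin gtrBl ltr01 -EFinB opprB addrC subrK.
  rewrite (Rint_split phii) // Rintegral_cst // [X in fine X]mu1 mulr1.
  by have := T0P (t - 1) t s0 st; rewrite -/(Phi t) -/(Phi (t - 1)); lra.
apply/cvgrPdist_lt => e e0.
have c1 : 0 < 2 * (1 + c) by rewrite mulr_gt0 // addr_gt0.
have [|T0 T00 T0P] := small (e ^+ 2 / (2 * (1 + c))); first by rewrite divr_gt0 // exprn_gt0.
exists T0; split; first by rewrite num_real.
move=> t /ltW tT; rewrite sub0r normrN ger0_norm ?sqrtr_ge0 //.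
rewrite -(@ltr_pXn2r _ 2) ?nnegrE ?sqrtr_ge0 ?(ltW e0) // /enorm -sqnE.
rewrite sqr_sqrtr ?sqn_ge0 //; apply: le_lt_trans (T0P t tT) _.
have -> : (1 + c) * (e ^+ 2 / (2 * (1 + c))) = e ^+ 2 / 2.
  by field; rewrite gt_eqF // addr_gt0.
by rewrite ltr_pdivrMr // ltr_pMr ?exprn_gt0 // ltr1n.
Qed.

End Energy.

(** * The interconnection *)

Section Interconnection.
Variable R : realType.

Lemma negdef_coercive n (M : 'M[R]_n) : negdefmx M ->
  exists2 e, 0 < e & forall x, bf M x x <= - (e * sqn x).
Proof.
move=> [Ms Mn]; have [|e e0 eP] := @posdef_coercive _ _ (- M).
  split=> [|x x0]; first by rewrite linearN /= Ms.
  by rewrite -/(bf _ _ _) bf_oppm oppr_gt0; exact: Mn.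
by exists e => // x; have := eP x; rewrite bf_oppm; lra.
Qed.

(** Pointwise dissipation along the filtered interconnection: the terminal cost
    [multP P0 Y] turns the two matrix inequalities into one whose supply is the
    sum over the channels of the quadratic form of [P0]. *)
Lemma interconnection_dissipation n k nu npsi mpsi
    (A : 'M[R]_n) (B : 'M[R]_(n, k)) (C : 'M[R]_(k, n)) (D : 'M[R]_k)
    (P0 : 'M[R]_(nu + nu))
    (Apsi : 'M[R]_npsi) (Bpsi : 'M[R]_(npsi, k))
    (Cpsi : 'M[R]_(mpsi, npsi)) (Dpsi : 'M[R]_(mpsi, k))
    (X : 'M[R]_(npsi + npsi + n)) (Y : 'M[R]_(nu * npsi)) (M : 'M[R]_(nu * mpsi))
    (G := filter_outer nu Apsi Bpsi Cpsi Dpsi)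
    (H := system_outer A B C D Apsi Bpsi Cpsi Dpsi)
    (Xt := X - block_mx (multP P0 Y) 0 0 0) :
  posdefmx (G^T *m lmi_middle Y M *m G) ->
  negdefmx (H^T *m lmi_middle X (multP P0 M) *m H) -> posdefmx Xt ->
  exists2 e0, 0 < e0 & exists r (E : 'I_r -> 'M[R]_(npsi, nu)) (F : 'I_r -> 'M[R]_(k, nu)),
  forall xz xw x w, let z := C *m x + D *m w in
    let xs := col_mx (col_mx xz xw) x in
    let f := col_mx (col_mx (Apsi *m xz + Bpsi *m z) (Apsi *m xw + Bpsi *m w))
                    (A *m x + B *m w) in
    2 * bf Xt xs f +
      (\sum_c let s := col_mx (xz^T *m E c + z^T *m F c)^T (xw^T *m E c + w^T *m F c)^T in
              bf P0 s s) <= - (e0 * (sqn xs + sqn w)).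
Proof.
move=> Gp Hn Xp; have [e0 e00 e0P] := negdef_coercive Hn.
have [r [E [F EF]]] := filter_channels P0 (posdef_psd Gp).
exists e0 => //; exists r, E, F => xz xw x w /=.
set z := C *m x + D *m w; set xs := col_mx (col_mx xz xw) x; set f := col_mx _ (A *m x + B *m w).
have := e0P (col_mx xs w); rewrite sqn_col_mx; apply: le_trans.
rewrite bf_mul system_outer_mul lmi_middle_form -/z -/xs -/f.
have := EF xz xw z w; rewrite /= => <-.
have XtE u v : bf Xt u v = bf X u v - bf (block_mx (multP P0 Y) 0 0 0) u v by rewrite bf_subm.
have -> : 2 * bf Xt xs f = bf Xt xs f + bf Xt f xs by rewrite (bf_sym f xs Xp.1); ring.
rewrite !XtE /xs /f !bf_block !bf_0m.
by rewrite le_eqVlt; apply/orP; left; apply/eqP; ring.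
Qed.

Local Open Scope complex_scope.

(** A kernel vector of [1 - D W], [W = v I], gives an input [wc = v zc] with
    [zc = D wc] at the zero state. The supply of its real and imaginary parts is
    negative by dissipation, and their sum is nonnegative because [v] lies in the
    region. *)
Lemma interconnection_well_posed n k nu npsi
    (A : 'M[R]_n) (B : 'M[R]_(n, k)) (C : 'M[R]_(k, n)) (D : 'M[R]_k)
    (P0 : 'M[R]_(nu + nu)) (Apsi : 'M[R]_npsi) (Bpsi : 'M[R]_(npsi, k))
    (Xt : 'M[R]_(npsi + npsi + n)) e0 r
    (E : 'I_r -> 'M[R]_(npsi, nu)) (F : 'I_r -> 'M[R]_(k, nu)) :
  0 < e0 ->
  (forall xz xw x w, let z := C *m x + D *m w in
    let xs := col_mx (col_mx xz xw) x in
    let f := col_mx (col_mx (Apsi *m xz + Bpsi *m z) (Apsi *m xw + Bpsi *m w))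
                    (A *m x + B *m w) in
    2 * bf Xt xs f +
      (\sum_c let s := col_mx (xz^T *m E c + z^T *m F c)^T (xw^T *m E c + w^T *m F c)^T in
              bf P0 s s) <= - (e0 * (sqn xs + sqn w))) ->
  well_posed D (scalar_values k P0).
Proof.
move=> e00 diss W [v [WE vin]]; apply/negP; rewrite -det_tr.
move=> /det0P[u u0 /(congr1 trmx)]; rewrite trmx_mul trmxK trmx0.
rewrite WE mulmxBl mul1mx -mulmxA mul_scalar_mx => /eqP; rewrite subr_eq0 => /eqP zE.
set zc := u^T in zE; pose wc := v *: zc.
have [wr [wi wcE]] : exists wr wi, wc = cmx wr wi by do 2 eexists; exact: cmxP.
have [zr [zi zcE]] : exists zr zi, zc = cmx zr zi by do 2 eexists; exact: cmxP.
have [zrE ziE] : zr = D *m wr /\ zi = D *m wi.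
  by apply: cmx_inj; rewrite -zcE -cplxmx_mul_cmx -wcE.
pose supply w := \sum_c (let s := col_mx ((D *m w)^T *m F c)^T (w^T *m F c)^T in bf P0 s s).
have stat w : supply w <= - (e0 * sqn w).
  have := diss 0 0 0 w; rewrite /= mulmx0 add0r !col_mx0 bf0l mulr0 add0r.
  rewrite [X in X + sqn w]bf0l add0r => h; apply: le_trans h.
  rewrite le_eqVlt; apply/orP; left; apply/eqP; apply: eq_bigr => c _.
  by rewrite /= !trmx0 !mul0mx ?mulmx0 !add0r.
have pos : 0 <= supply wr + supply wi.
  rewrite -big_split sumr_ge0 // => c _ /=; apply: (in_region_real vin).
  rewrite -zrE -ziE !trmx_mul !trmxK -!cplxmx_mul_cmx -wcE -zcE.
  by rewrite /wc scalemxAr.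
have h1 := stat wi; have h2 := stat wr.
have wr0 : wr = 0.
  apply/eqP; rewrite -sqn_eq0 eq_le sqn_ge0 andbT -(pmulr_rle0 _ e00).
  have : 0 <= e0 * sqn wi by rewrite mulr_ge0 ?sqn_ge0 // ltW.
  lra.
have wi0 : wi = 0.
  apply/eqP; rewrite -sqn_eq0 eq_le sqn_ge0 andbT -(pmulr_rle0 _ e00).
  have : 0 <= e0 * sqn wr by rewrite mulr_ge0 ?sqn_ge0 // ltW.
  lra.
move/eqP: u0; apply; apply: trmx_inj; rewrite -/zc zcE zrE ziE wr0 wi0 mulmx0 trmx0.
by apply/matrixP => i j; rewrite !mxE.
Qed.

End Interconnection.

Section Channels.
Local Open Scope classical_set_scope.
Local Open Scope ring_scope.
Variable R : realType.
Local Notation mu := (@lebesgue_measure R).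

Lemma prim_mx_vecc m n (F f : R -> 'M[R]_(m, n)) : prim_mx F f ->
  prim_mx (fun t => vecc (F t)) (fun t => vecc (f t)).
Proof.
move=> pF i j; rewrite ord1; case/mxvec_indexP: i => i' j'.
by apply: prim_ext (pF i' j') => t _; rewrite mxE mxvecE.
Qed.

Lemma prim_mx_col_mx m1 m2 (F f : R -> 'cV[R]_m1) (G g : R -> 'cV[R]_m2) :
  prim_mx F f -> prim_mx G g ->
  prim_mx (fun t => col_mx (F t) (G t)) (fun t => col_mx (f t) (g t)).
Proof.
move=> pF pG i j; rewrite ord1; case: (fintype.split_ordP i) => i' ->.
  by apply: prim_ext (pF i' 0) => t _; rewrite col_mxEu.
by apply: prim_ext (pG i' 0) => t _; rewrite col_mxEd.
Qed.

(** Filtering the input and the output of an admissible uncertainty, and the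
    energy its channels store. Without input channels all signals vanish.
    Otherwise the scalar transfer function commutes with the filter: the filter
    state [xw] driven by [w] is the scalar system applied to [xz], because the
    defect [Th' - Th Apsi^T - eta Bpsi^T] solves [y' = A y], [y(0) = 0]. *)
Lemma uncertainty_channels k nu npsi (P0 : 'M[R]_(nu + nu))
    (Apsi : 'M[R]_npsi) (Bpsi : 'M[R]_(npsi, k)) (Delta : lti R k k)
    (z w : R -> 'cV[R]_k) r (E : 'I_r -> 'M[R]_(npsi, nu)) (F : 'I_r -> 'M[R]_(k, nu)) :
  P0^T = P0 -> (forall y, bf P0 (col_mx 0 y) (col_mx 0 y) <= 0) ->
  uncertainty_class (scalar_values k P0) Delta -> l2_mx z ->
  {ae mu, forall t, 0 <= t -> w t = lti_map Delta z t} ->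
  exists (xz xw : R -> 'cV[R]_npsi) (w' : R -> 'cV[R]_k),
    let Q t := \sum_c let s := col_mx ((xz t)^T *m E c + (z t)^T *m F c)^T
                                      ((xw t)^T *m E c + (w' t)^T *m F c)^T in bf P0 s s in
    [/\ xz 0 = 0 /\ xw 0 = 0,
        prim_mx xz (fun t => Apsi *m xz t + Bpsi *m z t),
        prim_mx xw (fun t => Apsi *m xw t + Bpsi *m w' t),
        {ae mu, forall t, 0 <= t -> w' t = w t} &
        exists a b, locint b /\ forall e, 0 < e -> exists V v,
          [/\ prim V v, V 0 = 0, forall t, 0 <= t -> - (e * a t) <= V t &
              forall t, 0 <= t -> v t <= Q t + e * b t]].
Proof.
move=> P0s R0n; case: k => [|k] in Bpsi Delta z w F *.
  move=> _ _ _; exists (fun=> 0), (fun=> 0), w => Q.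
  have B0 (u : 'cV[R]_0) : Bpsi *m u = 0 by rewrite [Bpsi]thinmx0 mul0mx.
  have p0 (u : R -> 'cV[R]_0) : prim_mx (fun=> 0 : 'cV[R]_npsi) (fun t => Apsi *m 0 + Bpsi *m u t).
    by apply: prim_mx_ext (prim_mx_cst 0) => // t _; rewrite B0 mulmx0 addr0.
  split=> //; try exact: p0.
    by apply/(@filterE _ _ (ae_filter_ringOfSetsType mu)).
  exists (fun=> 0), (fun=> 0); split; first exact: locint0.
  move=> e e0; exists (fun=> 0), (fun=> 0); split=> //.
  - exact: prim_cst.
  - by move=> t _; rewrite mulr0 oppr0.
  move=> t _; rewrite mulr0 addr0 /Q sumr_ge0 // => c _.
  have F0 (u : 'cV[R]_0) : u^T *m F c = 0 by rewrite [F c]flatmx0 mulmx0.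
  by rewrite !F0 !trmx0 !mul0mx addr0 trmx0 col_mx0 bf0l.
move=> Dclass zl wz.
have [p [q [d [[qm szd] qs axis infty Dreal]]]] := uncertainty_realization Dclass.
have [L Lp LP] := delta_storage P0s R0n qm szd qs axis infty.
set A := companion q in Dreal LP; set b := companion_in q in Dreal LP.
set c := \row__ _ in Dreal LP.
pose zT t := (z t)^T.
have zTl : l2_mx zT by exact: l2_mx_tr.
pose eta := ode_sol A (fun s => b *m zT s).
have peta : prim_mx eta (fun t => A *m eta t + b *m zT t).
  by apply: ode_solP; apply: l2_mx_int; exact: l2_mxMl.
pose xz := ode_sol Apsi (fun s => Bpsi *m z s).
have pxz : prim_mx xz (fun t => Apsi *m xz t + Bpsi *m z t).
  by apply: ode_solP; apply: l2_mx_int; exact: l2_mxMl.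
have pxzT := prim_mx_tr pxz.
pose Th := ode_sol A (fun s => b *m (xz s)^T).
have pTh : prim_mx Th (fun t => A *m Th t + b *m (xz t)^T).
  apply: ode_solP; apply: l2_mx_int; apply: l2_mxMl; exact: l2_mx_prim pxzT.
have xz0 : xz 0 = 0 by exact: ode_sol0.
have Th0 : Th 0 = 0 by exact: ode_sol0.
have eta0 : eta 0 = 0 by exact: ode_sol0.
have etaE : eta = ode_sol A (fun s => b *m zT s) by [].
clearbody Th; clearbody xz eta.
have trD m n (U V : 'M[R]_(m, n)) : (U + V)^T = U^T + V^T by exact: linearD.
have commute t : 0 <= t ->
    A *m Th t + b *m (xz t)^T = Th t *m Apsi^T + eta t *m Bpsi^T.
  pose Fo t := A *m Th t + b *m (xz t)^T + (Th t *m - Apsi^T + eta t *m - Bpsi^T).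
  move=> t0; apply/eqP; rewrite -subr_eq0 opprD -!mulmxN -/(Fo t); apply/eqP.
  apply: (@ode_unique _ _ _ A Fo) => //; last first.
    by rewrite /Fo Th0 xz0 eta0 trmx0 !mulmx0 !mul0mx !addr0.
  apply: prim_mx_ext (prim_mxD (prim_mxD (prim_mxMl A pTh) (prim_mxMl b pxzT))
    (prim_mxD (prim_mxMr (- Apsi^T) pTh) (prim_mxMr (- Bpsi^T) peta))) => s _ //.
  rewrite trD !trmx_mul -/(zT s).
  have -> : (A *m Th s + b *m (xz s)^T) *m - Apsi^T =
      A *m (Th s *m - Apsi^T) - b *m ((xz s)^T *m Apsi^T).
    by rewrite mulmxDl -!mulmxA !mulmxN.
  have -> : (A *m eta s + b *m zT s) *m - Bpsi^T =
      A *m (eta s *m - Bpsi^T) - b *m (zT s *m Bpsi^T).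
    by rewrite mulmxDl -!mulmxA !mulmxN.
  have cancel_uv (V : zmodType) (X1 u v x y : V) :
      X1 + (u + v) + ((x - u) + (y - v)) = X1 + (x + y).
    by rewrite -addrA; congr (_ + _); rewrite addrACA ![_ + (_ - _)]addrC !subrK.
  by rewrite /Fo (mulmxDr b) cancel_uv -!mulmxDr.
pose w' t := (c *m eta t + d *: zT t)^T.
pose xw t := (c *m Th t + d *: (xz t)^T)^T.
have pZ m n (G g : R -> 'M[R]_(m, n)) : prim_mx G g ->
    prim_mx (fun t => d *: G t) (fun t => d *: g t).
  by move=> pG i j; apply: prim_ext (primZ d (pG i j)) => t _; rewrite mxE.
exists xz, xw, w' => Q; split.
- by rewrite /xw Th0 xz0 mulmx0 trmx0 scaler0 addr0 trmx0.
- exact: pxz.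
- apply: prim_mx_ext (prim_mx_tr (prim_mxD (prim_mxMl c pTh) (pZ _ _ _ _ pxzT))) => t t0 //.
  rewrite commute // -[RHS]trmxK; congr trmx.
  have -> : (Apsi *m xz t + Bpsi *m z t)^T = (xz t)^T *m Apsi^T + zT t *m Bpsi^T.
    by rewrite trD !trmx_mul.
  have -> : (Apsi *m xw t + Bpsi *m w' t)^T =
      (c *m Th t + d *: (xz t)^T) *m Apsi^T + (c *m eta t + d *: zT t) *m Bpsi^T.
    by rewrite trD !trmx_mul !trmxK.
  by rewrite mulmxDr scalerDr !mulmxDl !mulmxA !scalemxAl addrACA.
- move: wz; apply: filterS; first exact: (ae_filter_ringOfSetsType mu).
  move=> t h t0; rewrite h // /w' -[RHS]trmxK; congr trmx.
  by rewrite (lti_map_scalar t0 (l2_mx_int zl) Dreal) etaE.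
pose Si ch t := Th t *m E ch + eta t *m F ch.
pose u ch t := (xz t)^T *m E ch + zT t *m F ch.
have pSi ch : prim_mx (Si ch) (fun t => A *m Si ch t + b *m u ch t).
  apply: prim_mx_ext (prim_mxD (prim_mxMr (E ch) pTh) (prim_mxMr (F ch) peta)) => t _ //.
  by rewrite /Si /u !mulmxDl !mulmxDr !mulmxA addrACA.
have ul ch : l2_mx (u ch).
  apply: l2_mxD; first by apply: l2_mx_prim (prim_mxMr (E ch) pxzT).
  have := l2_mx_tr (l2_mxMl (F ch)^T zl); congr l2_mx.
  by apply/funext => t; rewrite trmx_mul trmxK.
have out ch t : 0 <= t -> ((xw t)^T *m E ch + (w' t)^T *m F ch) = c *m Si ch t + d *: u ch t.
  move=> t0; rewrite /xw /w' !trmxK /Si /u !mulmxDl mulmxDr scalerDr !mulmxA !scalemxAl.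
  by rewrite addrACA.
exists (fun t => \sum_ch bf L (vecc (Si ch t)) (vecc (Si ch t))),
  (fun t => \sum_ch (sqn (vecc (Si ch t)) + sqn (u ch t)^T)); split.
  apply: locint_sum => ch; apply: locintD; apply: locint_sqn.
    exact: l2_mx_prim (prim_mx_vecc (pSi ch)).
  exact: l2_mx_tr.
move=> e e0; have [Z Zs [Z1 Z2]] := LP e e0.
exists (fun t => \sum_ch bf Z (vecc (Si ch t)) (vecc (Si ch t))).
eexists; split.
- apply: prim_sum => ch; exact: prim_bf (prim_mx_vecc (pSi ch)).
- rewrite big1 // => ch _; rewrite /Si Th0 eta0 !mul0mx addr0 linear0.
  exact: bf0l.
- move=> t t0; rewrite mulr_sumr -sumrN; apply: ler_sum => ch _; exact: Z2.
move=> t t0 /=; rewrite mulr_sumr -big_split /=; apply: ler_sum => ch _.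
have := Z1 (Si ch t) (u ch t); rewrite /= -out //.
by rewrite (bf_sym _ (vecc (Si ch t)) Zs); lra.
Qed.

End Channels.

Lemma enorm_sqn (R : realType) n (x : 'cV[R]_n) : enorm x = Num.sqrt (sqn x).
Proof. by rewrite /enorm sqnE. Qed.

Section Trajectory.
Local Open Scope classical_set_scope.
Local Open Scope ring_scope.
Variable R : realType.
Local Notation mu := (@lebesgue_measure R).

Lemma trajectory_prim n k l (A : 'M[R]_n) (B : 'M[R]_(n, l)) (C : 'M[R]_(k, n)) (D : 'M[R]_(k, l))
    (Delta : lti R l k) x0 x w z : trajectory A B C D Delta x0 x w z ->
  x 0 = x0 /\ prim_mx x (fun t => A *m x t + B *m w t).
Proof.
move=> [[wl _] xc xE _ _].
have x00 : x 0 = x0 by rewrite xE // mxRintegral0 addr0.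
have xl : l2_mx x.
  move=> i j; rewrite ord1; apply: l2loc_cont => T T0.
  apply: continuous_subspaceW (xc i); apply: subset_itvl; rewrite bnd_simp //.
have fi : locint_mx (fun t => A *m x t + B *m w t).
  by apply: l2_mx_int; apply: l2_mxD; apply: l2_mxMl => //; exact: L2e_l2.
split=> // i j; split; first exact: fi.
by move=> t t0; rewrite xE // x00 !mxE.
Qed.

End Trajectory.

Theorem theorem10 (R : realType) (n k nu npsi mpsi : nat)
    (A : 'M[R]_n) (B : 'M[R]_(n, k)) (C : 'M[R]_(k, n)) (D : 'M[R]_k)
    (Q S R0 : 'M[R]_nu)
    (Apsi : 'M[R]_npsi) (Bpsi : 'M[R]_(npsi, k))
    (Cpsi : 'M[R]_(mpsi, npsi)) (Dpsi : 'M[R]_(mpsi, k)) :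
  let P0 : 'M[R]_(nu + nu) := block_mx Q S S^T R0 in
  let G := filter_outer nu Apsi Bpsi Cpsi Dpsi in
  let H := system_outer A B C D Apsi Bpsi Cpsi Dpsi in
  P0^T = P0 ->
  negsemidefmx R0 ->
  hurwitz Apsi ->
  (exists (X : 'M[R]_(npsi + npsi + n)) (Y : 'M[R]_(nu * npsi))
          (M : 'M[R]_(nu * mpsi)),
     [/\ X^T = X, Y^T = Y & M^T = M] /\
     [/\ posdefmx (G^T *m lmi_middle Y M *m G),
         negdefmx (H^T *m lmi_middle X (multP P0 M) *m H) &
         posdefmx (X - block_mx (multP P0 Y) 0 0 0)]) ->
  robustly_stable A B C D (scalar_values k P0).
Proof.
move=> P0 G H P0s [_ R0n] _ [X [Y [M [_ [Gp Hn Xp]]]]].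
set Xt := X - _ in Xp.
have [e0 e00 [r [E [F diss]]]] := interconnection_dissipation Gp Hn Xp.
split; first exact: interconnection_well_posed e00 diss.
have P0n y : bf P0 (col_mx 0 y) (col_mx 0 y) <= 0.
  by rewrite bf_block !(bf0l, bf0r) !add0r; exact: R0n.
have [e1 e10 e1P] := posdef_coercive Xp.
have [c c0 cP] := bf_upper Xt.
exists (Num.sqrt (c / e1)); first by rewrite sqrtr_gt0 divr_gt0.
move=> x0 Delta Dclass x w z traj.
have [xx0 px] := trajectory_prim traj.
have [[wL zL] _ _ zE wE] := traj.
have wl := L2e_l2 wL; have zl := L2e_l2 zL.
have [xz [xw [w' [[xz0 xw0] pxz pxw w'E [a [b [bi stor]]]]]]] :=
  @uncertainty_channels _ _ _ _ P0 Apsi Bpsi Delta z w r E F P0s P0n Dclass zl wE.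
pose xs t := col_mx (col_mx (xz t) (xw t)) (x t).
have pxs := prim_mx_col_mx (prim_mx_col_mx pxz pxw) px.
pose phi t := e0 * (sqn (xs t) + sqn (w t)).
have phii : locint phi.
  apply/locintZ/locintD; apply: locint_sqn => //; exact: l2_mx_prim pxs.
have energy := energy_estimate (proj1 Xp) pxs phii bi _ stor.
have {}energy T : 0 <= T ->
    bf Xt (xs T) (xs T) + Rintegral (@lebesgue_measure R) `[0, T]%classic phi <=
    bf Xt (xs 0) (xs 0).
  apply: energy.
  apply: (@filterS2 _ _ (ae_filter_ringOfSetsType (@lebesgue_measure R)) _ _ _ _ zE w'E).
  move=> t zt wt t0; have := diss (xz t) (xw t) (x t) (w t).
  by rewrite wt // [z t]zt.
have phi_ge0 t : 0 <= phi t by rewrite mulr_ge0 ?addr_ge0 ?sqn_ge0 // ltW.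
have xs0 : sqn (xs 0) = sqn (x 0).
  by rewrite /xs xz0 xw0 !sqn_col_mx [sqn (0 : 'cV_npsi)]bf0l !add0r.
have bound0 : bf Xt (xs 0) (xs 0) <= c * sqn (x 0).
  by rewrite -xs0 (le_trans (ler_norm _)).
have x_le t : sqn (x t) <= sqn (xs t).
  by rewrite /xs sqn_col_mx lerDr sqn_ge0.
split.
  apply: (l2_decay (A := A) (B := B) (w := w) (K := c * sqn (x 0) / e0)) => // T T0.
  have xwi : locint (fun t => sqn (x t) + sqn (w t)).
    by apply: locintD; apply: locint_sqn => //; exact: l2_mx_prim px.
  rewrite ler_pdivlMr // mulrC -RintegralZl //; last exact: xwi.
  apply: le_trans bound0; apply: le_trans (energy T T0).
  apply: (@le_trans _ _ (Rintegral (@lebesgue_measure R) `[0, T]%classic phi)).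
    apply: le_Rintegral => //; [exact: (locintZ e0 xwi)|exact: phii|].
    by move=> t _; rewrite ler_pM2l // lerD2r.
  by rewrite lerDr (posdef_psd Xp).2.
move=> T T0.
rewrite !enorm_sqn -sqrtrM ?divr_ge0 ?(ltW c0) ?(ltW e10) // ler_wsqrtr //.
rewrite mulrAC ler_pdivlMr // mulrC.
apply: le_trans bound0; apply: le_trans (energy T T0).
apply: (@le_trans _ _ (bf Xt (xs T) (xs T))); last first.
  by rewrite lerDl; apply: Rintegral_ge0 => t _; exact: phi_ge0.
by apply: le_trans (e1P _); rewrite ler_pM2l.
Qed.
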